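(* Let $F:\mathbb{C}^2\to\mathbb{C}^4$ be the map $F(x,y)=(x,\,y^2,\,xy^3,\,xy+y^3)$ and let $Y=\operatorname{Im}F$. Then $F$ is injective and proper, $Y$ is a surface which is not a complete intersection, $Y$ has an isolated singularity (at $0$), the complex link of $(Y,0)$ is contractible, and the link $\mathrm{lk}(Y,0)$ is simply connected. Consequently, Mumford's criterion (the link of a normal surface germ is simply connected if and only if the surface is non-singular) cannot be extended to surfaces with isolated singularity.
   Context: Real link. For an analytic germ $(Y,y)$, the (real) link is $\mathrm{lk}_\varepsilon(Y,y):=\rho^{-1}(\varepsilon)$, where $\rho:(Y,y)\to(\mathbb{R}_{\ge0},0)$ is a proper analytic function with $\rho^{-1}(0)=\{y\}$ (for instance, the distance function to $y$) and $\varepsilon>0$ is small enough. Up to homeomorphism it depends neither on $\rho$ nor on small $\varepsilon$, and it is denoted $\mathrm{lk}(Y,y)$. Complex link. Let $(Y,0)$ be a complex analytic space germ embedded in $(\mathbb{C}^N,0)$ and $g:(Y,0)\to(\mathbb{C},0)$ a holomorphic function germ. With $B_\varepsilon$ the ball of radius $\varepsilon$ and $D_\delta\subset\mathbb{C}$ the disc of radius $\delta$, both centred at $0$, the restriction $g_|:B_\varepsilon\cap g^{-1}(D_\delta\setminus\{0\})\to D_\delta\setminus\{0\}$ is a locally trivial fibration for $0<\delta\ll\varepsilon\ll1$; its fibre $g^{-1}(\lambda)\cap B_\varepsilon$, $0<|\lambda|\ll\varepsilon$, is the Milnor fibre of $g$. The complex link of $(Y,0)$ is the Milnor fibre of a general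 holomorphic function $g$ on $(Y,0)$, for instance the restriction to $Y$ of a general linear form on $\mathbb{C}^N$ (general: its differential at $0$ does not vanish on any limit at $0$ of tangent spaces to the positive-dimensional strata of a fixed Whitney stratification of $Y$). Its homotopy type does not depend on the choices. *)

(* Defs.v *)
From mathcomp Require Import all_boot all_order all_algebra.
From mathcomp Require Import all_classical all_reals all_analysis.
From mathcomp Require Import complex.

Set Implicit Arguments.
Unset Strict Implicit.
Unset Printing Implicit Defensive.

Import Order.TTheory GRing.Theory Num.Theory.
Import numFieldNormedType.Exports.

Local Open Scope classical_set_scope.
Local Open Scope ring_scope.

Definition complex_field (R : realType) : numClosedFieldType := R[i].

Section Homotopy.
Variables (R : realType) (T : topologicalType).
Implicit Types (A : set T) (x y : T).

Definition path_in A x y (c : R -> T) : Prop :=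
  [/\ {within `[0, 1], continuous c}, c 0 = x, c 1 = y
    & forall t : R, t \in `[0, 1] -> A (c t)].

Definition path_connected A : Prop :=
  A !=set0 /\ forall x y, A x -> A y -> exists c, path_in A x y c.

Definition null_homotopic A x (c : R -> T) : Prop :=
  exists H : R * R -> T,
    {within `[0, 1] `*` `[0, 1], continuous H} /\
    forall s t : R, s \in `[0, 1] -> t \in `[0, 1] ->
      [/\ A (H (s, t)), H (s, 0) = c s, H (s, 1) = x,
          H (0, t) = x & H (1, t) = x].

Definition simply_connected A : Prop :=
  path_connected A /\
  forall x c, path_in A x x c -> null_homotopic A x c.

Definition contractible A : Prop :=
  exists (x0 : T) (H : T * R -> T),
    [/\ A x0, {within A `*` `[0, 1], continuous H} &
    forall x, A x ->
      [/\ H (x, 0) = x, H (x, 1) = x0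
        & forall t : R, t \in `[0, 1] -> A (H (x, t))]].

End Homotopy.

(* Continuity is part of properness. *)
Definition proper_map (T U : topologicalType) (f : T -> U) : Prop :=
  continuous f /\ forall K : set U, compact K -> compact (f @^-1` K).

(* K stands for the field of complex numbers, complex_field R; the order of a
   numClosedFieldType is such that 0 < e means that e is a positive real. *)
Section Holomorphic.
Variable K : numClosedFieldType.

Definition monomial n (a : {ffun 'I_n -> nat}) (z : 'rV[K]_n) : K :=
  \prod_i z 0 i ^+ a i.

(* Sum of u over the multi-indices all of whose entries are < d. *)
Definition box_sum n (u : {ffun 'I_n -> nat} -> K) (d : nat) : K :=
  \sum_(a : {ffun 'I_n -> 'I_d}) u [ffun i => nat_of_ord (a i)].

(* The germ of f at p lies in the ring of convergent power series at p:
   on a neighbourhood of p, f is the sum of an absolutely convergent series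
   of monomials in z - p. *)
Definition holomorphic_at n (f : 'rV[K]_n -> K) (p : 'rV[K]_n) : Prop :=
  exists c : {ffun 'I_n -> nat} -> K, \forall z \near p,
    (exists M : K, forall d,
       box_sum (fun a => `|c a * monomial a (z - p)|) d <= M) /\
    box_sum (fun a => c a * monomial a (z - p)) @ \oo --> f z.

Definition holomorphic_map_at n m (f : 'rV[K]_n -> 'rV[K]_m) p : Prop :=
  forall j, holomorphic_at (fun z => f z 0 j) p.

End Holomorphic.

Section Analytic.
Variables (R : realType) (K : numClosedFieldType) (N : nat).
Local Notation V := 'rV[K]_N.
Implicit Types (Y S : set V) (p q : V) (d : nat).

(* 'rV_N carries the sup norm, hence the explicit Euclidean distance. *)
Definition eucl_dist (z w : V) : K :=
  sqrtC (\sum_i `|z 0 i - w 0 i| ^+ 2).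

Definition analytic_at Y p : Prop :=
  exists k (f : V -> 'rV[K]_k),
    holomorphic_map_at f p /\ \forall z \near p, Y z <-> f z = 0.

Definition analytic_subset Y : Prop := forall p, analytic_at Y p.

(* f is a holomorphic submersion at p onto C^(N - d) whose zero set is Y
   near p; v *m 'J f p is the value at v of the differential of f. *)
Definition submersive_equations d Y p (f : V -> 'rV[K]_(N - d)) : Prop :=
  [/\ (d <= N)%N, Y p, holomorphic_map_at f p, \rank ('J f p) = (N - d)%N
    & \forall z \near p, Y z <-> f z = 0].

Definition smooth_at d Y p : Prop :=
  exists f : V -> 'rV[K]_(N - d), submersive_equations Y p f.

Definition singular_at Y p : Prop := Y p /\ forall d, ~ smooth_at d Y p.

Definition isolated_singularity Y p : Prop :=
  singular_at Y p /\ \forall q \near p^', ~ singular_at Y q.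

(* Pure dimension d: the regular points of dimension d are dense. *)
Definition pure_dim d Y : Prop := Y `<=` closure [set q | smooth_at d Y q].

Definition surface Y : Prop :=
  [/\ Y !=set0, analytic_subset Y & pure_dim 2 Y].

Definition surface_germ Y p : Prop :=
  [/\ Y p, analytic_at Y p
    & \forall q \near p, Y q -> closure [set q' | smooth_at 2 Y q'] q].

Definition vanishing_germ Y p (f : V -> K) : Prop :=
  holomorphic_at f p /\ \forall z \near p, Y z -> f z = 0.

(* For a germ of dimension d: its ideal is generated by N - d elements. *)
Definition complete_intersection_at d Y p : Prop :=
  exists f : 'I_(N - d) -> V -> K,
    (forall i, vanishing_germ Y p (f i)) /\
    forall g, vanishing_germ Y p g ->
      exists h : 'I_(N - d) -> V -> K,
        (forall i, holomorphic_at (h i) p) /\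
        \forall z \near p, g z = \sum_i h i z * f i z.

Definition link Y p (e : K) : set V := Y `&` [set z | eucl_dist z p = e].

Definition simply_connected_link Y p : Prop :=
  exists2 e0 : K, 0 < e0 &
    forall e, 0 < e < e0 -> simply_connected R (link Y p e).

(* The rows of A form a basis of the tangent space at p of the d-dimensional
   submanifold S. *)
Definition tangent_basis d S p (A : 'M[K]_(d, N)) : Prop :=
  row_free A /\
  exists f : V -> 'rV[K]_(N - d),
    submersive_equations S p f /\ A *m 'J f p = 0.

(* Convergence of row spaces in the Grassmannian of d-planes in C^N, the
   quotient of the full-rank d x N matrices by change of basis. *)
Definition grassmann_cvg d (A : nat -> 'M[K]_(d, N)) (L : 'M[K]_(d, N)) :
    Prop :=
  [/\ forall n, row_free (A n), row_free L &
    exists B : nat -> 'M[K]_(d, N),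
      (forall n, (B n == A n)%MS) /\ B @ \oo --> L].

Definition whitney_a (A B : set V) : Prop :=
  forall a b q (x : nat -> V) (T : nat -> 'M[K]_(a, N)) (tau : 'M[K]_(a, N))
      (Tq : 'M[K]_(b, N)),
    B q -> (forall n, A (x n)) -> x @ \oo --> q ->
    (forall n, tangent_basis A (x n) (T n)) -> grassmann_cvg T tau ->
    tangent_basis B q Tq -> (Tq <= tau)%MS.

(* Limits of secants are taken in the projective space of lines of C^N. *)
Definition whitney_b (A B : set V) : Prop :=
  forall a q (x y : nat -> V) (T : nat -> 'M[K]_(a, N)) (tau : 'M[K]_(a, N))
      (l : V),
    B q -> (forall n, A (x n)) -> (forall n, B (y n)) ->
    x @ \oo --> q -> y @ \oo --> q ->
    (forall n, tangent_basis A (x n) (T n)) -> grassmann_cvg T tau ->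
    grassmann_cvg (fun n => x n - y n) l -> (l <= tau)%MS.

Record whitney_stratification Y (SS : set (set V)) : Prop := {
  strata_cover : \bigcup_(A in SS) A = Y;
  strata_disjoint : trivIset SS id;
  strata_locally_finite : forall p, exists2 U, nbhs p U &
    finite_set [set A | SS A /\ A `&` U !=set0];
  strata_smooth : forall A, SS A ->
    A !=set0 /\ exists d, forall q, A q -> smooth_at d A q;
  strata_analytic : forall A, SS A ->
    analytic_subset (closure A) /\ analytic_subset (closure A `\` A);
  strata_frontier : forall A B, SS A -> SS B ->
    B `&` closure A !=set0 -> B `<=` closure A;
  strata_whitney : forall A B, SS A -> SS B -> A <> B ->
    whitney_a A B /\ whitney_b A B }.

(* The differential of g at p does not vanish on any limit at p of tangent
   spaces to a positive-dimensional stratum. *)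
Definition general_at (SS : set (set V)) (g : V -> K) p : Prop :=
  forall A d (x : nat -> V) (T : nat -> 'M[K]_(d, N)) (tau : 'M[K]_(d, N)),
    SS A -> (0 < d)%N -> (forall n, A (x n)) -> x @ \oo --> p ->
    (forall n, tangent_basis A (x n) (T n)) -> grassmann_cvg T tau ->
    exists2 v : V, (v <= tau)%MS & 'd g p v != 0.

Definition milnor_fibre Y p (g : V -> K) (e : K) (lambda : K) : set V :=
  Y `&` [set z | eucl_dist z p <= e] `&` [set z | g z = lambda].

(* Every admissible choice of stratification and general function is
   allowed, as the complex link does not depend on them up to homotopy. *)
Definition contractible_complex_link Y p : Prop :=
  forall (SS : set (set V)) (g : V -> K),
    whitney_stratification Y SS ->
    holomorphic_at g p -> g p = 0 -> general_at SS g p ->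
    exists2 e0 : K, 0 < e0 & forall e, 0 < e < e0 ->
      exists2 delta : K, 0 < delta & forall lambda : K,
        0 < `|lambda| < delta ->
        contractible R (milnor_fibre Y p g e lambda).

End Analytic.

Definition mumford_criterion (R : realType) (K : numClosedFieldType)
    (G : forall N, set 'rV[K]_N -> 'rV[K]_N -> Prop) : Prop :=
  forall N (Y : set 'rV[K]_N) p, G N Y p ->
    (simply_connected_link R Y p <-> smooth_at 2 Y p).

(* Normal surface germs belong to this class: the singularity, if there is
   one, is isolated. *)
Definition surface_germ_isol (K : numClosedFieldType) N (Y : set 'rV[K]_N)
    (p : 'rV[K]_N) : Prop :=
  surface_germ Y p /\ \forall q \near p^', ~ singular_at Y q.

Definition F (K : numClosedFieldType) (z : 'rV[K]_2) : 'rV[K]_4 :=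
  let x := z 0 0 in let y := z 0 1 in
  \row_j [:: x; y ^+ 2; x * y ^+ 3; x * y + y ^+ 3]`_j.

(* Main.v *)
Require Import Defs.
From HB Require Import structures.
From mathcomp Require Import all_boot all_order all_algebra.
From mathcomp Require Import all_classical all_reals all_analysis.
From mathcomp Require Import complex.
From mathcomp Require Import ring lra.
Set Implicit Arguments. Unset Strict Implicit. Unset Printing Implicit Defensive.
Import Order.TTheory GRing.Theory Num.Theory.
Import numFieldNormedType.Exports.
Local Open Scope classical_set_scope.
Local Open Scope ring_scope.

(* Write (x, u, v, w) for the coordinates of C^4. The surface Y is cut out by
   v^2 = x^2 u^3, w^2 = (x + u)^2 u, v w = x u^2 (x + u), (x + u) v = x u w, and
   at each point other than 0 two of these equations have independent
   differentials. The secants of Y through 0 have limits spanning C^4, so every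
   function vanishing on Y has order at least 2 at 0: hence Y is singular at 0,
   and two generators of its ideal could not produce the independent quadratic
   parts of the equations for v^2, w^2 and v w.
   Link: |F|^2 increases strictly along the weighted rays s |-> (s^2 x, s y), so
   the link is a retract of C^2 minus the origin, which is simply connected.
   Complex link: if dg(0) killed e1, it would kill e1 and some (0, s, 0, t),
   which span a limit of tangent planes of Y; so generality forces dg(0) e1 <> 0.
   Then g(F(x, y)) = lambda has a solution x = phi(y) near 0, and the Milnor
   fibre {F(phi(y), y)} is star-shaped in the parameter y. *)

(** Hypotheses of holomorphy are exploited only through a two-point estimate: on the ball of radius
    s at p, f z - f w differs from its linear part by at most M s |z - w|. It lets secants control
    Jacobians, and it makes equations solvable by minimising a norm on a compact ball
    ([approx_zero]). Two obstacles shape the complex link. The stratification is arbitrary, so the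
    arc that yields the limit plane must be shown to meet a stratum of positive dimension
    arbitrarily near 0; this stratum may be a curve, whose tangent lines are merely contained in the
    tangent planes of Y, and a cluster line is then needed. Moreover the ball is round in C^4 while
    the contraction takes place in the parameter y: |F|^2 <= e^2 must survive although x = phi(y) is
    not homogeneous. Hence lambda is small relative to e, and two regimes are separated, |y|^2 below
    or above a fixed multiple of e. For C^2 minus 0 the argument is general position in R^4: an edge
    of a polygon and the base point span a real subspace of dimension at most 3. *)

(* Makes it possible to estimate norms in the totally ordered field R, K being only partially ordered. *)
Record real_structure (R : realType) (K : numClosedFieldType) := RealStructure {
  of_real : {rmorphism R -> K};
  to_real : K -> R;
  of_real_le : {mono of_real : x y / x <= y};
  to_realK : forall x, x \is Num.real -> of_real (to_real x) = x }.

(** * Norms and coordinates with values in R *)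

Section RealNorm.
Variables (R : realType) (K : numClosedFieldType) (S : real_structure R K).

Definition cR (x : R) : K := of_real S x.
Definition re (z : K) : R := to_real S ('Re z).
Definition im (z : K) : R := to_real S ('Im z).

Lemma cRD x y : cR (x + y) = cR x + cR y. Proof. exact: rmorphD. Qed.
Lemma cRM x y : cR (x * y) = cR x * cR y. Proof. exact: rmorphM. Qed.
Lemma cR0 : cR 0 = 0. Proof. exact: rmorph0. Qed.
Lemma cR1 : cR 1 = 1. Proof. exact: rmorph1. Qed.
Lemma cRN x : cR (- x) = - cR x. Proof. exact: rmorphN. Qed.
Lemma cRB x y : cR (x - y) = cR x - cR y. Proof. exact: rmorphB. Qed.
Lemma cRX x n : cR (x ^+ n) = cR x ^+ n. Proof. exact: rmorphXn. Qed.
Lemma cRV x : cR x^-1 = (cR x)^-1. Proof. exact: fmorphV. Qed.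
Lemma cR_nat n : cR n%:R = n%:R. Proof. exact: rmorph_nat. Qed.
Lemma cR_le x y : (cR x <= cR y) = (x <= y). Proof. exact: of_real_le. Qed.
Lemma cR_inj : injective cR. Proof. exact: fmorph_inj. Qed.
Lemma cR_lt x y : (cR x < cR y) = (x < y).
Proof. by rewrite !lt_def cR_le (inj_eq cR_inj). Qed.
Lemma cR_eq0 x : (cR x == 0) = (x == 0).
Proof. by rewrite -cR0 (inj_eq cR_inj). Qed.
Lemma cR_sum (I : Type) (r : seq I) (P : pred I) (F : I -> R) :
  cR (\sum_(i <- r | P i) F i) = \sum_(i <- r | P i) cR (F i).
Proof. exact: rmorph_sum. Qed.
Lemma cR_real x : cR x \is Num.real.
Proof. by rewrite realE -cR0 !cR_le -realE num_real. Qed.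

Lemma ge0_cR (e : K) : 0 <= e -> exists2 r : R, 0 <= r & e = cR r.
Proof.
move=> e0; have E : cR (to_real S e) = e by apply: to_realK; apply: ger0_real.
by exists (to_real S e) => //; rewrite -cR_le E cR0.
Qed.

Lemma pos_cR (e : K) : 0 < e -> exists2 r : R, 0 < r & e = cR r.
Proof.
move=> e0; have [r r0 E] := ge0_cR (ltW e0); exists r => //.
by rewrite -cR_lt cR0 -E.
Qed.

Lemma cR_norm x : `|cR x| = cR `|x|.
Proof.
have [x0|x0] := leP 0 x; first by rewrite !ger0_norm // -cR0 cR_le.
by rewrite !ltr0_norm // ?cRN // -cR0 cR_lt.
Qed.

Lemma crect z : z = cR (re z) + 'i * cR (im z).
Proof. by rewrite /cR /re /im !to_realK ?Creal_Re ?Creal_Im // -Crect. Qed.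

Lemma re_rect x y : re (cR x + 'i * cR y) = x.
Proof. by apply: cR_inj; rewrite /re /cR to_realK ?Creal_Re // Re_rect // cR_real. Qed.
Lemma im_rect x y : im (cR x + 'i * cR y) = y.
Proof. by apply: cR_inj; rewrite /im /cR to_realK ?Creal_Im // Im_rect // cR_real. Qed.

Lemma cR_re z : cR (re z) = 'Re z. Proof. by rewrite /cR to_realK ?Creal_Re. Qed.
Lemma cR_im z : cR (im z) = 'Im z. Proof. by rewrite /cR to_realK ?Creal_Im. Qed.
Lemma reD x y : re (x + y) = re x + re y.
Proof. by apply: cR_inj; rewrite cRD !cR_re raddfD. Qed.
Lemma imD x y : im (x + y) = im x + im y.
Proof. by apply: cR_inj; rewrite cRD !cR_im raddfD. Qed.
Lemma re_cRM k x : re (cR k * x) = k * re x.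
Proof.
by rewrite {1}(crect x) mulrDr mulrCA -!cRM re_rect.
Qed.
Lemma im_cRM k x : im (cR k * x) = k * im x.
Proof. by rewrite {1}(crect x) mulrDr mulrCA -!cRM im_rect. Qed.

Section Norm.
Variable V : normedModType K.
Implicit Types v w : V.

Definition rn v : R := to_real S `|v|.

Lemma rnE v : `|v| = cR (rn v).
Proof. by rewrite /rn /cR to_realK // ger0_real. Qed.

Lemma rn_ge0 v : 0 <= rn v. Proof. by rewrite -cR_le -rnE cR0. Qed.
Lemma rn_le v r : (`|v| <= cR r) = (rn v <= r). Proof. by rewrite rnE cR_le. Qed.
Lemma rn_lt v r : (`|v| < cR r) = (rn v < r). Proof. by rewrite rnE cR_lt. Qed.
Lemma rnD v w : rn (v + w) <= rn v + rn w.
Proof. by rewrite -cR_le cRD -!rnE ler_normD. Qed.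
Lemma rnN v : rn (- v) = rn v.
Proof. by apply: cR_inj; rewrite -!rnE normrN. Qed.
Lemma rn0 : rn (0 : V) = 0.
Proof. by apply: cR_inj; rewrite -!rnE normr0 cR0. Qed.
Lemma rnB v w : rn (v - w) <= rn v + rn w.
Proof. by rewrite -(rnN w) rnD. Qed.
Lemma rn_distC v w : rn (v - w) = rn (w - v).
Proof. by rewrite -rnN opprB. Qed.
Lemma rn_eq0 v : (rn v == 0) = (v == 0).
Proof. by rewrite -[RHS]normr_eq0 rnE cR_eq0. Qed.
Lemma rn_gt0 v : (0 < rn v) = (v != 0).
Proof. by rewrite lt_def rn_ge0 andbT rn_eq0. Qed.

Lemma nearP_rn (P : V -> Prop) p :
  (\forall z \near p, P z) <-> exists2 e : R, 0 < e & forall z, rn (z - p) < e -> P z.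
Proof.
split.
  move/nbhs_ballP => [e /= /pos_cR[r r0 ->]] H; exists r => // z hz.
  by apply: H; rewrite -ball_normE /= distrC rn_lt.
move=> [e e0 H]; apply/nbhs_ballP; exists (cR e) => /=; first by rewrite -cR0 cR_lt.
by move=> z; rewrite -ball_normE /= distrC rn_lt; apply: H.
Qed.

Lemma nearPd_rn (P : V -> Prop) p :
  (\forall z \near p^', P z) <-> exists2 e : R, 0 < e & forall z, rn (z - p) < e -> z != p -> P z.
Proof.
rewrite /dnbhs; split.
  by move=> /nearP_rn[e e0 H]; exists e => // z h1 h2; apply: H.
by move=> [e e0 H]; apply/nearP_rn; exists e => // z h1 h2; apply: H.
Qed.

Lemma cvg_rnP {T} {F : set_system T} {FF : Filter F} (f : T -> V) (l : V) :
  (f @ F --> l) <-> forall e : R, 0 < e -> \forall t \near F, rn (f t - l) < e.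
Proof.
split.
  move=> /cvgrPdist_lt H e e0; have e0' : 0 < cR e by rewrite -cR0 cR_lt.
  by have := H _ e0'; apply: filterS => t; rewrite distrC rn_lt.
move=> H; apply/cvgrPdist_lt => _ /pos_cR[e e0 ->].
by apply: filterS (H _ e0) => t; rewrite distrC rn_lt.
Qed.

Lemma rnZE (k : K) (v : V) : rn (k *: v) = to_real S `|k| * rn v.
Proof. by apply: cR_inj; rewrite cRM -!rnE normrZ /cR to_realK // ger0_real. Qed.

End Norm.

Lemma rnZ (V : normedModType K) (k : K) (v : V) : rn (k *: v) = rn k * rn v.
Proof. exact: rnZE. Qed.
Lemma rnM (x y : K) : rn (x * y) = rn x * rn y.
Proof. by apply: cR_inj; rewrite cRM -!rnE normrM. Qed.
Lemma rnX (x : K) n : rn (x ^+ n) = rn x ^+ n.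
Proof. by apply: cR_inj; rewrite cRX -!rnE normrX. Qed.
Lemma rn1 : rn (1 : K) = 1.
Proof. by apply: cR_inj; rewrite -!rnE normr1 cR1. Qed.
Lemma rnV (x : K) : rn x^-1 = (rn x)^-1.
Proof. by apply: cR_inj; rewrite cRV -!rnE normfV. Qed.
Lemma rn_cR x : rn (cR x) = `|x|.
Proof. by apply: cR_inj; rewrite -rnE cR_norm. Qed.
Lemma rn_sqr (x : K) : rn x ^+ 2 = re x ^+ 2 + im x ^+ 2.
Proof. by apply: cR_inj; rewrite cRD !cRX -rnE cR_re cR_im normC2_Re_Im. Qed.
Lemma rn_Re (x : K) : `|re x| <= rn x.
Proof.
rewrite -(@ler_pXn2r _ 2%N) // ?nnegrE ?normr_ge0 ?rn_ge0 // rn_sqr real_normK ?num_real //.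
by rewrite lerDl sqr_ge0.
Qed.
Lemma rn_Im (x : K) : `|im x| <= rn x.
Proof.
rewrite -(@ler_pXn2r _ 2%N) // ?nnegrE ?normr_ge0 ?rn_ge0 // rn_sqr real_normK ?num_real //.
by rewrite lerDr sqr_ge0.
Qed.

(** The norm of a row is the maximum of the norms of its entries; [0 <= r] covers n = 0, where the
    right-hand side holds vacuously. *)
Lemma rn_row_le n (v : 'rV[K]_n) r : 0 <= r ->
  (rn v <= r) <-> (forall i, rn (v 0 i) <= r).
Proof.
move=> r0; rewrite -rn_le (_ : `|v| = mx_norm v) // mx_normE.
have r0' : 0 <= cR r by rewrite -cR0 cR_le.
rewrite -[cR r]/((NngNum r0')%:num) num_le; split=> [/bigmax_leP[_ H] i|H].
  by have := H (ord0, i) isT; rewrite -num_le /= rn_le.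
apply/bigmax_leP; split=> [|[i j] _] /=; first by rewrite -num_le /=.
by rewrite -num_le /= (ord1 i) rn_le.
Qed.

Lemma rn_coord n (v : 'rV[K]_n) i : rn (v 0 i) <= rn v.
Proof. exact: (rn_row_le v (rn_ge0 v)).1. Qed.

Lemma cR_continuous : continuous cR.
Proof.
move=> x; apply/cvg_rnP => e e0; near=> y.
by rewrite -cRB rn_cR distrC; near: y; apply: cvgr_dist_lt.
Unshelve. all: by end_near. Qed.


Lemma rn_continuous (V : normedModType K) : continuous (@rn V).
Proof.
move=> x; apply/cvgrPdist_lt => e e0; apply/nearP_rn; exists e => // z; apply: le_lt_trans.
have [h|h] := leP (rn x) (rn z).
  rewrite distrC ger0_norm ?subr_ge0 // lerBlDr.
  by apply: le_trans (rnD _ _); rewrite subrK.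
rewrite ger0_norm ?subr_ge0; last exact: ltW.
rewrite lerBlDr rn_distC.
by apply: le_trans (rnD _ _); rewrite subrK.
Qed.

(** The disc is a closed part of the image of the square [-r, r]^2 under (a, b) |-> a + i b. *)
Lemma disc_compact (r : R) : compact [set z : K | rn z <= r].
Proof.
have Kc : compact (`[-r, r]%classic `*` `[-r, r]%classic).
  by apply: compact_setX; apply: segment_compact.
pose f (ab : R * R) : K := cR ab.1 + 'i * cR ab.2.
have cf : continuous f.
  move=> ab; apply: cvgD.
    by apply: (@continuous_comp _ _ _ fst); [exact: cvg_fst|exact: cR_continuous].
  apply: cvgM; first exact: cvg_cst.
  by apply: (@continuous_comp _ _ _ snd); [exact: cvg_snd|exact: cR_continuous].
have Kf : compact (f @` (`[-r, r]%classic `*` `[-r, r]%classic)).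
  by apply: continuous_compact => //; apply: continuous_subspaceT.
apply: (subclosed_compact _ Kf).
  apply: (@preimage_closed _ _ (@rn K) [set x | x <= r]); last exact: closed_le.
  by move=> x _; exact: rn_continuous.
move=> z /= zr; exists (re z, im z); last by rewrite /f /= -crect.
by split => /=; rewrite in_itv /= -ler_norml (le_trans _ zr) // ?rn_Re ?rn_Im.
Qed.

Lemma rvball_compact n (r : R) : compact [set v : 'rV[K]_n | rn v <= r].
Proof.
have [r0|r0] := leP 0 r; last first.
  rewrite (_ : mkset _ = set0); first exact: compact0.
  by rewrite predeqE => v; split=> //= H; have := rn_ge0 v; rewrite leNgt (le_lt_trans H).
have := @rV_compact K n (fun=> [set z : K | rn z <= r]) (fun=> @disc_compact r).
by congr compact; rewrite predeqE => v /=; rewrite rn_row_le.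
Qed.

Lemma rn_sum (V : normedModType K) (I : Type) (r : seq I) (P : pred I) (F : I -> V) :
  rn (\sum_(i <- r | P i) F i) <= \sum_(i <- r | P i) rn (F i).
Proof.
elim/big_ind2 : _ => [|x a y b xa yb|//]; first by rewrite rn0.
by apply: le_trans (rnD _ _) _; apply: lerD.
Qed.

End RealNorm.
Arguments rn_ge0 {R K S V} v.
Arguments rnD {R K S V} v w.
Arguments rnB {R K S V} v w.
Arguments rn_coord {R K S n} v i.
Arguments rn_sum {R K S V I} r P F.
Arguments rn_row_le {R K S n} v {r}.
Arguments rn_Re {R K S} x.
Arguments rn_Im {R K S} x.

Lemma complex_real_structure (R : realType) : real_structure R (complex_field R).
Proof.
apply: (@RealStructure R (complex_field R) (real_complex R) (@complex.Re R)).
  exact: lecR.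
exact: RRe_real.
Qed.

(** * A two-point estimate for convergent power series *)

Section PowerSeries.
Variables (R : realType) (K : numClosedFieldType) (S : real_structure R K).
Local Notation rn := (rn S).
Local Notation cR := (cR S).

Definition deg n (a : {ffun 'I_n -> nat}) : nat := (\sum_i a i)%N.

(** x y - x' y' = x (y - y') + (x - x') y'. The three bounds form a package that is stable under
    products, the exponents adding up, so that monomials can be treated factor by factor. *)
Lemma prod_diff (x x' y y' : K) (s D : R) k l : 0 <= s -> 0 <= D ->
  rn x <= s ^+ k -> rn x' <= s ^+ k -> rn (x - x') * s <= k%:R * s ^+ k * D ->
  rn y <= s ^+ l -> rn y' <= s ^+ l -> rn (y - y') * s <= l%:R * s ^+ l * D ->
  [/\ rn (x * y) <= s ^+ (k + l), rn (x' * y') <= s ^+ (k + l) &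
      rn (x * y - x' * y') * s <= (k + l)%:R * s ^+ (k + l) * D].
Proof.
move=> s0 D0 hx hx' hd hy hy' hd'.
split; [by rewrite rnM exprD ler_pM ?rn_ge0|by rewrite rnM exprD ler_pM ?rn_ge0|].
rewrite (_ : x * y - x' * y' = x * (y - y') + (x - x') * y'); last by ring.
apply: (@le_trans _ _ ((rn x * rn (y - y') + rn (x - x') * rn y') * s)).
  by rewrite ler_wpM2r // -!rnM rnD.
have -> : (rn x * rn (y - y') + rn (x - x') * rn y') * s =
  rn x * (rn (y - y') * s) + rn (x - x') * s * rn y' by ring.
have -> : (k + l)%:R * s ^+ (k + l) * D =
  s ^+ k * (l%:R * s ^+ l * D) + (k%:R * s ^+ k * D) * s ^+ l.
  by rewrite natrD exprD; ring.
by apply: lerD; apply: ler_pM => //; rewrite ?mulr_ge0 ?rn_ge0.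
Qed.

(* Multiplying by s avoids both the exponent deg a - 1 and a division by zero. *)
Lemma monomial_diff n (a : {ffun 'I_n -> nat}) (Z W : 'rV[K]_n) (s D : R) :
  rn Z <= s -> rn W <= s -> rn (Z - W) <= D ->
  rn (monomial a Z - monomial a W) * s <= (deg a)%:R * s ^+ deg a * D.
Proof.
move=> hZ hW hD; have s0 : 0 <= s by apply: le_trans (rn_ge0 _) hZ.
have D0 : 0 <= D by apply: le_trans (rn_ge0 _) hD.
pose P (x y : K) (k : nat) := [/\ rn x <= s ^+ k, rn y <= s ^+ k &
      rn (x - y) * s <= k%:R * s ^+ k * D].
suff : P (monomial a Z) (monomial a W) (deg a) by case.
have P1 : P 1 1 0%N by split; rewrite ?rn1 ?expr0 // subrr rn0 !mul0r.
have KM x y k x' y' l : P x y k -> P x' y' l -> P (x * x') (y * y') (k + l)%N.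
  by move=> [h1 h2 h3] [h4 h5 h6]; apply: prod_diff.
rewrite /monomial /deg; apply: (big_ind3 P) => // i _.
elim: (a i) => [|k IH]; first by rewrite !expr0.
rewrite !exprS; apply: (KM _ _ 1%N _ _ k) => //; split; rewrite ?expr1 ?mul1r.
- by apply: le_trans (rn_coord _ _) _.
- by apply: le_trans (rn_coord _ _) _.
- rewrite mulrC ler_wpM2l //; apply: le_trans hD.
  by have := rn_coord (Z - W) i; rewrite !mxE.
Qed.

Definition unit_exp n (i : 'I_n) : {ffun 'I_n -> nat} := [ffun j => nat_of_bool (j == i)].

Lemma monomial_unit_exp n (i : 'I_n) (Z : 'rV[K]_n) : monomial (unit_exp i) Z = Z 0 i.
Proof.
rewrite /monomial (bigD1 i) //= ffunE eqxx expr1 big1 ?mulr1 // => j ji.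
by rewrite ffunE (negbTE ji).
Qed.

Lemma unit_exp_inj n : injective (@unit_exp n).
Proof.
move=> i j /ffunP /(_ i); rewrite !ffunE eqxx.
by case: eqP.
Qed.

Lemma deg1 n (a : {ffun 'I_n -> nat}) : deg a = 1%N -> exists i, a = unit_exp i.
Proof.
move=> h; have /existsP[i ai] : [exists i, a i != 0%N].
  apply/contraT; rewrite negb_exists => /forallP H; move: h; rewrite /deg big1 // => i _.
  by have := H i; rewrite negbK => /eqP.
exists i; apply/ffunP => j; rewrite ffunE; move: h; rewrite /deg (bigD1 i) //=.
have : (0 < a i)%N by rewrite lt0n.
case E : (a i) => [//|k] _ /eqP; rewrite addSn eqSS addn_eq0 => /andP[/eqP k0].
rewrite sum_nat_eq0 => /forallP H; have [->|ji] := eqVneq j i; first by rewrite E k0.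
by have := H j; rewrite ji => /eqP.
Qed.

(** The linear part is written as a box sum in order to be subtracted from the series term by term;
    a box of side at least 2 contains every [unit_exp i]. *)
Lemma box_sum_lin n (c : {ffun 'I_n -> nat} -> K) (v : 'rV[K]_n) d : (2 <= d)%N ->
  box_sum (fun a => \sum_i (a == unit_exp i)%:R * (c a * v 0 i)) d = \sum_i c (unit_exp i) * v 0 i.
Proof.
move=> d2; rewrite /box_sum exchange_big /=; apply: eq_bigr => i _.
have lt1 (b : bool) : (b < d)%N by case: b => //; apply: leq_trans d2.
pose a0 : {ffun 'I_n -> 'I_d} := [ffun j => Ordinal (lt1 (j == i))].
have E0 : [ffun i0 => nat_of_ord (a0 i0)] = unit_exp i by apply/ffunP => j; rewrite !ffunE.
rewrite (bigD1 a0) //= E0 eqxx mul1r big1 ?addr0 // => a aa0.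
case: eqP => [E|]; last by rewrite mul0r.
case/eqP: aa0; apply/ffunP => j; apply: val_inj; rewrite ffunE /=.
by move/ffunP: E => /(_ j); rewrite !ffunE.
Qed.

Lemma monomial_const n (a : {ffun 'I_n -> nat}) (x : K) : monomial a (const_mx x) = x ^+ deg a.
Proof. by rewrite /monomial /deg expr_sum; apply: eq_bigr => i _; rewrite mxE. Qed.

(** Terms of degree 0 and 1 cancel. In degree k + 2, [monomial_diff] gives the factor (k + 2) s^(k +
    1), at most 2^(k + 2) s (r / 2)^k = 4 s r^k. The bound is thus a term of the series at (r, ...,
    r) times a factor common to all terms. *)
Lemma term_bound n (a : {ffun 'I_n -> nat}) (ca : K) (Z W : 'rV[K]_n) (s r : R) :
  0 < r -> 0 < s -> s <= r / 2 -> rn Z <= s -> rn W <= s ->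
  rn (ca * (monomial a Z - monomial a W) - \sum_i (a == unit_exp i)%:R * (ca * (Z - W) 0 i))
   <= rn (ca * monomial a (const_mx (cR r))) * (4 / r ^+ 2 * s * rn (Z - W)).
Proof.
move=> r0 s0 sr hZ hW.
have rhs0 : 0 <= rn (ca * monomial a (const_mx (cR r))) * (4 / r ^+ 2 * s * rn (Z - W)).
  by rewrite !mulr_ge0 ?rn_ge0 // ?ltW // invr_gt0 exprn_gt0.
have [/existsP[i /eqP ai]|/existsPn H] := boolP [exists i, a == unit_exp i].
  rewrite (bigD1 i) //= [in X in _ - (X + _)]ai eqxx big1; last first.
    move=> j ji; rewrite ai; case: eqP => [/unit_exp_inj E|_]; last by rewrite mul0r.
    by rewrite E eqxx in ji.
  by move: rhs0; rewrite ai mul1r addr0 !monomial_unit_exp !mxE subrr rn0.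
rewrite big1 ?subr0; last by move=> i _; rewrite (negbTE (H i)) mul0r.
rewrite monomial_const !rnM rnX rn_cR (gtr0_norm r0) -mulrA ler_wpM2l ?rn_ge0 //.
have := @monomial_diff n a Z W s _ hZ hW (lexx _).
have : deg a <> 1%N.
  by move=> /deg1[i ai]; have := H i; rewrite ai eqxx.
case E : (deg a) => [|[|k]] // _; first by rewrite !mul0r pmulr_lle0 // => h; apply: le_trans h _;
  rewrite !mulr_ge0 ?rn_ge0 // ?ltW // invr_gt0 exprn_gt0.
rewrite -ler_pdivlMr // => h; apply: le_trans h _.
rewrite ler_pdivrMr //.
have -> : r ^+ k.+2 * (4 / r ^+ 2 * s * rn (Z - W)) * s = (2 ^+ k.+2 * (s ^+ 2 * (r / 2) ^+ k)) * rn (Z - W).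
  rewrite !exprS expr0 exprMn exprVn.
  have : r != 0 by rewrite gt_eqF.
  have : 2 ^+ k != 0 :> R by rewrite expf_neq0.
  by move=> h1 h2; field; rewrite h1 h2.
apply: ler_wpM2r; first exact: rn_ge0.
apply: ler_pM; [by rewrite ler0n|by rewrite exprn_ge0 // ltW| |].
  by rewrite -natrX ler_nat ltnW // ltn_expl.
rewrite -addn2 addnC exprD; apply: ler_wpM2l; first by rewrite exprn_ge0 // ltW.
by apply: lerXn2r; rewrite ?nnegrE //; apply: ltW => //; rewrite divr_gt0.
Qed.

(** A single truncation serves both points, and d >= 2 makes it fit for [box_sum_lin]. *)
Lemma cvg_diff_approx (u v : nat -> K) (a b k : K) (eps : R) :
  u @ \oo --> a -> v @ \oo --> b -> 0 < eps ->
  exists2 d, (2 <= d)%N & rn (a - b - k - (u d - v d - k)) < eps.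
Proof.
move=> ua vb eps0; have H : (u - v) @ \oo --> a - b by exact: cvgB.
have HX : \forall t \near \oo, rn ((u - v) t - (a - b)) < eps by exact: ((cvg_rnP S (u - v) (a - b)).1 H _ eps0).
have [d [d2 HNd]] := filter_ex (filterI (nbhs_infty_ge 2) HX).
exists d; first exact: d2.
rewrite rn_distC (_ : _ - _ - (_ - _ - _) = u d - v d - (a - b)); first exact: HNd.
by ring.
Qed.

(** By [term_bound], the absolutely convergent series at one fixed point dominates the nonlinear
    terms, uniformly in z and w. *)
Lemma holo_strict n (f : 'rV[K]_n -> K) p : holomorphic_at f p ->
  exists (L : 'cV[K]_n) (M r : R), [/\ 0 < r, 0 <= M &
    forall s z w, 0 < s -> s <= r -> rn (z - p) <= s -> rn (w - p) <= s ->
      rn (f z - f w - ((z - w) *m L) 0 0) <= M * s * rn (z - w)].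
Proof.
move=> [c /(nearP_rn S)[e e0 H]].
have e20 : 0 < e / 2 by rewrite divr_gt0.
(* The fixed point: all coordinates of z - p are e / 2, so a monomial takes the value (e / 2)^deg
   there. *)
have [|[M HM] _] := H (p + const_mx (cR (e / 2))).
  rewrite addrAC subrr add0r; apply: (@le_lt_trans _ _ (e / 2)); last by rewrite ltr_pdivrMr // mulr_natr mulr2n ltrDl.
  by apply/(rn_row_le _ (ltW e20)) => i; rewrite mxE rn_cR gtr0_norm.
have [m m0 ME] : exists2 m, 0 <= m & M = cR m.
  by apply: (ge0_cR S); apply: le_trans (HM 0%N); apply: sumr_ge0 => *; apply: normr_ge0.
(* L collects the coefficients of degree one; the radius is half of e / 2, as [term_bound] asks. *)
exists (\col_i c (unit_exp i)), (m * (4 / (e / 2) ^+ 2)), (e / 2 / 2).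
have HM' d : \sum_(a : {ffun 'I_n -> 'I_d}) rn (c [ffun i => nat_of_ord (a i)] *
   monomial [ffun i => nat_of_ord (a i)] (const_mx (cR (e / 2)))) <= m.
  have := HM d; rewrite /box_sum (addrC p) addrK.
  rewrite -(cR_le S) -ME cR_sum; apply: le_trans.
  by apply: ler_sum => a _; rewrite (rnE S).
split.
- by rewrite !divr_gt0.
- by rewrite mulr_ge0 // divr_ge0 // exprn_ge0 // ltW.
move=> s z w s0 sr hz hw.
have se1 : s < e.
  by apply: le_lt_trans sr _; lra.
have [_ cz] := H z (le_lt_trans hz se1).
have [_ cw] := H w (le_lt_trans hw se1).
(* The bound is proved for truncations, and eps pays for the passage to the limit. *)
apply/ler_addgt0Pr => eps eps0.
set Lzw := ((z - w) *m _) 0 0.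
have LE : Lzw = \sum_i c (unit_exp i) * (z - w) 0 i.
  by rewrite /Lzw mxE; apply: eq_bigr => i _; rewrite !mxE mulrC.
have [d d2] := cvg_diff_approx Lzw cz cw eps0.
set T := (X in _ - _ - _ - X) => Hd.
have TE : T = box_sum (fun a => c a * monomial a (z - p)) d - box_sum (fun a => c a * monomial a (w - p)) d - Lzw by [].
clearbody T.
rewrite -(subrK T (f z - f w - Lzw)) addrC.
apply: le_trans (rnD _ _) _; apply: lerD; last exact: ltW.
have -> : T = \sum_(a : {ffun 'I_n -> 'I_d}) let a' := [ffun i => nat_of_ord (a i)] in
   (c a' * (monomial a' (z - p) - monomial a' (w - p)) - \sum_i (a' == unit_exp i)%:R * (c a' * (z - p - (w - p)) 0 i)).
  rewrite /= sumrB TE; congr (_ - _).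
    by rewrite /box_sum -sumrB; apply: eq_bigr => a _; rewrite mulrBr.
  rewrite LE -(box_sum_lin c (z - w) d2) /box_sum; apply: eq_bigr => a _.
  by apply: eq_bigr => i _; rewrite !mxE opprB addrA subrK.
have -> : rn (z - w) = rn (z - p - (w - p)) by rewrite opprB addrA subrK.
apply: le_trans (rn_sum _ _ _) _ => /=.
apply: (@le_trans _ _ (\sum_(a : {ffun 'I_n -> 'I_d}) rn (c [ffun i => nat_of_ord (a i)] *
   monomial [ffun i => nat_of_ord (a i)] (const_mx (cR (e / 2)))) * (4 / (e / 2) ^+ 2 * s * rn (z - p - (w - p))))).
  by apply: ler_sum => a _; apply: term_bound.
rewrite -mulr_suml -!(mulrA (m)) ler_wpM2r //.
by rewrite !mulr_ge0 ?rn_ge0 // ?ltW // invr_gt0 exprn_gt0.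
Qed.

End PowerSeries.

(** * Jacobians and strict differentiability *)

Section Differential.
Variables (R : realType) (K : numClosedFieldType) (S : real_structure R K).
Local Notation rn := (rn S).

Lemma rn_mulmx n m (L : 'M[K]_(n, m)) :
  exists2 B : R, 0 < B & forall v : 'rV[K]_n, rn (v *m L) <= B * rn v.
Proof.
exists (1 + \sum_i \sum_j rn (L i j)).
  by rewrite ltr_wpDr // sumr_ge0 // => i _; rewrite sumr_ge0 // => j _; apply: rn_ge0.
move=> v.
have S0 : 0 <= \sum_i \sum_j rn (L i j).
  by rewrite sumr_ge0 // => i _; rewrite sumr_ge0 // => j _; apply: rn_ge0.
apply/rn_row_le => [|j]; first by rewrite mulr_ge0 ?rn_ge0 // addr_ge0.
rewrite mxE; apply: le_trans (rn_sum _ _ _) _ => /=.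
apply: (@le_trans _ _ ((\sum_i \sum_j rn (L i j)) * rn v)); last by rewrite ler_wpM2r ?rn_ge0 // lerDr.
rewrite mulr_suml; apply: ler_sum => i _; rewrite rnM mulrC.
apply: ler_pM; rewrite ?rn_ge0 // ?rn_coord //.
by rewrite (bigD1 j) //= lerDl sumr_ge0 // => k _; apply: rn_ge0.
Qed.

Lemma linear_continuous_rn (V W : normedModType K) (f : {linear V -> W}) (B : R) :
  (forall v, rn (f v) <= B * rn v) -> continuous f.
Proof.
move=> H x; apply/(cvg_rnP S) => e e0; apply/(nearP_rn S).
have B0 : 0 < `|B| + 1 by rewrite ltr_wpDl.
exists (e / (`|B| + 1)); first by rewrite divr_gt0.
move=> z hz; rewrite -linearB; apply: le_lt_trans (H _) _.
move: hz; rewrite ltr_pdivlMr // mulrC; apply: le_lt_trans; apply: ler_wpM2r; first exact: rn_ge0.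
by apply: le_trans (ler_norm _) _; rewrite lerDl.
Qed.

Lemma diff_strict (V W : normedModType K) (f : V -> W) p (df : {linear V -> W}) (B M r : R) :
  (forall v, rn (df v) <= B * rn v) -> 0 < r -> 0 <= M ->
  (forall z, rn (z - p) <= r -> rn (f z - f p - df (z - p)) <= M * rn (z - p) ^+ 2) ->
  'd f p = df :> (V -> W).
Proof.
move=> HB r0 M0 H; apply: diff_unique; first exact: linear_continuous_rn HB.
apply/eqaddoP => _ /(pos_cR S)[e e0 ->].
apply/(nearP_rn S); exists (Num.min r (e / (M + 1))).
  by rewrite lt_min r0 divr_gt0 // ltr_wpDl.
move=> v; rewrite subr0 lt_min => /andP[vr ve] /=.
rewrite !(rnE S) -cRM cR_le.
have := H (v + p); rewrite addrK => /(_ (ltW vr)).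
rewrite -[X in rn X]/(f (v + p) - f p - df v).
have -> : (f \o shift p - (cst (f p) + df)) v = f (v + p) - f p - df v.
  by rewrite -[LHS]/(f (v + p) - (f p + df v)) opprD addrA.
move=> h; apply: le_trans h _; rewrite expr2 mulrA ler_wpM2r ?rn_ge0 //.
move: ve; rewrite ltr_pdivlMr ?ltr_wpDl // => /ltW; apply: le_trans.
by rewrite mulrC ler_wpM2l ?rn_ge0 // lerDl.
Qed.

(** Take the sum of the constants and the minimum of the radii, capped by 1. *)
Lemma ex_common m (P : 'I_m -> R -> R -> Prop) :
  (forall i M r M' r', P i M r -> M <= M' -> 0 < r' -> r' <= r -> P i M' r') ->
  (forall i, exists M r : R, [/\ 0 < r, 0 <= M & P i M r]) ->
  exists M r : R, [/\ 0 < r, 0 <= M & forall i, P i M r].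
Proof.
move=> mono H.
have [f Hf] := @choice _ _ (fun i (Mr : R * R) => [/\ 0 < Mr.2, 0 <= Mr.1 & P i Mr.1 Mr.2])
  (fun i => let: ex_intro M (ex_intro r h) := H i in ex_intro _ (M, r) h).
exists (\sum_i (f i).1), (\big[Num.min/1]_i (f i).2).
have r0 : 0 < \big[Num.min/1]_i (f i).2.
  by apply: lt_bigmin => // i _; have [] := Hf i.
split=> //.
  by apply: sumr_ge0 => i _; have [] := Hf i.
move=> i; have [h1 h2 h3] := Hf i; apply: mono h3 _ r0 _.
  rewrite (bigD1 i) //= lerDl sumr_ge0 // => j _; by have [] := Hf j.
by apply: bigmin_le.
Qed.

(** A condition on pairs of points: it controls secants that avoid p, and it makes the correction
    maps fed to [approx_zero] close to the identity. *)
Definition strict_at n m (f : 'rV[K]_n -> 'rV[K]_m) p (L : 'M[K]_(n, m)) (M r : R) :=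
  forall s z w, 0 < s -> s <= r -> rn (z - p) <= s -> rn (w - p) <= s ->
      rn (f z - f w - (z - w) *m L) <= M * s * rn (z - w).

Lemma holo_map_strict n m (f : 'rV[K]_n -> 'rV[K]_m) p : holomorphic_map_at f p ->
  exists M r : R, [/\ 0 < r, 0 <= M & strict_at f p ('J f p) M r].
Proof.
move=> H.
have [L HL] := @choice _ _ (fun (j : 'I_m) (L : 'cV[K]_n) => exists (M r : R), [/\ 0 < r, 0 <= M &
    forall s z w, 0 < s -> s <= r -> rn (z - p) <= s -> rn (w - p) <= s ->
      rn (f z 0 j - f w 0 j - ((z - w) *m L) 0 0) <= M * s * rn (z - w)]) (fun j => holo_strict S (H j)).
have [M [r [r0 M0 HMr]]] : exists M r : R, [/\ 0 < r, 0 <= M & strict_at f p (\matrix_(i, j) L j i 0) M r].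
  have := @ex_common m (fun j M r => forall s z w, 0 < s -> s <= r -> rn (z - p) <= s -> rn (w - p) <= s ->
      rn (f z 0 j - f w 0 j - ((z - w) *m L j) 0 0) <= M * s * rn (z - w)) _ HL.
  case.
    move=> i M r M' r' h MM r'0 rr s z w s0 sr hz hw; apply: le_trans (h _ _ _ s0 (le_trans sr rr) hz hw) _.
    by rewrite -!mulrA ler_wpM2r // mulr_ge0 ?rn_ge0 // ltW.
  move=> M [r [r0 M0 h]]; exists M, r; split=> // s z w s0 sr hz hw.
  apply/rn_row_le => [|j]; first by rewrite !mulr_ge0 ?rn_ge0 // ltW.
  have := h j s z w s0 sr hz hw; congr (rn _ <= _).
  by rewrite !mxE; congr (_ - _); apply: eq_bigr => i _; rewrite !mxE.
suff -> : 'J f p = \matrix_(i, j) L j i 0 by exists M, r.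
have [B _ HB] := rn_mulmx (\matrix_(i, j) L j i 0).
have E : 'd f p = mulmxr (\matrix_(i, j) L j i 0) :> (_ -> _).
  apply: (@diff_strict _ _ f p (mulmxr (\matrix_(i, j) L j i 0)) B M r) => //= z hz.
  have [->|zp] := eqVneq z p; first by rewrite !subrr mul0mx subr0 !rn0 expr2 !mulr0.
  have := HMr (rn (z - p)) z p; rewrite rn_gt0 subr_eq0 => /(_ zp hz (lexx _)).
  by rewrite subrr rn0 => /(_ (rn_ge0 _)); rewrite expr2 mulrA.
apply/matrixP => i j; rewrite /jacobian.
by rewrite [LHS]mxE E /= -rowE [LHS]mxE.
Qed.

(** [general_at] speaks of ['d g p] and not of a Jacobian matrix; the column L represents this
    linear form. *)
Lemma holo_strict_d n (f : 'rV[K]_n -> K) p : holomorphic_at f p ->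
  exists (L : 'cV[K]_n) (M r : R), [/\ 0 < r, 0 <= M,
    forall v, 'd f p v = (v *m L) 0 0 &
    forall s z w, 0 < s -> s <= r -> rn (z - p) <= s -> rn (w - p) <= s ->
      rn (f z - f w - ((z - w) *m L) 0 0) <= M * s * rn (z - w)].
Proof.
move=> /(holo_strict S)[L [M [r [r0 M0 H]]]]; exists L, M, r; split=> // v.
have [B _ HB] := rn_mulmx L.
pose g (v : 'rV[K]_n) : K := (v *m L) 0 0.
have gl : linear g by move=> k x y; rewrite /g mulmxDl -scalemxAl !mxE.
pose gL : {linear 'rV[K]_n -> K} := HB.pack g (GRing.isLinear.Build _ _ _ _ g gl).
suff -> : 'd f p = gL :> (_ -> _) by [].
apply: (@diff_strict _ _ f p gL B M r) => //=.
  by move=> w; apply: le_trans (HB w); apply: rn_coord.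
move=> z hz; have [->|zp] := eqVneq z p; first by rewrite /g !subrr mul0mx mxE subr0 !rn0 expr2 !mulr0.
have := H (rn (z - p)) z p; rewrite rn_gt0 subr_eq0 => /(_ zp hz (lexx _)).
by rewrite subrr rn0 => /(_ (rn_ge0 _)); rewrite expr2 mulrA.
Qed.

End Differential.

(** * Polynomial functions are holomorphic *)

Section Polynomials.
Variables (K : numClosedFieldType) (n : nat) (p : 'rV[K]_n).
Implicit Types (f g : 'rV[K]_n -> K) (a b : {ffun 'I_n -> nat}).

(** The expansion is centred at p as in [holomorphic_at]. A multi-index may occur several times in
    the list, so that addition is concatenation. *)
Definition polyfun f := exists s : seq (K * {ffun 'I_n -> nat}),
  forall z, f z = \sum_(t <- s) t.1 * monomial t.2 (z - p).

Lemma monomialD a b (z : 'rV[K]_n) :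
  monomial [ffun i => (a i + b i)%N] z = monomial a z * monomial b z.
Proof. by rewrite /monomial -big_split; apply: eq_bigr => i _; rewrite ffunE exprD. Qed.

Lemma monomial0 (z : 'rV[K]_n) : monomial [ffun=> 0%N] z = 1.
Proof. by rewrite /monomial big1 // => i _; rewrite ffunE. Qed.

Lemma polyfun_cst k : polyfun (fun=> k).
Proof. by exists [:: (k, [ffun=> 0%N])] => z; rewrite big_seq1 /= monomial0 mulr1. Qed.

Lemma polyfun_coord i : polyfun (fun z => z 0 i).
Proof.
exists [:: (p 0 i, [ffun=> 0%N]); (1, unit_exp i)] => z.
by rewrite big_cons big_seq1 /= monomial0 mulr1 mul1r monomial_unit_exp !mxE; ring.
Qed.

Lemma polyfunD f g : polyfun f -> polyfun g -> polyfun (fun z => f z + g z).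
Proof. by move=> [s hs] [t ht]; exists (s ++ t) => z; rewrite big_cat /= -hs -ht. Qed.

Lemma polyfunM f g : polyfun f -> polyfun g -> polyfun (fun z => f z * g z).
Proof.
move=> [s hs] [t ht].
pose mul (x y : K * {ffun 'I_n -> nat}) := (x.1 * y.1, [ffun i => (x.2 i + y.2 i)%N] : {ffun 'I_n -> nat}).
exists [seq mul x y | x <- s, y <- t] => z.
rewrite hs ht big_allpairs_dep mulr_suml; apply: eq_bigr => x _.
by rewrite mulr_sumr; apply: eq_bigr => y _ /=; rewrite monomialD mulrACA.
Qed.

Lemma polyfunN f : polyfun f -> polyfun (fun z => - f z).
Proof.
move=> hf; have := polyfunM (polyfun_cst (-1)) hf; congr polyfun.
by apply/funext => z; rewrite mulN1r.
Qed.

Lemma polyfunX f k : polyfun f -> polyfun (fun z => f z ^+ k).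
Proof.
move=> hf; elim: k => [|k IH]; first exact: polyfun_cst.
have := polyfunM hf IH; congr polyfun.
by apply/funext => z; rewrite exprS.
Qed.

Lemma box_sum_pick b (g : {ffun 'I_n -> nat} -> K) d :
  box_sum (fun a => (b == a)%:R * g a) d = if [forall i, (b i < d)%N] then g b else 0.
Proof.
rewrite /box_sum; case: ifPn => [/forallP H|/forallPn[i hi]].
  pose a0 : {ffun 'I_n -> 'I_d} := [ffun j => Ordinal (H j)].
  have E0 : [ffun i0 => nat_of_ord (a0 i0)] = b by apply/ffunP => j; rewrite !ffunE.
  rewrite (bigD1 a0) //= E0 eqxx mul1r big1 ?addr0 // => a aa0.
  case: eqP => [E|]; last by rewrite mul0r.
  case/eqP: aa0; apply/ffunP => j; apply: val_inj; rewrite ffunE /=.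
  by move/ffunP: E => /(_ j); rewrite !ffunE.
rewrite big1 // => a _; case: eqP => [E|]; last by rewrite mul0r.
by move: hi; rewrite E ffunE ltn_ord.
Qed.

(** The coefficient at a multi-index adds up its occurrences, and the box sums are constant as soon
    as the box contains every multi-index of the list. *)
Lemma polyfun_holo f : polyfun f -> holomorphic_at f p.
Proof.
move=> [s hs]; exists (fun a => \sum_(t <- s) t.1 * (t.2 == a)%:R).
apply: (@filterE _ (nbhs p)) => z.
have E (d : nat) : box_sum (fun a => (\sum_(t <- s) t.1 * (t.2 == a)%:R) * monomial a (z - p)) d =
    \sum_(t <- s) t.1 * box_sum (fun a => (t.2 == a)%:R * monomial a (z - p)) d.
  rewrite /box_sum; under eq_bigr do rewrite mulr_suml.
  rewrite exchange_big /=; apply: eq_bigr => t _; rewrite mulr_sumr.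
  by apply: eq_bigr => a _; rewrite mulrA.
split.
  exists (\sum_(t <- s) `|t.1 * monomial t.2 (z - p)|) => d.
  apply: (@le_trans _ _ (\sum_(t <- s) `|t.1| * box_sum (fun a => (t.2 == a)%:R * `|monomial a (z - p)|) d)).
    rewrite /box_sum; under [leRHS]eq_bigr do rewrite mulr_sumr.
    rewrite exchange_big /=; apply: ler_sum => a _.
    rewrite mulr_suml; apply: le_trans (ler_norm_sum _ _ _) _.
    by apply: ler_sum => t _; rewrite !normrM normr_nat mulrA.
  apply: ler_sum => t _; rewrite box_sum_pick normrM ler_wpM2l //.
  by case: ifP.
have [D HD] : exists D : nat, forall t, t \in s -> forall i, (t.2 i < D)%N.
  exists (\sum_(t <- s) \sum_i t.2 i).+1%N => t ts i.
  rewrite ltnS (big_rem t) //= (bigD1 i) //= -addnA; exact: leq_addr.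
apply: cvg_near_cst; exists D => // d /= Dd.
rewrite E hs big_seq [RHS]big_seq; apply: eq_bigr => t ts.
rewrite box_sum_pick ifT //; apply/forallP => i; exact: leq_trans (HD t ts i) Dd.
Qed.

End Polynomials.

Ltac solve_polyfun := repeat first [exact: polyfun_cst | exact: polyfun_coord | apply: polyfunD
  | apply: polyfunN | apply: polyfunX | apply: polyfunM].

(** * Jacobians read off along lines *)

Section JacobianDirections.
Variables (R : realType) (K : numClosedFieldType) (S : real_structure R K).
Local Notation rn := (rn S).
Local Notation cR := (cR S).

Lemma small_real_eq0 (z : K) (B r : R) : 0 < r ->
  (forall t : R, 0 < t -> t <= r -> rn z <= B * t) -> z = 0.
Proof.
move=> r0 H; apply/eqP; rewrite -(rn_eq0 S) eq_le rn_ge0 andbT.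
apply/ler_addgt0Pr => e e0; rewrite add0r.
have B0 : 0 < `|B| + 1 by rewrite ltr_wpDl.
pose t := Num.min r (e / (`|B| + 1)).
have t0 : 0 < t by rewrite lt_min r0 divr_gt0.
apply: le_trans (H t t0 _) _; first by rewrite ge_min lexx.
apply: (@le_trans _ _ ((`|B| + 1) * t)).
  by apply: ler_wpM2r; [exact: ltW|apply: le_trans (ler_norm _) _; rewrite lerDl].
by rewrite mulrC -ler_pdivlMr // ge_min lexx orbT.
Qed.

(** Two expansions of f along p + t v with quadratic errors have the same linear coefficient. *)
Lemma J_dir n m (f : 'rV[K]_n -> 'rV[K]_m) p v j l (B : R) : holomorphic_map_at f p ->
  (forall t : K, rn t <= 1 -> rn (f (p + t *: v) 0 j - f p 0 j - t * l) <= B * rn t ^+ 2) ->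
  (v *m 'J f p) 0 j = l.
Proof.
move=> /(holo_map_strict S)[M [r [r0 M0 H]]] HB.
apply/eqP; rewrite -subr_eq0; apply/eqP.
have V0 : 0 < rn v + 1 by rewrite ltr_wpDl ?rn_ge0.
apply: (@small_real_eq0 _ (B + M * (rn v + 1) * rn v) (Num.min 1 (r / (rn v + 1)))).
  by rewrite lt_min ltr01 divr_gt0.
move=> t t0; rewrite le_min => /andP[t1 tr].
have tn : rn (cR t) = t by rewrite rn_cR gtr0_norm.
have := HB (cR t); rewrite tn => /(_ t1) h1.
have := H (t * (rn v + 1)) (p + cR t *: v) p.
rewrite mulr_gt0 // -ler_pdivlMr // tr addrAC subrr add0r rnZ tn rn0.
rewrite ler_wpM2l ?(ltW t0) ?lerDl // mulr_ge0 ?(ltW t0) ?(ltW V0) // => /(_ isT isT isT isT) h2.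
have h3 := le_trans (rn_coord _ j) h2; rewrite -scalemxAl !mxE in h3.
rewrite -(ler_pM2l t0) -{1}tn -rnM.
have -> : cR t * ((v *m 'J f p) 0 j - l) =
  (f (p + cR t *: v) 0 j - f p 0 j - cR t * l) - (f (p + cR t *: v) 0 j - f p 0 j - cR t * (v *m 'J f p) 0 j) by ring.
apply: le_trans (rnB _ _) _.
have -> : t * ((B + M * (rn v + 1) * rn v) * t) = B * t ^+ 2 + M * (t * (rn v + 1)) * (t * rn v) by ring.
by apply: lerD => //; rewrite mxE.
Qed.

Lemma cubic_bound (q0 q1 q2 q3 : K) : exists B : R, forall t : K, rn t <= 1 ->
  rn (t ^+ 2 * (q0 + t * q1 + t ^+ 2 * q2 + t ^+ 3 * q3)) <= B * rn t ^+ 2.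
Proof.
exists (rn q0 + rn q1 + rn q2 + rn q3) => t t1.
rewrite rnM rnX mulrC ler_wpM2r ?exprn_ge0 ?rn_ge0 //.
apply: le_trans (rnD _ _) _; apply: lerD; last first.
  by rewrite rnM rnX ler_piMl ?rn_ge0 // exprn_ile1 ?rn_ge0.
apply: le_trans (rnD _ _) _; apply: lerD; last first.
  by rewrite rnM rnX ler_piMl ?rn_ge0 // exprn_ile1 ?rn_ge0.
by apply: le_trans (rnD _ _) _; apply: lerD; rewrite // rnM ler_piMl ?rn_ge0.
Qed.

(** Coefficients are provided up to t^5, the degree of v^2 - x^2 u^3. *)
Lemma J_poly n m (f : 'rV[K]_n -> 'rV[K]_m) p v j l q0 q1 q2 q3 : holomorphic_map_at f p ->
  (forall t : K, f (p + t *: v) 0 j = f p 0 j + t * l +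
     t ^+ 2 * (q0 + t * q1 + t ^+ 2 * q2 + t ^+ 3 * q3)) ->
  (v *m 'J f p) 0 j = l.
Proof.
move=> hf H; have [B HB] := cubic_bound q0 q1 q2 q3.
apply: (J_dir (B := B) hf) => t t1; have := HB t t1; congr (rn _ <= _).
by rewrite H; ring.
Qed.

End JacobianDirections.

(** * Equations of Y and inverse of the parametrisation *)

Definition i0 : 'I_4 := @Ordinal 4 0 isT.
Definition i1 : 'I_4 := @Ordinal 4 1 isT.
Definition i2 : 'I_4 := @Ordinal 4 2 isT.
Definition i3 : 'I_4 := @Ordinal 4 3 isT.

Section Equations.
Variable (K : numClosedFieldType).
Implicit Types (q : 'rV[K]_4).

Definition pt2 (x y : K) : 'rV[K]_2 := \row_j [:: x; y]`_j.
Definition pt4 (a b c d : K) : 'rV[K]_4 := \row_j [:: a; b; c; d]`_j.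

Lemma pt2E (z : 'rV[K]_2) : z = pt2 (z 0 0) (z 0 1).
Proof.
apply/rowP => j; rewrite mxE; case: j => [[|[|//]] h] /=; congr (z 0 _); exact: val_inj.
Qed.

Lemma pt20 x y : pt2 x y 0 0 = x. Proof. by rewrite mxE. Qed.
Lemma pt21 x y : pt2 x y 0 1 = y. Proof. by rewrite mxE. Qed.

Lemma pt4E q : q = pt4 (q 0 i0) (q 0 i1) (q 0 i2) (q 0 i3).
Proof.
apply/rowP => j; rewrite mxE; case: j => [[|[|[|[|//]]]] h] /=; congr (q 0 _); exact: val_inj.
Qed.

Lemma F_pt4 (z : 'rV[K]_2) : F z = pt4 (z 0 0) (z 0 1 ^+ 2) (z 0 0 * z 0 1 ^+ 3) (z 0 0 * z 0 1 + z 0 1 ^+ 3).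
Proof. by []. Qed.

Lemma F_pt2 x y : F (pt2 x y) = pt4 x (y ^+ 2) (x * y ^+ 3) (x * y + y ^+ 3).
Proof. by rewrite F_pt4 pt20 pt21. Qed.

Lemma pt4_0 a b c d : pt4 a b c d 0 i0 = a. Proof. by rewrite mxE. Qed.
Lemma pt4_1 a b c d : pt4 a b c d 0 i1 = b. Proof. by rewrite mxE. Qed.
Lemma pt4_2 a b c d : pt4 a b c d 0 i2 = c. Proof. by rewrite mxE. Qed.
Lemma pt4_3 a b c d : pt4 a b c d 0 i3 = d. Proof. by rewrite mxE. Qed.
Definition pt4s := (pt4_0, pt4_1, pt4_2, pt4_3).

(** The quadratic parts at 0 of the four equations are w^2, (x + u) v, v^2 and v w; those of [eq1],
    [eq3] and [eq4] serve in [not_ci_Y0]. *)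
Definition eq1 q : K := q 0 i3 ^+ 2 - (q 0 i0 + q 0 i1) ^+ 2 * q 0 i1.
Definition eq2 q : K := (q 0 i0 + q 0 i1) * q 0 i2 - q 0 i0 * q 0 i1 * q 0 i3.
Definition eq3 q : K := q 0 i2 ^+ 2 - q 0 i0 ^+ 2 * q 0 i1 ^+ 3.
Definition eq4 q : K := q 0 i2 * q 0 i3 - q 0 i0 * q 0 i1 ^+ 2 * (q 0 i0 + q 0 i1).

Lemma F_eqs (z : 'rV[K]_2) : [/\ eq1 (F z) = 0, eq2 (F z) = 0, eq3 (F z) = 0 & eq4 (F z) = 0].
Proof. by rewrite F_pt4 /eq1 /eq2 /eq3 /eq4 !pt4s; split; ring. Qed.

(* At 0 both denominators vanish, and 0 / 0 = 0 is the right value there. *)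
Definition F_inv q : 'rV[K]_2 :=
  pt2 (q 0 i0) (if q 0 i0 + q 0 i1 != 0 then q 0 i3 / (q 0 i0 + q 0 i1) else q 0 i2 / (q 0 i0 * q 0 i1)).

(** w = (x + u) y gives y if x + u != 0. Otherwise v = x u y does, unless x = 0, and then y^2 = u =
    0. *)
Lemma FK (z : 'rV[K]_2) : F_inv (F z) = z.
Proof.
rewrite [RHS]pt2E /F_inv F_pt4 !pt4s; congr pt2.
set x := z 0 0; set y := z 0 1; case: ifPn => [h|]; first by field.
rewrite negbK => /eqP h; have [x0|x0] := eqVneq x 0.
  move/eqP: h; rewrite x0 add0r sqrf_eq0 => /eqP ->.
  by rewrite !mul0r.
have y0 : y != 0 by apply: contraNneq x0 => y0; move: h; rewrite y0 expr0n addr0 => ->.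
by field; rewrite x0 y0.
Qed.

Lemma F_inj : injective (@F K). Proof. exact: can_inj FK. Qed.

Lemma Y_pt q y : q 0 i1 = y ^+ 2 -> q 0 i2 = q 0 i0 * y ^+ 3 -> q 0 i3 = q 0 i0 * y + y ^+ 3 -> range (@F K) q.
Proof.
by move=> h1 h2 h3; exists (pt2 (q 0 i0) y) => //; rewrite F_pt2 -h1 -h2 -h3 -pt4E.
Qed.

(** With y = w / (x + u), [eq1] reads u = y^2 and [eq2] determines v. *)
Lemma Y_chart1 q : q 0 i0 + q 0 i1 != 0 -> eq1 q = 0 -> eq2 q = 0 -> range (@F K) q.
Proof.
move=> h /subr0_eq e1 /subr0_eq e2; pose y := q 0 i3 / (q 0 i0 + q 0 i1).
have E : q 0 i1 = y ^+ 2 by rewrite expr_div_n e1 mulrAC divff ?mul1r // expf_neq0.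
have E3 : q 0 i3 = (q 0 i0 + q 0 i1) * y by rewrite /y mulrC divfK.
have Y3 : y ^+ 3 = q 0 i1 * y by rewrite E; ring.
clearbody y; apply: (@Y_pt q y) => //; last by rewrite E3 Y3; ring.
by apply: (mulfI h); rewrite e2 E3 Y3; ring.
Qed.

(** With y = v / (x u), [eq3] reads u = y^2 and [eq2] determines w. *)
Lemma Y_chart2 q : q 0 i0 != 0 -> q 0 i1 != 0 -> eq3 q = 0 -> eq2 q = 0 -> range (@F K) q.
Proof.
move=> hx hu /subr0_eq e3 /subr0_eq e2; set y := q 0 i2 / (q 0 i0 * q 0 i1).
have E : q 0 i1 = y ^+ 2 by rewrite expr_div_n e3; field; rewrite hx hu.
have E2 : q 0 i2 = q 0 i0 * q 0 i1 * y by rewrite /y; field; rewrite hx hu.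
apply: (@Y_pt q y) => //; first by rewrite E2 {1}E; ring.
apply: (mulfI (mulf_neq0 hx hu)); rewrite -e2 E2.
have -> : q 0 i0 * y + y ^+ 3 = (q 0 i0 + q 0 i1) * y by rewrite {1}E; ring.
by ring.
Qed.

Lemma YP q : range (@F K) q <-> [/\ eq1 q = 0, eq2 q = 0, eq3 q = 0 & eq4 q = 0].
Proof.
split=> [[z _ <-]|]; first exact: F_eqs.
move=> [e1 e2 e3 e4].
have [h|h] := eqVneq (q 0 i0 + q 0 i1) 0; last exact: Y_chart1.
have [u0|u0] := eqVneq (q 0 i1) 0.
  apply: (@Y_pt q 0); rewrite ?expr0n //= ?mulr0 ?addr0.
    by move/eqP: e3; rewrite /eq3 u0 expr0n mulr0 subr0 sqrf_eq0 => /eqP.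
  by move/eqP: e1; rewrite /eq1 u0 mulr0 subr0 sqrf_eq0 => /eqP.
have x0 : q 0 i0 != 0 by apply: contraNneq u0 => x0; move: h; rewrite x0 add0r => ->.
exact: Y_chart2.
Qed.

End Equations.

(** * Regular points and analyticity of Y, properness of F *)

Section Surface.
Variables (R : realType) (K : numClosedFieldType) (S : real_structure R K).
Local Notation rn := (rn S).
Local Notation Y := (range (@F K)).

(** [d1], [d2], [d3] are the differentials of [eq1], [eq2], [eq3] at p in the direction v. *)
Definition d1 (p v : 'rV[K]_4) : K := 2 * p 0 i3 * v 0 i3 - (p 0 i0 + p 0 i1) ^+ 2 * v 0 i1
  - 2 * (p 0 i0 + p 0 i1) * (v 0 i0 + v 0 i1) * p 0 i1.
Definition d2 (p v : 'rV[K]_4) : K := (p 0 i0 + p 0 i1) * v 0 i2 + (v 0 i0 + v 0 i1) * p 0 i2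
  - (v 0 i0 * p 0 i1 * p 0 i3 + p 0 i0 * v 0 i1 * p 0 i3 + p 0 i0 * p 0 i1 * v 0 i3).
Definition d3 (p v : 'rV[K]_4) : K := 2 * p 0 i2 * v 0 i2 - 2 * p 0 i0 * v 0 i0 * p 0 i1 ^+ 3
  - 3 * p 0 i0 ^+ 2 * p 0 i1 ^+ 2 * v 0 i1.

Lemma J_eq1 m (f : 'rV[K]_4 -> 'rV[K]_m) p v j : holomorphic_map_at f p ->
  (forall z, f z 0 j = eq1 z) -> (v *m 'J f p) 0 j = d1 p v.
Proof.
move=> hf H; set a := v 0 i0; set b := v 0 i1; set d := v 0 i3.
(* The coefficients of t^2, t^3, ... in [eq1] along p + t v; likewise in the next two lemmas. *)
apply: (J_poly (q0 := d ^+ 2 - 2 * (p 0 i0 + p 0 i1) * (a + b) * b - (a + b) ^+ 2 * p 0 i1)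
  (q1 := - ((a + b) ^+ 2 * b)) (q2 := 0) (q3 := 0) S hf) => t.
by rewrite !H /eq1 /d1 !mxE -/a -/b -/d; ring.
Qed.

Lemma J_eq2 m (f : 'rV[K]_4 -> 'rV[K]_m) p v j : holomorphic_map_at f p ->
  (forall z, f z 0 j = eq2 z) -> (v *m 'J f p) 0 j = d2 p v.
Proof.
move=> hf H; set a := v 0 i0; set b := v 0 i1; set c := v 0 i2; set d := v 0 i3.
apply: (J_poly (q0 := (a + b) * c - (a * b * p 0 i3 + a * p 0 i1 * d + p 0 i0 * b * d))
  (q1 := - (a * b * d)) (q2 := 0) (q3 := 0) S hf) => t.
by rewrite !H /eq2 /d2 !mxE -/a -/b -/c -/d; ring.
Qed.

Lemma J_eq3 m (f : 'rV[K]_4 -> 'rV[K]_m) p v j : holomorphic_map_at f p ->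
  (forall z, f z 0 j = eq3 z) -> (v *m 'J f p) 0 j = d3 p v.
Proof.
move=> hf H; set a := v 0 i0; set b := v 0 i1; set c := v 0 i2.
set x := p 0 i0; set u := p 0 i1.
apply: (J_poly (q0 := c ^+ 2 - (3 * x ^+ 2 * u * b ^+ 2 + 6 * x * a * u ^+ 2 * b + a ^+ 2 * u ^+ 3))
  (q1 := - (x ^+ 2 * b ^+ 3 + 6 * x * a * u * b ^+ 2 + 3 * a ^+ 2 * u ^+ 2 * b))
  (q2 := - (2 * x * a * b ^+ 3 + 3 * a ^+ 2 * u * b ^+ 2)) (q3 := - (a ^+ 2 * b ^+ 3)) S hf) => t.
by rewrite !H /eq3 /d3 !mxE -/a -/b -/c -/x -/u; ring.
Qed.

Lemma polyfun_eq1 p : polyfun p (@eq1 K). Proof. rewrite /eq1; solve_polyfun. Qed.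
Lemma polyfun_eq2 p : polyfun p (@eq2 K). Proof. rewrite /eq2; solve_polyfun. Qed.
Lemma polyfun_eq3 p : polyfun p (@eq3 K). Proof. rewrite /eq3; solve_polyfun. Qed.
Lemma polyfun_eq4 p : polyfun p (@eq4 K). Proof. rewrite /eq4; solve_polyfun. Qed.

(** The codomain is spelled [4 - 2], as [submersive_equations] has it for d = 2. *)
Definition row2 (f g : 'rV[K]_4 -> K) (z : 'rV[K]_4) : 'rV[K]_(4 - 2) := pt2 (f z) (g z).

Lemma row2_holo f g p : polyfun p f -> polyfun p g -> holomorphic_map_at (row2 f g) p.
Proof.
move=> hf hg [[|[|//]] h]; apply: polyfun_holo.
  by move: hf; congr polyfun; apply/funext => z; rewrite mxE.
by move: hg; congr polyfun; apply/funext => z; rewrite mxE.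
Qed.

Lemma row2_eq0 f g z : row2 f g z = 0 <-> f z = 0 /\ g z = 0.
Proof.
split=> [/rowP H|[h1 h2]]; last by rewrite /row2 h1 h2; apply/rowP => j; rewrite !mxE; case: j => [[|[|//]] h].
by have := (H 0, H 1); rewrite !mxE /= => -[].
Qed.

(** On the directions w and v, J gives a triangular 2 x 2 block with nonzero diagonal. *)
Lemma rank2 (J : 'M[K]_(4, 4 - 2)) (v w : 'rV[K]_4) :
  (v *m J) 0 0 = 0 -> (v *m J) 0 1 != 0 -> (w *m J) 0 0 != 0 -> \rank J = 2.
Proof.
move=> h1 h2 h3; apply/eqP; rewrite eqn_leq rank_leq_col /=.
pose A : 'M[K]_(2, 4) := \matrix_(i, j) (if i == 0 then w 0 j else v 0 j).
have EA i j : (A *m J) i j = if i == 0 then (w *m J) 0 j else (v *m J) 0 j.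
  by rewrite mxE; case: ifP => i0; rewrite mxE; apply: eq_bigr => k _; rewrite mxE i0.
apply: leq_trans (mxrankM_maxr A J).
suff /mxrank_unit -> : (A *m J : 'M[K]_2) \in unitmx by [].
rewrite unitmxE unitfE -det_tr det_trig; last first.
  by apply/is_trig_mxP => -[[|[|//]] hi] [[|[|//]] hj] //= _; rewrite mxE EA /= -h1; congr (_ 0 _); apply: val_inj.
apply/prodf_neq0 => -[[|[|//]] hi] _; rewrite mxE EA /=.
  by rewrite (_ : Ordinal hi = 0) //; apply: val_inj.
by rewrite (_ : Ordinal hi = 1) //; apply: val_inj.
Qed.

Lemma near_coord_neq0 (f : 'rV[K]_4 -> K) p : {for p, continuous f} -> f p != 0 -> \forall z \near p, f z != 0.
Proof.
move=> cf fp; have : \forall t \near p, rn (f t - f p) < rn (f p).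
  by apply: ((cvg_rnP S f (f p)).1 cf); rewrite rn_gt0.
by apply: filterS => z; apply: contraTneq => ->; rewrite sub0r rnN ltxx.
Qed.

Lemma coord_cont i (p : 'rV[K]_4) : {for p, continuous (fun z : 'rV[K]_4 => z 0 i)}.
Proof. exact: coord_continuous. Qed.

(** The direction of the coordinate v is seen by [eq2] alone, with value x + u; the direction of w
    gives 2 w for [eq1]. *)
Lemma chart1_equations p : Y p -> p 0 i0 + p 0 i1 != 0 ->
  submersive_equations Y p (row2 (@eq1 K) (@eq2 K) : _ -> 'rV[K]_(4 - 2)).
Proof.
move=> Yp h; have hol := row2_holo (polyfun_eq1 p) (polyfun_eq2 p).
split=> //; last first.
  have : \forall z \near p, (z : 'rV[K]_4) 0 i0 + z 0 i1 != 0.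
    apply: (near_coord_neq0 (f := fun z : 'rV[K]_4 => z 0 i0 + z 0 i1)) => //.
    exact: (cvgD (@coord_continuous K 1 4 0 i0 p) (@coord_continuous K 1 4 0 i1 p)).
  apply: filterS => z hz; rewrite row2_eq0; split=> [/YP[] //|[h1 h2]]; exact: Y_chart1.
have D1 v : (v *m 'J (row2 (@eq1 K) (@eq2 K)) p) 0 0 = d1 p v.
  by apply: J_eq1 => // z; rewrite mxE.
have D2 v : (v *m 'J (row2 (@eq1 K) (@eq2 K)) p) 0 1 = d2 p v.
  by apply: J_eq2 => // z; rewrite mxE.
have [w0|w0] := eqVneq (p 0 i3) 0.
  (* If w = 0, then u = 0 by [eq1], and the direction of u gives - (x + u)^2 instead. *)
  apply: (@rank2 _ (pt4 0 0 1 0) (pt4 0 1 0 0)); rewrite ?D1 ?D2 /d1 /d2 !pt4s.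
  - by ring.
  - by rewrite !(mulr0, mul0r, mulr1, addr0, subr0, add0r).
  have u0 : p 0 i1 = 0.
    have [/eqP + _ _ _] := (YP p).1 Yp; rewrite /eq1 w0 expr0n sub0r oppr_eq0 mulf_eq0 expf_eq0 (negbTE h).
    by rewrite andbF => /eqP.
  by rewrite w0 u0 !(mulr0, mul0r, mulr1, addr0, subr0, add0r, sub0r) oppr_eq0 expf_eq0 /=; move: h; rewrite u0 addr0.
apply: (@rank2 _ (pt4 0 0 1 0) (pt4 0 0 0 1)); rewrite ?D1 ?D2 /d1 /d2 !pt4s.
- by ring.
- by rewrite !(mulr0, mul0r, mulr1, addr0, subr0, add0r).
- by rewrite !(mulr0, mul0r, mulr1, addr0, subr0, add0r) mulf_neq0 // pnatr_eq0.
Qed.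

(** The direction of w gives 0 for [eq3] and - x u for [eq2]; that of v gives 2 v for [eq3], nonzero
    because v^2 = x^2 u^3. *)
Lemma chart2_equations p : Y p -> p 0 i0 != 0 -> p 0 i1 != 0 -> p 0 i0 + p 0 i1 = 0 ->
  submersive_equations Y p (row2 (@eq3 K) (@eq2 K) : _ -> 'rV[K]_(4 - 2)).
Proof.
move=> Yp hx hu xu; have hol := row2_holo (polyfun_eq3 p) (polyfun_eq2 p).
split=> //; last first.
  have H1 : \forall z \near p, (z : 'rV[K]_4) 0 i0 != 0.
    by apply: (near_coord_neq0 (f := fun z : 'rV[K]_4 => z 0 i0)) => //; apply: coord_cont.
  have H2 : \forall z \near p, (z : 'rV[K]_4) 0 i1 != 0.
    by apply: (near_coord_neq0 (f := fun z : 'rV[K]_4 => z 0 i1)) => //; apply: coord_cont.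
  apply: filterS2 H1 H2 => z hz hz'; rewrite row2_eq0; split=> [/YP[] //|[h1 h2]]; exact: Y_chart2.
have D1 v : (v *m 'J (row2 (@eq3 K) (@eq2 K)) p) 0 0 = d3 p v.
  by apply: J_eq3 => // z; rewrite mxE.
have D2 v : (v *m 'J (row2 (@eq3 K) (@eq2 K)) p) 0 1 = d2 p v.
  by apply: J_eq2 => // z; rewrite mxE.
apply: (@rank2 _ (pt4 0 0 0 1) (pt4 0 0 1 0)); rewrite ?D1 ?D2 /d3 /d2 !pt4s.
- by ring.
- by rewrite !(mulr0, mul0r, mulr1, addr0, subr0, add0r, sub0r) oppr_eq0 mulf_neq0.
rewrite !(mulr0, mul0r, mulr1, addr0, subr0, add0r) mulf_neq0 // ?pnatr_eq0 //.
have [_ _ /eqP e3 _] := (YP p).1 Yp; apply: contraTneq e3; rewrite /eq3 => ->.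
by rewrite expr0n sub0r oppr_eq0 mulf_neq0 // expf_neq0.
Qed.

Lemma smooth_Y p : Y p -> p != 0 -> smooth_at 2 Y p.
Proof.
move=> Yp p0; have [xu|xu] := eqVneq (p 0 i0 + p 0 i1) 0; last first.
  by exists (row2 (@eq1 K) (@eq2 K)); apply: chart1_equations.
have [u0|u0] := eqVneq (p 0 i1) 0.
  case/eqP: p0; have [/eqP + _ /eqP + _] := (YP p).1 Yp.
  rewrite /eq1 /eq3 u0 expr0n /= !mulr0 !subr0 !sqrf_eq0 => /eqP h3 /eqP h2.
  by move: xu; rewrite u0 addr0 => h0; rewrite (pt4E p) h0 u0 h2 h3; apply/rowP => j; rewrite !mxE; case: j => [[|[|[|[|//]]]] h].
have x0 : p 0 i0 != 0 by apply: contraNneq u0 => x0; move: xu; rewrite x0 add0r => ->.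
by exists (row2 (@eq3 K) (@eq2 K)); apply: chart2_equations.
Qed.

Lemma Y0 : Y 0.
Proof. by apply/YP; rewrite /eq1 /eq2 /eq3 /eq4 !mxE; split; ring. Qed.

Lemma analytic_Y : analytic_subset Y.
Proof.
move=> p; exists 4%N, (fun z => pt4 (eq1 z) (eq2 z) (eq3 z) (eq4 z)); split.
  move=> j; apply: polyfun_holo; case: j => [[|[|[|[|//]]]] h].
  - by have := polyfun_eq1 p; congr polyfun; apply/funext => z; rewrite mxE.
  - by have := polyfun_eq2 p; congr polyfun; apply/funext => z; rewrite mxE.
  - by have := polyfun_eq3 p; congr polyfun; apply/funext => z; rewrite mxE.
  - by have := polyfun_eq4 p; congr polyfun; apply/funext => z; rewrite mxE.
apply: (@filterE _ (nbhs p)) => z; rewrite YP; split=> [[-> -> -> ->]|/rowP H].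
  by apply/rowP => j; rewrite !mxE; case: j => [[|[|[|[|//]]]] h].
by have := (H i0, H i1, H i2, H i3); rewrite !pt4s !mxE => -[[[]]].
Qed.

Lemma cvg_row {T} {Fl : set_system T} {FF : Filter Fl} n (f : T -> 'rV[K]_n) (l : 'rV[K]_n) :
  (forall j, (fun t => f t 0 j) @ Fl --> l 0 j) -> f @ Fl --> l.
Proof.
move=> H; apply/(cvg_rnP S) => e e0.
have e2 : 0 < e / 2 by rewrite divr_gt0.
have : \forall t \near Fl, forall j, rn (f t 0 j - l 0 j) < e / 2.
  by apply: filter_forall => j; have /(cvg_rnP S)/(_ _ e2) := H j.
apply: filterS => t Ht; apply: (@le_lt_trans _ _ (e / 2)); last by rewrite ltr_pdivrMr // mulr_natr mulr2n ltrDl.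
by apply/(rn_row_le _ (ltW e2)) => j; rewrite !mxE; apply: ltW.
Qed.

Lemma F_continuous : continuous (@F K).
Proof.
move=> z; have c0 := @coord_continuous K 1 2 0 0 z; have c1 := @coord_continuous K 1 2 0 1 z.
have E j : (fun t : 'rV[K]_2 => F t 0 j) = fun t => [:: t 0 0; t 0 1 ^+ 2; t 0 0 * t 0 1 ^+ 3; t 0 0 * t 0 1 + t 0 1 ^+ 3]`_j.
  by apply/funext => t; rewrite mxE.
apply: (@cvg_row _ (nbhs z)) => j; rewrite E; have -> : F z 0 j = (fun t => [:: t 0 0; t 0 1 ^+ 2; t 0 0 * t 0 1 ^+ 3; t 0 0 * t 0 1 + t 0 1 ^+ 3]`_j) z by rewrite mxE.
have c12 : (fun t : 'rV[K]_2 => t 0 1 ^+ 2) @ z --> z 0 1 ^+ 2 by exact: (cvgM c1 c1).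
have c13 : (fun t : 'rV[K]_2 => t 0 1 ^+ 3) @ z --> z 0 1 ^+ 3 by exact: (cvgM c1 (cvgM c1 c1)).
case: j {E} => [[|[|[|[|//]]]] h] /=.
- exact: c0.
- exact: c12.
- exact: (cvgM c0 c13).
- exact: (cvgD (cvgM c0 c1) c13).
Qed.

Lemma compact_rn_bounded n (A : set 'rV[K]_n) : compact A -> exists B : R, forall z, A z -> rn z <= B.
Proof.
move=> cA; have [->|/set0P A0] := eqVneq A set0; first by exists 0.
have [|c _ H] := @compact_EVT_max _ R (fun z : 'rV[K]_n => rn z) A A0 cA; first by apply: continuous_subspaceT; exact: rn_continuous.
by exists (rn c) => z Az; apply: H; rewrite inE.
Qed.

Lemma rn_pt2 (z : 'rV[K]_2) r : 0 <= r -> rn (z 0 0) <= r -> rn (z 0 1) <= r -> rn z <= r.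
Proof.
move=> r0 h0 h1; apply/rn_row_le => // -[[|[|//]] h].
  by apply: le_trans h0; rewrite le_eqVlt; apply/orP; left; apply/eqP; congr (rn (z 0 _)); apply: val_inj.
by apply: le_trans h1; rewrite le_eqVlt; apply/orP; left; apply/eqP; congr (rn (z 0 _)); apply: val_inj.
Qed.

(** x and y^2 are coordinates of F(x, y): if both are at most |B| in norm, then |x| and |y| are at
    most |B| + 1, so the closed preimage lies in a ball. *)
Lemma F_proper : proper_map (@F K).
Proof.
split; first exact: F_continuous.
move=> A cA; have [B HB] := compact_rn_bounded cA.
apply: (@subclosed_compact _ _ [set v : 'rV[K]_2 | rn v <= `|B| + 1]); last 2 first.
- exact: rvball_compact.
- move=> z /= /HB FB; have {}FB : rn (F z) <= `|B| by apply: le_trans FB (ler_norm B).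
  have B0 : 0 <= `|B| + 1 by rewrite addr_ge0.
  apply: rn_pt2 => //.
    by have := le_trans (rn_coord (F z) i0) FB; rewrite F_pt4 pt4s => h; apply: le_trans h _; rewrite lerDl.
  have := le_trans (rn_coord (F z) i1) FB; rewrite F_pt4 pt4s rnX => h.
  rewrite leNgt; apply/negP => h2; move: h; apply/negP; rewrite -ltNge.
  apply: (@lt_le_trans _ _ (`|B| + 1)); first by rewrite ltrDl.
  apply: (@le_trans _ _ ((`|B| + 1) ^+ 2)); last by rewrite lerXn2r ?nnegrE ?rn_ge0 // ltW.
  by rewrite expr2 ler_peMl // lerDr.
- apply: preimage_closed; first by move=> x _; exact: F_continuous.
  by apply: compact_closed => //; exact: norm_hausdorff.
Qed.

End Surface.

(** * The singular point: secants at 0 and the ideal of Y *)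

Section Singularity.
Variables (R : realType) (K : numClosedFieldType) (S : real_structure R K).
Local Notation rn := (rn S).
Local Notation cR := (cR S).
Local Notation Y := (range (@F K)).

Lemma rn_pt4 (a b c d : K) r : 0 <= r -> rn a <= r -> rn b <= r -> rn c <= r -> rn d <= r ->
  rn (pt4 a b c d) <= r.
Proof. by move=> r0 ha hb hc hd; apply/rn_row_le => // -[[|[|[|[|//]]]] h]; rewrite mxE. Qed.

(* v is the limit of the directions of secants of A through points tending to p. *)
Lemma secant_kernel n m (f : 'rV[K]_n -> 'rV[K]_m) (A : set 'rV[K]_n) p v (B r : R) :
  holomorphic_map_at f p -> (\forall z \near p, A z -> f z = 0) -> 0 < r ->
  (forall t : R, 0 < t -> t <= r -> exists z w l, [/\ A z, A w, l != 0,
    rn (z - p) <= B * t /\ rn (w - p) <= B * t & rn (z - w - l *: v) <= B * t * rn l]) ->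
  v *m 'J f p = 0.
Proof.
move=> /(holo_map_strict S)[M [s [s0 M0 H]]] /(nearP_rn S)[e e0 He] r0 HA.
have [D D0 HD] := rn_mulmx S ('J f p).
have B1 : 0 < `|B| + 1 by rewrite ltr_wpDl.
apply/rowP => j; rewrite [RHS]mxE.
apply: (@small_real_eq0 _ _ S _ (M * (`|B| + 1) * (rn v + (`|B| + 1) * r) + D * (`|B| + 1))
   (Num.min r (Num.min (s / (`|B| + 1)) (e / 2 / (`|B| + 1))))).
  by rewrite !lt_min r0 !divr_gt0.
move=> t t0; rewrite !le_min !ler_pdivlMr // => /and3P[tr ts te].
have [z [w [l [Az Aw l0 [hz hw] hl]]]] := HA t t0 tr.
have Bt : B * t <= t * (`|B| + 1).
  by rewrite mulrC ler_wpM2l ?(ltW t0) //; apply: le_trans (ler_norm _) _; rewrite lerDl.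
have e2 : e / 2 < e by rewrite ltr_pdivrMr // mulr_natr mulr2n ltrDl.
have {}te : t * (`|B| + 1) <= e / 2 by rewrite ler_pdivlMr.
have fz : f z = 0 by apply: He => //; apply: le_lt_trans e2; apply: le_trans hz (le_trans Bt te).
have fw : f w = 0 by apply: He => //; apply: le_lt_trans e2; apply: le_trans hw (le_trans Bt te).
have := H (t * (`|B| + 1)) z w; rewrite mulr_gt0 // ts fz fw subrr sub0r rnN.
move=> /(_ isT isT (le_trans hz Bt) (le_trans hw Bt)) h1.
have l1 : 0 < rn l by rewrite rn_gt0.
rewrite -(ler_pM2l l1) -rnM.
have -> : l * (v *m 'J f p) 0 j = ((z - w) *m 'J f p - (z - w - l *: v) *m 'J f p) 0 j.
  by rewrite -mulmxBl subKr -scalemxAl [RHS]mxE.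
apply: le_trans (rn_coord _ _) _; apply: le_trans (rnB _ _) _.
have hl' : rn (z - w - l *: v) <= t * (`|B| + 1) * rn l.
  by apply: le_trans hl _; apply: ler_wpM2r; rewrite ?rn_ge0.
have hzw : rn (z - w) <= rn l * (rn v + (`|B| + 1) * r).
  rewrite -[z - w](subrK (l *: v)); apply: le_trans (rnD _ _) _; rewrite rnZ mulrDr addrC lerD2l.
  apply: le_trans hl' _; rewrite mulrC; apply: ler_wpM2l; first exact: rn_ge0.
  by rewrite mulrC ler_wpM2l // ltW.
apply: (@le_trans _ _ (M * (t * (`|B| + 1)) * (rn l * (rn v + (`|B| + 1) * r)) + D * (t * (`|B| + 1) * rn l))).
  apply: lerD.
    by apply: le_trans h1 _; apply: ler_wpM2l => //; rewrite !mulr_ge0 // ltW.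
  by apply: le_trans (HD _) _; apply: ler_wpM2l => //; rewrite ltW.
by rewrite le_eqVlt; apply/orP; left; apply/eqP; ring.
Qed.

(** F(x, y) - F(x, -y) = (0, 0, 2 x y^3, 2 y (x + y^2)). On x = y this is 2 y^2 e4 up to higher
    order; on x = - y^2 it is exactly - 2 y^5 e3. The chords from 0 to F(t, 0) and F(0, t) give e1
    and e2. *)
Lemma J_vanish m (f : 'rV[K]_4 -> 'rV[K]_m) :
  holomorphic_map_at f 0 -> (\forall z \near (0 : 'rV[K]_4), Y z -> f z = 0) -> 'J f 0 = 0.
Proof.
move=> hf hY.
have YF x y : Y (pt4 x (y ^+ 2) (x * y ^+ 3) (x * y + y ^+ 3)) by exists (pt2 x y) => //; rewrite F_pt2.
have sub4 (a b c d a' b' c' d' : K) : pt4 a b c d - pt4 a' b' c' d' = pt4 (a - a') (b - b') (c - c') (d - d').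
  by apply/rowP => -[[|[|[|[|//]]]] h]; rewrite !mxE.
have sc4 (k a b c d : K) : k *: pt4 a b c d = pt4 (k * a) (k * b) (k * c) (k * d).
  by apply/rowP => -[[|[|[|[|//]]]] h]; rewrite !mxE.
have tE t : 0 < t -> rn (cR t) = t by move=> t0; rewrite rn_cR gtr0_norm.
have t2 n (t : R) : 0 < t -> t <= 1 -> t ^+ n.+1 <= t.
  by move=> t0 t1; rewrite exprS ler_piMr ?exprn_ile1 ?(ltW t0).
have k1 : pt4 1 0 0 0 *m 'J f 0 = 0.
  apply: (@secant_kernel _ _ f Y 0 (pt4 1 0 0 0) 1 1 hf hY ltr01) => t t0 t1.
  exists (pt4 (cR t) (0 ^+ 2) (cR t * 0 ^+ 3) (cR t * 0 + 0 ^+ 3)), 0, (cR t).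
  rewrite !subr0 rn0 !expr0n /= !mulr0 addr0 sc4 mulr1 !mulr0 subrr rn0 mul1r tE //; split=> //.
  - by have := YF (cR t) 0; rewrite !expr0n /= !mulr0 addr0.
  - exact: Y0.
  - by rewrite -(rn_gt0 S) tE.
  - by rewrite rn_pt4 ?(ltW t0) // ?tE ?rn0 // ltW.
  - by rewrite mulr_ge0 // ltW.
have k2 : pt4 0 1 0 0 *m 'J f 0 = 0.
  apply: (@secant_kernel _ _ f Y 0 (pt4 0 1 0 0) 1 1 hf hY ltr01) => t t0 t1.
  exists (pt4 0 (cR t ^+ 2) 0 (cR t ^+ 3)), 0, (cR t ^+ 2).
  rewrite !subr0 rn0 sc4 mulr1 !mulr0 sub4 !subrr !subr0 !mul1r rnX tE //; split=> //.
  - by have := YF 0 (cR t); rewrite !mul0r add0r.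
  - exact: Y0.
  - by rewrite expf_neq0 // -(rn_gt0 S) tE.
  - by rewrite rn_pt4 ?(ltW t0) // ?rnX ?tE ?rn0 // ?(ltW t0) // t2.
  - by rewrite rn_pt4 ?mulr_ge0 ?exprn_ge0 ?(ltW t0) // ?rnX ?tE ?rn0 // ?mulr_ge0 ?exprn_ge0 ?(ltW t0) // exprS.
have k4 : pt4 0 0 0 1 *m 'J f 0 = 0.
  apply: (@secant_kernel _ _ f Y 0 (pt4 0 0 0 1) 2 1 hf hY ltr01) => t t0 t1.
  set T := cR t; have rT : rn T = t by exact: tE.
  exists (pt4 T (T ^+ 2) (T * T ^+ 3) (T * T + T ^+ 3)), (pt4 T ((- T) ^+ 2) (T * (- T) ^+ 3) (T * - T + (- T) ^+ 3)), (2 * T ^+ 2).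
  rewrite !subr0 sc4 mulr1 !mulr0 !sub4.
  have n2 : rn (2 : K) = 2 by rewrite -(cR_nat S) rn_cR normr_nat.
  have b1 : t <= 2 * t by rewrite mulr_natl mulr2n lerDl ltW.
  have tt := t2 _ _ t0 t1; have t00 := ltW t0.
  split; [exact: YF|exact: YF| | |].
  - by rewrite mulf_neq0 // ?pnatr_eq0 // expf_neq0 // -(rn_gt0 S) rT.
  - have e4 : rn (T * T ^+ 3) <= 2 * t by rewrite rnM rnX rT -exprS; apply: le_trans (tt _) b1.
    have e2 : rn (T ^+ 2) <= 2 * t by rewrite rnX rT; apply: le_trans (tt _) b1.
    have e5 : rn (T * T + T ^+ 3) <= 2 * t.
      apply: le_trans (rnD _ _) _; rewrite rnM rnX rT -expr2 mulr_natl mulr2n; exact: lerD.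
    split; apply: rn_pt4; rewrite ?rT ?mulr_ge0 //.
    + by rewrite sqrrN.
    + by rewrite -rnN; move: e4; congr (rn _ <= _); ring.
    + by rewrite -rnN; move: e5; congr (rn _ <= _); ring.
  - have N : 0 <= 2 * t * rn (2 * T ^+ 2) by rewrite !mulr_ge0 // rn_ge0.
    have E : 2 * t * rn (2 * T ^+ 2) = 2 * (2 * t ^+ 3) by rewrite rnM rnX n2 rT; ring.
    apply: rn_pt4 => //.
    + by rewrite subrr subr0 rn0.
    + by rewrite sqrrN subrr subr0 rn0.
    + rewrite E (_ : _ - _ - 0 = 2 * T ^+ 4); last by ring.
      rewrite rnM rnX n2 rT ler_pM2l // exprS; apply: (@le_trans _ _ (t ^+ 3)).
        by rewrite ler_piMl // exprn_ge0.
      by rewrite mulr_natl mulr2n lerDl exprn_ge0.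
    + rewrite E (_ : _ - _ - _ = 2 * T ^+ 3); last by ring.
      by rewrite rnM rnX n2 rT ler_pM2l // mulr_natl mulr2n lerDl exprn_ge0.
have k3 : pt4 0 0 1 0 *m 'J f 0 = 0.
  apply: (@secant_kernel _ _ f Y 0 (pt4 0 0 1 0) 1 1 hf hY ltr01) => t t0 t1.
  set T := cR t; have rT : rn T = t by exact: tE.
  exists (pt4 (- T ^+ 2) (T ^+ 2) (- T ^+ 2 * T ^+ 3) (- T ^+ 2 * T + T ^+ 3)),
    (pt4 (- T ^+ 2) ((- T) ^+ 2) (- T ^+ 2 * (- T) ^+ 3) (- T ^+ 2 * - T + (- T) ^+ 3)), (- 2 * T ^+ 5).
  rewrite !subr0 sc4 mulr1 !mulr0 !sub4.
  have tt := t2 _ _ t0 t1; have t00 := ltW t0.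
  have T0 : T != 0 by rewrite -(rn_gt0 S) rT.
  have e2 : rn (T ^+ 2) <= 1 * t by rewrite rnX rT mul1r; apply: tt.
  have e5 : rn (T ^+ 5) <= 1 * t by rewrite rnX rT mul1r; apply: tt.
  have t01 : 0 <= 1 * t by rewrite mul1r.
  split; [exact: YF|exact: YF| | |].
  - by rewrite mulf_neq0 // ?oppr_eq0 ?pnatr_eq0 // expf_neq0.
  - split; apply: rn_pt4 => //; rewrite ?rnN ?sqrrN //.
    + by rewrite -rnN; move: e5; congr (rn _ <= _); ring.
    + by rewrite (_ : _ + _ = 0) ?rn0 //; ring.
    + by move: e5; congr (rn _ <= _); ring.
    + by rewrite (_ : _ + _ = 0) ?rn0 //; ring.
  - have N : 0 <= 1 * t * rn (- 2 * T ^+ 5) by rewrite !mulr_ge0 // rn_ge0.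
    apply: rn_pt4 => //; rewrite (_ : _ - _ - _ = 0) ?rn0 //; ring.
apply/row_matrixP => i; rewrite row0 rowE.
have -> : delta_mx 0 i = @pt4 K (i == i0)%:R (i == i1)%:R (i == i2)%:R (i == i3)%:R.
  by apply/rowP => j; rewrite !mxE eqxx /=; case: j => [[|[|[|[|//]]]] h]; case: i => [[|[|[|[|//]]]] h'].
by case: i => [[|[|[|[|//]]]] h] /=.
Qed.

(** With a zero Jacobian the rank condition leaves no equation at all, so Y would contain a
    neighbourhood of 0; but (0, 0, r, 0) with r > 0 violates v^2 = x^2 u^3. *)
Lemma not_smooth_Y0 d : ~ smooth_at d Y 0.
Proof.
move=> [f [d4 _ hf + H]]; have J0 : 'J f 0 = 0.
  by apply: J_vanish => //; apply: filterS H => z [h _].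
rewrite J0 mxrank0 => E.
move/(nearP_rn S): H => [e e0 He].
have e2 : 0 < e / 2 by rewrite divr_gt0.
have : Y (pt4 0 0 (cR (e / 2)) 0).
  apply: (He _ _).2; last first.
    by apply/rowP => j; have : (j < 0)%N by [apply: leq_trans (ltn_ord j) _; rewrite -E].
  rewrite subr0; apply: (@le_lt_trans _ _ (e / 2)); last by rewrite ltr_pdivrMr // mulr_natr mulr2n ltrDl.
  by apply: rn_pt4; rewrite ?rn0 ?rn_cR ?gtr0_norm // ltW.
move/YP => [_ _ + _]; rewrite /eq3 !pt4s expr0n mul0r subr0 => /eqP.
by rewrite sqrf_eq0 (cR_eq0 S) gt_eqF.
Qed.

Lemma isolated_Y : isolated_singularity Y 0.
Proof.
split; first by split; [exact: Y0|exact: not_smooth_Y0].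
apply/(nearPd_rn S); exists 1 => // z _ z0 [Yz H]; exact: (H 2 (smooth_Y S Yz z0)).
Qed.

Lemma F0 : F (0 : 'rV[K]_2) = 0.
Proof. by rewrite F_pt4 !mxE; apply/rowP => -[[|[|[|[|//]]]] h]; rewrite !mxE /= ?expr0n ?mul0r ?addr0. Qed.

Lemma pure_dim_Y : pure_dim 2 Y.
Proof.
move=> q Yq; have [->|q0] := eqVneq q 0; last first.
  by apply: subset_closure; exact: (smooth_Y S Yq q0).
move=> B /(nearP_rn S)[e e0 He].
have e2 : 0 < Num.min 1 (e / 2) by rewrite lt_min ltr01 divr_gt0.
(* 0 is approached through the regular points F(x, 0) = (x, 0, 0, 0), x != 0. *)
pose x := cR (Num.min 1 (e / 2)).
have rx : rn x = Num.min 1 (e / 2) by rewrite rn_cR gtr0_norm.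
have E : F (pt2 x 0) = pt4 x 0 0 0 by rewrite F_pt2 !expr0n /= !mulr0 addr0.
have Yx : Y (pt4 x 0 0 0) by exists (pt2 x 0).
exists (pt4 x 0 0 0); split.
  apply: (smooth_Y S) => //; apply/eqP => /rowP/(_ i0); rewrite pt4s mxE => /eqP.
  by rewrite -(rn_eq0 S) rx gt_eqF.
apply: He; rewrite subr0; apply: (@le_lt_trans _ _ (e / 2)); last by rewrite ltr_pdivrMr // mulr_natr mulr2n ltrDl.
have e20 : 0 <= e / 2 by rewrite divr_ge0 // ltW.
by apply: rn_pt4; rewrite ?rn0 // rx ge_min lexx orbT.
Qed.

Lemma surface_Y : surface Y.
Proof. by split; [exists 0; exact: Y0|exact: analytic_Y|exact: pure_dim_Y]. Qed.

Lemma holo_lip n (f : 'rV[K]_n -> K) p : holomorphic_at f p ->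
  exists D r : R, [/\ 0 < r, 0 <= D & forall z, rn (z - p) <= r -> rn (f z - f p) <= D * rn (z - p)].
Proof.
move=> /(holo_strict S)[L [M [r [r0 M0 H]]]].
have [B B0 HB] := rn_mulmx S L.
exists (B + M * r), r; split=> //; first exact: addr_ge0 (ltW B0) (mulr_ge0 M0 (ltW r0)).
move=> z zr; have := H r z p r0 (lexx _) zr; rewrite subrr rn0 => /(_ (ltW r0)) h.
rewrite -[f z - f p](subrK (((z - p) *m L) 0 0)) mulrDl addrC.
apply: le_trans (rnD _ _) _; apply: lerD => //.
by apply: le_trans (rn_coord _ _) _.
Qed.

(** The two generators are O(|z|^2), so modulo O(|z|^3) only the values at 0 of the coefficients h
    count, and three quadratic parts would lie in the span of two. *)
Lemma not_ci_Y0 : ~ complete_intersection_at 2 Y 0.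
Proof.
move=> [f [hf gen]].
pose f' z : 'rV[K]_(4 - 2) := \row_i f i z.
have hf' : holomorphic_map_at f' 0.
  by move=> i; have [h _] := hf i; move: h; congr holomorphic_at; apply/funext => z; rewrite mxE.
have vf' : \forall z \near (0 : 'rV[K]_4), Y z -> f' z = 0.
  have : \forall z \near (0 : 'rV[K]_4), forall i, Y z -> f i z = 0.
    by apply: (@filter_forall _ _ (fun i z => Y z -> f i z = 0) (nbhs (0 : 'rV[K]_4))) => i; have [] := hf i.
  by apply: filterS => z H Yz; apply/rowP => i; rewrite !mxE H.
have J0 := J_vanish hf' vf'.
have f'0 : f' 0 = 0 by move/(nearP_rn S): vf' => [e e0]; apply; [rewrite subrr rn0|exact: Y0].
have [M [r [r0 M0 Hf]]] := holo_map_strict S hf'.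
have quad z : rn z <= r -> rn (f' z) <= M * rn z ^+ 2.
  move=> zr; have [->|z0] := eqVneq z 0; first by rewrite f'0 !rn0 expr2 !mulr0.
  have := Hf (rn z) z 0; rewrite rn_gt0 z0 zr !subr0 rn0 f'0 J0 mulmx0 !subr0 lexx rn_ge0.
  by move=> /(_ isT isT isT isT); rewrite expr2 mulrA.
(* In this order the quadratic parts are v^2, w^2 and v w. *)
pose g (j : 'I_3) : 'rV[K]_4 -> K := [:: @eq3 K; @eq1 K; @eq4 K]`_j.
have gv j : vanishing_germ Y 0 (g j).
  split; first by case: j => [[|[|[|//]]] h]; apply: polyfun_holo; [exact: polyfun_eq3|exact: polyfun_eq1|exact: polyfun_eq4].
  by apply: (@filterE _ (nbhs (0 : 'rV[K]_4))) => z /YP[]; case: j => [[|[|[|//]]] h].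
have [h Hh] := @choice _ _ (fun j (h : 'I_(4 - 2) -> 'rV[K]_4 -> K) => (forall i, holomorphic_at (h i) 0) /\
        \forall z \near (0 : 'rV[K]_4), g j z = \sum_i h i z * f i z) (fun j => gen (g j) (gv j)).
pose H0 : 'M[K]_(3, 4 - 2) := \matrix_(j, i) h j i 0.
(* Three rows in a space of dimension two are linearly dependent. *)
have [c cH c0] : exists2 c : 'rV[K]_3, c *m H0 = 0 & c != 0.
  have : kermx H0 != 0.
    rewrite -mxrank_eq0 mxrank_ker -lt0n subn_gt0; exact: leq_ltn_trans (rank_leq_col _) _.
  by move=> /rowV0Pn[c /sub_kermxP cH c0]; exists c.
(* On the line through v the combination of the three functions is q t^2, but it is also O(t^3). *)
have key v (q : K) : (forall t : R, \sum_j c 0 j * g j (cR t *: v) = cR t ^+ 2 * q) -> q = 0.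
  move=> Hq.
  have [D [s [s0 D0 HD]]] : exists D s : R, [/\ 0 < s, 0 <= D & forall ji : 'I_3 * 'I_(4 - 2), forall z, rn z <= s -> rn (h ji.1 ji.2 z - h ji.1 ji.2 0) <= D * rn z].
    have lip (ji : 'I_3 * 'I_(4 - 2)) := holo_lip ((Hh ji.1).1 ji.2).
    have [DD HDD] := choice lip; have [rr Hrr] := choice HDD.
    exists (\sum_ji DD ji), (\big[Num.min/1]_ji rr ji); split.
    - by apply: lt_bigmin => // i _; have [] := Hrr i.
    - by apply: sumr_ge0 => i _; have [] := Hrr i.
    move=> ji z zs; have [_ _] := Hrr ji; move=> /(_ z); rewrite subr0 => /(_ (le_trans zs _)) hh.
    apply: le_trans (hh (bigmin_le _ _ _)) _; apply: ler_wpM2r; first exact: rn_ge0.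
    by rewrite (bigD1 ji) //= lerDl sumr_ge0 // => k _; have [] := Hrr k.
  have near : \forall z \near (0 : 'rV[K]_4), forall j, g j z = \sum_i h j i z * f i z.
    by apply: (@filter_forall _ _ (fun j z => g j z = \sum_i h j i z * f i z) (nbhs (0 : 'rV[K]_4))) => j; have [] := Hh j.
  move/(nearP_rn S): near => [e e0 He].
  have v1 : 0 < rn v + 1 by rewrite ltr_wpDl ?rn_ge0.
  pose m := Num.min s (Num.min (e / 2) r).
  have m0 : 0 < m by rewrite !lt_min s0 divr_gt0.
  apply: (@small_real_eq0 _ _ S _ (\sum_j \sum_(i < 4 - 2) rn (c 0 j) * (D * (M * rn v ^+ 3))) (m / (rn v + 1))).
    by rewrite divr_gt0.
  move=> t t0; rewrite ler_pdivlMr // => tm.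
  have tv : rn (cR t *: v) = t * rn v by rewrite rnZ rn_cR gtr0_norm.
  have : t * rn v <= m by apply: le_trans tm; rewrite ler_wpM2l ?(ltW t0) // lerDl.
  rewrite -tv !le_min => /and3P[vs ve vr].
  have ve' : rn (cR t *: v - 0) < e by rewrite subr0; apply: le_lt_trans ve _; rewrite ltr_pdivrMr // mulr_natr mulr2n ltrDl.
  have t2 : 0 < t ^+ 2 by rewrite exprn_gt0.
  rewrite -(ler_pM2l t2) (_ : t ^+ 2 * rn q = rn (cR t ^+ 2 * q)); last by rewrite rnM rnX rn_cR gtr0_norm.
  rewrite -Hq.
  (* Since c annihilates the values at 0, each h j i may be replaced by its increment, of order
     t. *)
  have -> : \sum_j c 0 j * g j (cR t *: v) = \sum_j \sum_i c 0 j * ((h j i (cR t *: v) - h j i 0) * f i (cR t *: v)).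
    transitivity (\sum_j \sum_i c 0 j * (h j i (cR t *: v) * f i (cR t *: v))).
      by apply: eq_bigr => j _; rewrite (He _ ve') mulr_sumr.
    apply/eqP; rewrite -subr_eq0 -sumrB; apply/eqP.
    transitivity (\sum_j \sum_i c 0 j * H0 j i * f i (cR t *: v)).
      by apply: eq_bigr => j _; rewrite -sumrB; apply: eq_bigr => i _; rewrite mxE; ring.
    rewrite exchange_big /= big1 // => i _; rewrite -mulr_suml.
    by move/rowP: cH => /(_ i); rewrite !mxE => ->; rewrite mul0r.
  apply: le_trans (rn_sum _ _ _) _ => /=.
  rewrite mulr_suml mulr_sumr; apply: ler_sum => j _.
  apply: le_trans (rn_sum _ _ _) _ => /=.
  rewrite mulr_suml mulr_sumr; apply: ler_sum => i _.
  rewrite rnM.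
  have -> : t ^+ 2 * (rn (c 0 j) * (D * (M * rn v ^+ 3)) * t) = rn (c 0 j) * ((D * (t * rn v)) * (M * (t * rn v) ^+ 2)) by ring.
  apply: ler_wpM2l; first exact: rn_ge0.
  rewrite rnM; apply: ler_pM; rewrite ?rn_ge0 //.
    by rewrite -tv; exact: (HD (j, i)).
  rewrite -tv; apply: le_trans (quad _ vr); have := rn_coord (f' (cR t *: v)) i; by rewrite mxE.
have Z k : k *: (0 : K) = 0 by rewrite scaler0.
pose o0 : 'I_3 := @Ordinal 3 0 isT; pose o1 : 'I_3 := @Ordinal 3 1 isT; pose o2 : 'I_3 := @Ordinal 3 2 isT.
have sum3 (x : 'I_3 -> K) : \sum_j x j = x o0 + x o1 + x o2.
  by rewrite !big_ord_recl big_ord0 addr0 addrA; congr (x _ + x _ + x _); apply: val_inj.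
(* Where x = u = 0 the three functions are v^2, w^2 and v w: the directions e3, e4 and e3 + e4
   isolate the three coefficients in turn. *)
have c1 : c 0 o0 = 0.
  apply: (key (pt4 0 0 1 0)) => t; rewrite sum3 /g /= /eq1 /eq3 /eq4 !mxE /=; ring.
have c2 : c 0 o1 = 0.
  apply: (key (pt4 0 0 0 1)) => t; rewrite sum3 /g /= /eq1 /eq3 /eq4 !mxE /=; ring.
have c3 : c 0 o2 = 0.
  apply: (key (pt4 0 0 1 1)) => t; rewrite sum3 c1 c2 /g /= /eq1 /eq3 /eq4 !mxE /=; ring.
case/eqP: c0; apply/rowP => -[[|[|[|//]]] hj]; rewrite mxE.
- by rewrite -[RHS]c1; congr (c 0 _); apply: val_inj.
- by rewrite -[RHS]c2; congr (c 0 _); apply: val_inj.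
- by rewrite -[RHS]c3; congr (c 0 _); apply: val_inj.
Qed.

End Singularity.

(** * Paths and loops in C^2 minus the origin *)

Section PuncturedPlane.
Variables (R : realType) (K : numClosedFieldType) (S : real_structure R K).
Local Notation rn := (rn S).
Local Notation cR := (cR S).
Local Notation re := (re S).
Local Notation im := (im S).
Local Notation V := 'rV[K]_2.
Local Notation I := (`[(0 : R), (1 : R)]%classic).

(** Written with the norm, from which it inherits continuity. *)
Definition pos_part (a : R) : R := (`|a| + a) / 2.

Lemma pos_part_ge0E a : 0 <= a -> pos_part a = a.
Proof. by move=> a0; rewrite /pos_part ger0_norm //; lra. Qed.
Lemma pos_part_le0E a : a <= 0 -> pos_part a = 0.
Proof. by move=> a0; rewrite /pos_part ler0_norm // addNr mul0r. Qed.
Lemma pos_part_ge0 a : 0 <= pos_part a.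
Proof. by have [a0|/ltW a0] := leP 0 a; [rewrite pos_part_ge0E|rewrite pos_part_le0E]. Qed.

Lemma pos_part_cvg {T} {Fl : set_system T} {FF : Filter Fl} (f : T -> R) (l : R) :
  f @ Fl --> l -> (fun t => pos_part (f t)) @ Fl --> pos_part l.
Proof.
by move=> h; apply: cvgM; [apply: cvgD => //; exact: cvg_norm|exact: cvg_cst].
Qed.

(** The hat function on [-1, 1]; its integer translates serve for linear interpolation. *)
Definition tent (x : R) : R := pos_part (1 - `|x|).

Lemma tent_out x : 1 <= `|x| -> tent x = 0.
Proof. by move=> h; rewrite /tent pos_part_le0E // subr_le0. Qed.
Lemma tent_ge0 x : 0 <= tent x. Proof. exact: pos_part_ge0. Qed.

Lemma tent_sum n (x : R) : 0 <= x -> x <= n%:R -> \sum_(k < n.+1) tent (x - k%:R) = 1.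
Proof.
elim: n => [|n IH] x0 xn.
  by rewrite big_ord_recl big_ord0 addr0 subr0 (_ : x = 0) ?/tent ?normr0 ?subr0 ?pos_part_ge0E //; apply/eqP; rewrite eq_le x0 xn.
rewrite big_ord_recr /=; have [h|h] := leP x n%:R.
  rewrite IH // tent_out ?addr0 // distrC -natr1 ler_normr; apply/orP; left; lra.
rewrite big_ord_recr /= big1 ?add0r; last first.
  move=> [i hi] _ /=; rewrite tent_out // ler_normr; apply/orP; left.
  have : (i.+1)%:R <= n%:R :> R by rewrite ler_nat.
  rewrite -natr1; lra.
rewrite -natr1 in xn *; rewrite /tent ger0_norm ?subr_ge0 ?(ltW h) // ler0_norm; last lra.
by rewrite !pos_part_ge0E; lra.
Qed.

Lemma tent_two n (x : R) : 0 <= x -> x <= n.+1%:R ->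
  exists2 k, (k <= n)%N & forall j, j != k -> j != k.+1 -> tent (x - j%:R) = 0.
Proof.
elim: n => [|n IH] x0 xn.
  exists 0%N => // -[|[|j]] // _ _; apply: tent_out; rewrite distrC ler_normr; apply/orP; left.
  have : (2%:R : R) <= j.+2%:R by rewrite ler_nat.
  lra.
have [h|h] := leP x n.+1%:R.
  by have [k kn Hk] := IH x0 h; exists k => //; apply: leq_trans kn _.
exists n.+1 => // j j1 j2; apply: tent_out.
have [h1|h1] := ltnP j n.+1.
  have : j.+1%:R <= n.+1%:R :> R by rewrite ler_nat.
  by rewrite -[j.+1%:R]natr1 => h2; rewrite ler_normr; apply/orP; left; lra.
have h2 : (n.+3 <= j)%N by rewrite ltn_neqAle eq_sym j2 /= ltn_neqAle eq_sym j1 h1.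
have : n.+2%:R + 1 <= j%:R :> R by rewrite natr1 ler_nat.
by move=> h3; rewrite distrC ler_normr; apply/orP; left; lra.
Qed.

Definition real4 (z : V) : 'rV[R]_4 := \row_j [:: re (z 0 0); im (z 0 0); re (z 0 1); im (z 0 1)]`_j.

Lemma real4D z w : real4 (z + w) = real4 z + real4 w.
Proof. by apply/rowP => -[[|[|[|[|//]]]] h]; rewrite !mxE /= ?reD ?imD. Qed.
Lemma real4Z k z : real4 (cR k *: z) = k *: real4 z.
Proof. by apply/rowP => -[[|[|[|[|//]]]] h]; rewrite !mxE /= ?re_cRM ?im_cRM. Qed.

(** A bare predicate: V carries a K-linear structure, whereas these forms are linear over R only. *)
Definition real_linear (l : V -> R) :=
  (forall z w, l (z + w) = l z + l w) /\ (forall k z, l (cR k *: z) = k * l z).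

(** Three linear equations in four real unknowns. *)
Lemma kill3 (x y z : V) : exists2 a : 'cV[R]_4, a != 0 &
  [/\ (real4 x *m a) 0 0 = 0, (real4 y *m a) 0 0 = 0 & (real4 z *m a) 0 0 = 0].
Proof.
pose M : 'M[R]_(3, 4) := \matrix_(i, j) [:: real4 x 0 j; real4 y 0 j; real4 z 0 j]`_i.
have : kermx M^T != 0.
  rewrite -mxrank_eq0 mxrank_ker -lt0n subn_gt0; exact: leq_ltn_trans (rank_leq_col _) _.
move=> /rowV0Pn[c /sub_kermxP cM c0]; exists c^T; first by rewrite trmx_eq0.
have H : M *m c^T = 0 by rewrite -[M]trmxK -trmx_mul cM trmx0.
have row (i : 'I_3) (v : 'rV[R]_4) : (forall j, M i j = v 0 j) -> (v *m c^T) 0 0 = 0.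
  move=> E; have /matrixP/(_ i 0) := H; rewrite !mxE => E2; rewrite -[RHS]E2.
  by apply: eq_bigr => j _; rewrite E.
split.
- by apply: (row (@Ordinal 3 0 isT)) => j; rewrite mxE.
- by apply: (row (@Ordinal 3 1 isT)) => j; rewrite mxE.
- by apply: (row (@Ordinal 3 2 isT)) => j; rewrite mxE.
Qed.

Lemma poly_nonroot (p : {poly R}) : p != 0 -> exists m : nat, p.[m%:R] != 0.
Proof.
move=> p0; apply: contrapT => H.
have all0 m : root p m%:R.
  by apply/rootP/eqP; apply: contraT => h; case: H; exists m.
have := @max_poly_roots _ p [seq m%:R | m <- iota 0 (size p)] p0.
rewrite size_map size_iota ltnn => H2; suff : false by []; apply: H2.
  by apply/allP => _ /mapP[m _ ->].
by rewrite map_inj_uniq ?iota_uniq // => a b /eqP; rewrite eqr_nat => /eqP.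
Qed.

(* The points (1, m, m^2, m^3) of the moment curve leave every proper real subspace of C^2 for m large. *)
Lemma generic_vector n (x : V) (y z : 'I_n -> V) : exists u : V, forall k, exists2 l : V -> R,
  real_linear l & [/\ l x = 0, l (y k) = 0, l (z k) = 0 & l u != 0].
Proof.
have [a Ha] := @choice _ _ (fun k (a : 'cV[R]_4) => a != 0 /\ [/\ (real4 x *m a) 0 0 = 0, (real4 (y k) *m a) 0 0 = 0 & (real4 (z k) *m a) 0 0 = 0])
  (fun k => let: ex_intro2 a h1 h2 := kill3 x (y k) (z k) in ex_intro _ a (conj h1 h2)).
(* [(p k).[m]] is the value of the form [a k] at (1, m, m^2, m^3); passing to the product of these
   nonzero polynomials lets one m serve for all k. *)
pose p k : {poly R} := \poly_(j < 4) (a k (inord j) 0).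
have pn0 k : p k != 0.
  have [a0 _] := Ha k; apply: contra_neq a0 => pk0; apply/matrixP => j j'; rewrite (ord1 j') mxE.
  have : (p k)`_j = 0 by rewrite pk0 coef0.
  by rewrite coef_poly ltn_ord inord_val.
have [m Hm] : exists m : nat, (\prod_k p k).[m%:R] != 0.
  by apply: poly_nonroot; apply/prodf_neq0 => k _.
pose u : V := pt2 (cR 1 + 'i * cR m%:R) (cR (m%:R ^+ 2) + 'i * cR (m%:R ^+ 3)).
exists u => k; exists (fun w => (real4 w *m a k) 0 0).
  split=> [w w'|t w]; first by rewrite real4D mulmxDl mxE.
  by rewrite real4Z -scalemxAl mxE.
have [_ [h1 h2 h3]] := Ha k; split=> //.
rewrite horner_prod in Hm; have /prodf_neq0/(_ k isT) := Hm.
rewrite horner_poly mxE; congr (_ != _); apply: eq_bigr => j _.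
rewrite inord_val mulrC; congr (_ * _); rewrite mxE /u pt20 pt21 !re_rect !im_rect.
by case: j => [[|[|[|[|//]]]] h].
Qed.

Lemma real_linear_sum n (l : V -> R) (w : 'I_n -> V) (t : 'I_n -> R) : real_linear l ->
  l (\sum_i cR (t i) *: w i) = \sum_i t i * l (w i).
Proof.
move=> [lD lZ]; have l0 : l 0 = 0 by have := lZ 0 0; rewrite scaler0 mul0r.
by elim/big_rec2 : _ => // i a b _ <-; rewrite lD lZ.
Qed.

Lemma real_linear0 (l : V -> R) : real_linear l -> l 0 = 0.
Proof. by move=> [_ lZ]; have := lZ 0 0; rewrite scaler0 mul0r. Qed.

(** The near-covering form of compactness makes n uniform; halving the radius at x leaves room for
    s' beside s. *)
Lemma unif_cont (c : R -> V) (d : R) : {within I, continuous c} -> 0 < d ->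
  exists n : nat, forall s s' : R, s \in `[0, 1]%R -> s' \in `[0, 1]%R -> `|s - s'| <= n.+1%:R^-1 -> rn (c s - c s') < d.
Proof.
move=> /subspace_continuousP cc d0.
have := (compact_near_coveringP I).1 (@segment_compact R 0 1) nat \oo
  (fun n s => s \in `[0, 1]%R -> forall s', s' \in `[0, 1]%R -> `|s - s'| <= n.+1%:R^-1 -> rn (c s - c s') < d) _.
case.
  move=> x Ix; have d2 : 0 < d / 2 by rewrite divr_gt0.
  have : \forall t \near within I (nbhs x), rn (c t - c x) < d / 2.
    exact: ((cvg_rnP S c (c x)).1 (cc x Ix) _ d2).
  move=> /nbhs_ballP[e /= e0 He].
  have e2 : 0 < e / 2 by rewrite divr_gt0.
  have Hinv : \forall n \near \oo, n.+1%:R^-1 < e / 2 by exact: near_infty_natSinv_lt (PosNum e2).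
  exists (ball x (e / 2), [set n : nat | n.+1%:R^-1 < e / 2]); first by split => //=; exact: nbhsx_ballx.
  move=> [s n] /= [xs hn] Is s' Is' ss'.
  have h1 : rn (c s - c x) < d / 2.
    apply: He => //; apply: lt_trans xs _; rewrite ltr_pdivrMr // mulr_natr mulr2n ltrDl //.
  have h2 : rn (c s' - c x) < d / 2.
    apply: He => //; rewrite /ball /=; rewrite /ball /= in xs.
    by apply: le_lt_trans (ler_distD s _ _) _; rewrite [ltRHS](splitr e); apply: ltrD => //; exact: le_lt_trans hn.
  rewrite -[c s - c s'](subrKA (c x)); apply: le_lt_trans (rnD _ _) _.
  rewrite (rn_distC S (c x)); lra.
move=> N _ HN; exists N => s s' Is Is' h; exact: (HN N (leqnn N) s Is Is).
Qed.

Lemma rn_ge_min (c : R -> V) : {within I, continuous c} -> (forall s, s \in `[0, 1]%R -> c s != 0) ->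
  exists2 mu, 0 < mu & forall s, s \in `[0, 1]%R -> mu <= rn (c s).
Proof.
move=> cc c0.
have I0 : I !=set0 by exists 0; rewrite /= in_itv /= lexx ler01.
have [|s sI Hs] := @compact_EVT_min _ R (fun s => rn (c s)) I I0 (@segment_compact R 0 1).
  apply/subspace_continuousP => x Ix; move/subspace_continuousP: cc => /(_ x Ix) cx.
  exact: (cvg_comp _ _ cx (@rn_continuous R K S V (c x))).
exists (rn (c s)); first by rewrite rn_gt0 c0 //; move: sI; rewrite inE.
by move=> s' Is'; apply: Hs; rewrite inE.
Qed.

(** Piecewise linear interpolation of c at the n + 2 nodes k / (n + 1). *)
Definition polygon (c : R -> V) (n : nat) (s : R) : V :=
  \sum_(k < n.+2) cR (tent (n.+1%:R * s - k%:R)) *: c (k%:R / n.+1%:R).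

Lemma polygon_node n (k : 'I_n.+2) : (k%:R / n.+1%:R : R) \in `[0, 1]%R.
Proof.
rewrite in_itv /= divr_ge0 // ler_pdivrMr // mul1r ler_nat -ltnS; exact: ltn_ord.
Qed.

(** A point of the polygon is a convex combination of values of c at nodes closer to s than 1 / (n +
    1). *)
Lemma polygon_close (c : R -> V) n d s : 0 <= d ->
  (forall s s' : R, s \in `[0, 1]%R -> s' \in `[0, 1]%R -> `|s - s'| <= n.+1%:R^-1 -> rn (c s - c s') < d) ->
  s \in `[0, 1]%R -> rn (polygon c n s - c s) <= d.
Proof.
move=> d0 H Is; have := Is; rewrite in_itv /= => /andP[s0 s1].
have n0 : 0 < n.+1%:R :> R by [].
have sum1 : \sum_(k < n.+2) tent (n.+1%:R * s - k%:R) = 1.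
  by apply: tent_sum; [rewrite mulr_ge0|rewrite ler_piMr].
have -> : c s = \sum_(k < n.+2) cR (tent (n.+1%:R * s - k%:R)) *: c s.
  by rewrite -scaler_suml -cR_sum sum1 cR1 scale1r.
rewrite /polygon -sumrB; apply: le_trans (rn_sum _ _ _) _ => /=.
apply: (@le_trans _ _ (\sum_(k < n.+2) tent (n.+1%:R * s - k%:R) * d)); last by rewrite -mulr_suml sum1 mul1r.
apply: ler_sum => k _; rewrite -scalerBr rnZ rn_cR ger0_norm ?tent_ge0 //.
have [h|h] := leP 1 `|n.+1%:R * s - k%:R|; first by rewrite tent_out // !mul0r.
apply: ler_wpM2l; first exact: tent_ge0.
apply: ltW; apply: H => //; first exact: polygon_node.
rewrite (_ : k%:R / n.+1%:R - s = (k%:R - n.+1%:R * s) / n.+1%:R); last by field; rewrite gt_eqF.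
rewrite normrM normfV (gtr0_norm n0) ler_piMl ?invr_ge0 ?(ltW n0) // distrC; exact: ltW.
Qed.

Lemma polygon0 (c : R -> V) n : polygon c n 0 = c 0.
Proof.
rewrite /polygon big_ord_recl big1 ?addr0 /=.
  by rewrite mulr0 subr0 mul0r /tent normr0 subr0 pos_part_ge0E // cR1 scale1r.
move=> i _; rewrite tent_out ?cR0 ?scale0r // mulr0 sub0r normrN ger0_norm //.
by rewrite ler1n.
Qed.

Lemma polygon1 (c : R -> V) n : polygon c n 1 = c 1.
Proof.
rewrite /polygon big_ord_recr big1 ?add0r /=.
  by rewrite add0r mulr1 subrr /tent normr0 subr0 pos_part_ge0E // cR1 scale1r divff.
move=> [i hi] _ /=; rewrite tent_out ?cR0 ?scale0r // mulr1 ler_normr; apply/orP; left.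
have : i.+1%:R <= n.+1%:R :> R by rewrite ler_nat.
rewrite -[i.+1%:R]natr1; lra.
Qed.

(** The point lies on one edge, and the form attached to that edge vanishes at both its ends. *)
Lemma polygon_kill (c : R -> V) n s (l : 'I_n.+1 -> V -> R) : s \in `[0, 1]%R ->
  (forall k, real_linear (l k)) ->
  (forall k : 'I_n.+1, l k (c (k%:R / n.+1%:R)) = 0 /\ l k (c (k.+1%:R / n.+1%:R)) = 0) ->
  exists k, l k (polygon c n s) = 0.
Proof.
rewrite in_itv /= => /andP[s0 s1] lin H.
have [||k kn Hk] := @tent_two n (n.+1%:R * s); [by rewrite mulr_ge0|by rewrite ler_piMr|].
exists (Ordinal (kn : (k < n.+1)%N)); rewrite /polygon real_linear_sum // big1 // => j _.
have [H1 H2] := H (Ordinal (kn : (k < n.+1)%N)).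
have [jk|jk] := eqVneq (j : nat) k; first by rewrite jk H1 mulr0.
have [jk1|jk1] := eqVneq (j : nat) k.+1; first by rewrite jk1 H2 mulr0.
by rewrite Hk // mul0r.
Qed.

Lemma tent_continuous : continuous tent.
Proof.
move=> x; apply: pos_part_cvg; apply: cvgB; first exact: cvg_cst.
exact: norm_continuous.
Qed.

Lemma cvg_cRZ {T} {Fl : set_system T} {FF : Filter Fl} (a : T -> R) (v : T -> V) (a0 : R) (v0 : V) :
  a @ Fl --> a0 -> v @ Fl --> v0 -> (fun t => cR (a t) *: v t) @ Fl --> cR a0 *: v0.
Proof.
move=> ha hv; apply: cvgZ => //.
exact: (cvg_comp _ _ ha (@cR_continuous R K S a0)).
Qed.

Lemma cvg_ord_sum {T} {Fl : set_system T} {FF : Filter Fl} n (f : nat -> T -> V) (l : nat -> V) :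
  (forall k, f k @ Fl --> l k) -> (fun t => \sum_(k < n) f k t) @ Fl --> \sum_(k < n) l k.
Proof.
move=> H; elim: n => [|n IH].
  by rewrite big_ord0 (_ : (fun t => _) = fun=> 0); [exact: cvg_cst|apply/funext => t; rewrite big_ord0].
rewrite big_ord_recr (_ : (fun t => _) = fun t => \sum_(k < n) f k t + f n t); first exact: cvgD.
by apply/funext => t; rewrite big_ord_recr.
Qed.

Lemma polygon_continuous (c : R -> V) n : continuous (polygon c n).
Proof.
move=> s; rewrite /polygon.
apply: (@cvg_ord_sum _ (nbhs s) _ _ (fun k s => cR (tent (n.+1%:R * s - k%:R)) *: c (k%:R / n.+1%:R))
  (fun k => cR (tent (n.+1%:R * s - k%:R)) *: c (k%:R / n.+1%:R))) => k.
have h1 : (fun s : R => n.+1%:R * s - k%:R) @ nbhs s --> n.+1%:R * s - k%:R.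
  by apply: cvgB; [apply: cvgM; [exact: cvg_cst|exact: cvg_id]|exact: cvg_cst].
apply: cvg_cRZ; last exact: cvg_cst.
exact: (cvg_comp _ _ h1 (@tent_continuous _)).
Qed.

Lemma affine3 (a b : R) (x : V) : cR a *: x + cR (1 - a - b) *: x + cR b *: x = x.
Proof.
rewrite -!scalerDl -!cRD; have -> : a + (1 - a - b) + b = 1 by ring.
by rewrite cR1 scale1r.
Qed.

(* The loop c is joined to a nearby polygon Q bent by a generic vector u, and Q to the base point x: genericity keeps the segments from Q s to x away from 0. *)
Lemma loop_null (c : R -> V) x : {within I, continuous c} -> (forall s, s \in `[0, 1]%R -> c s != 0) ->
  c 0 = x -> c 1 = x ->
  exists H : R * R -> V, {within I `*` I, continuous H} /\
    forall s t, s \in `[0, 1]%R -> t \in `[0, 1]%R ->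
      [/\ H (s, t) != 0, H (s, 0) = c s, H (s, 1) = x, H (0, t) = x & H (1, t) = x].
Proof.
move=> cc c0 cx0 cx1.
have [mu mu0 Hmu] := rn_ge_min cc c0.
have m4 : 0 < mu / 4 by rewrite divr_gt0.
have [n Hn] := unif_cont cc m4.
have [u Hu] := generic_vector x (fun k : 'I_n.+1 => c (k%:R / n.+1%:R)) (fun k : 'I_n.+1 => c (k.+1%:R / n.+1%:R)).
have [l l_lin Hl] := fin_all_exists2 Hu.
(* The bend then has norm at most mu / 4, as has the distance from the polygon to c, so Q s - c s is
   shorter than c s. *)
pose eta := mu / 4 / (rn u + 1).
have u1 : 0 < rn u + 1 by rewrite ltr_wpDl ?rn_ge0.
have eta0 : 0 < eta by rewrite divr_gt0.
(* The factor s (1 - s) vanishes at both ends, so Q is again a loop at x. *)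
pose Q s := polygon c n s + cR (eta * (s * (1 - s))) *: u.
have Q0 : Q 0 = x by rewrite /Q polygon0 cx0 mul0r mulr0 cR0 scale0r addr0.
have Q1 : Q 1 = x by rewrite /Q polygon1 cx1 subrr !mulr0 cR0 scale0r addr0.
have Qc s : s \in `[0, 1]%R -> rn (Q s - c s) < mu.
  move=> Is; have h1 := polygon_close (ltW m4) Hn Is.
  move: Is; rewrite in_itv /= => /andP[s0 s1].
  rewrite /Q addrAC; apply: le_lt_trans (rnD _ _) _.
  have h2 : rn (cR (eta * (s * (1 - s))) *: u) <= mu / 4.
    have s10 : 0 <= 1 - s by rewrite subr_ge0.
    have e0 := ltW eta0.
    rewrite rnZ rn_cR ger0_norm; last exact: mulr_ge0 e0 (mulr_ge0 s0 s10).
    apply: (@le_trans _ _ (eta * (rn u + 1))); last by rewrite /eta divfK // gt_eqF.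
    apply: ler_pM; [exact: mulr_ge0 e0 (mulr_ge0 s0 s10)|exact: rn_ge0| |by rewrite lerDl].
    rewrite ler_piMr //; nra.
  lra.
(* The weights are (1 - 2 t, 2 t, 0) for t <= 1 / 2 and (0, 2 - 2 t, 2 t - 1) beyond: c moves to Q,
   then Q to x, in one continuous formula. *)
pose H (p : R * R) := cR (pos_part (1 - 2 * p.2)) *: c p.1 +
   cR (1 - pos_part (1 - 2 * p.2) - pos_part (2 * p.2 - 1)) *: Q p.1 + cR (pos_part (2 * p.2 - 1)) *: x.
exists H; split.
  apply/subspace_continuousP => -[s t] [/= Is It].
  have cfst : (@fst R R) @ within (I `*` I) (nbhs (s, t)) --> s by apply: cvg_within_filter; exact: cvg_fst.
  have csnd : (@snd R R) @ within (I `*` I) (nbhs (s, t)) --> t by apply: cvg_within_filter; exact: cvg_snd.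
  have c2 : (fun p : R * R => 2 * p.2) @ within (I `*` I) (nbhs (s, t)) --> 2 * t by apply: cvgM => //; exact: cvg_cst.
  have ca : (fun p : R * R => pos_part (1 - 2 * p.2)) @ within (I `*` I) (nbhs (s, t)) --> pos_part (1 - 2 * t).
    by apply: pos_part_cvg; apply: cvgB => //; exact: cvg_cst.
  have cb : (fun p : R * R => pos_part (2 * p.2 - 1)) @ within (I `*` I) (nbhs (s, t)) --> pos_part (2 * t - 1).
    by apply: pos_part_cvg; apply: cvgB => //; exact: cvg_cst.
  have cfst' : (@fst R R) @ within (I `*` I) (nbhs (s, t)) --> within I (nbhs s).
    move=> A /= hA; have := cfst _ hA; rewrite /= !nbhs_simpl /within /= => h.
    by apply: filterS h => p hp [h1 h2]; exact: (hp (conj h1 h2) h1).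
  apply: cvgD; last by apply: cvg_cRZ => //; exact: cvg_cst.
  apply: cvgD; apply: cvg_cRZ => //.
  - move/subspace_continuousP: cc => /(_ s Is); exact: cvg_comp.
  - by apply: cvgB => //; apply: cvgB => //; exact: cvg_cst.
  - have q2 : (fun s : R => s) @ s --> s by exact: cvg_id.
    have q1 : (fun s : R => 1 - s) @ s --> 1 - s by apply: cvgB; [exact: cvg_cst|exact: cvg_id].
    have q3 : (fun s : R => eta * (s * (1 - s))) @ s --> eta * (s * (1 - s)).
      exact: (cvgM (cvg_cst eta) (cvgM q2 q1)).
    have cQ : Q @ s --> Q s.
      exact: (cvgD (@polygon_continuous c n s) (@cvg_cRZ _ _ _ _ (fun=> u) _ _ q3 (cvg_cst _))).
    exact: (cvg_comp _ _ cfst cQ).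
move=> s t Is It.
have I0 : (0 : R) \in `[0, 1]%R by rewrite in_itv /= lexx ler01.
split.
- rewrite /H /=; have := It; rewrite in_itv /= => /andP[t0 t1].
  have [ht|ht] := leP t (1 / 2).
    rewrite (pos_part_le0E (a := 2 * t - 1)); last lra.
    rewrite pos_part_ge0E; last lra.
    rewrite cR0 scale0r addr0 subr0 !cRB cR1.
    (* A zero would give c s = - 2 t (Q s - c s), of norm less than mu. *)
    apply/negP => /eqP E.
    have E2 : c s = - (cR (2 * t) *: (Q s - c s)).
      move: (c s) (Q s) E => cs qs E.
      apply/eqP; rewrite -subr_eq0 opprK -[X in _ == X]E; apply/eqP/rowP => i.
      by rewrite !mxE; ring.
    have := Hmu s Is; rewrite E2 rnN rnZ rn_cR ger0_norm; last lra.
    apply/negP; rewrite -ltNge; apply: le_lt_trans (Qc s Is).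
    rewrite ler_piMl ?rn_ge0 //; lra.
  rewrite (pos_part_le0E (a := 1 - 2 * t)); last lra.
  rewrite (pos_part_ge0E (a := 2 * t - 1)); last lra.
  rewrite cR0 scale0r add0r subr0.
  have x0 : x != 0 by rewrite -cx0 c0.
  have [s0|s0] := eqVneq s 0; first by rewrite s0 Q0 -scalerDl -cRD subrK cR1 scale1r.
  have [s1|s1] := eqVneq s 1; first by rewrite s1 Q1 -scalerDl -cRD subrK cR1 scale1r.
  have [t1'|t1'] := eqVneq t 1.
    by rewrite t1' (_ : 1 - (2 * 1 - 1) = 0); [rewrite cR0 scale0r add0r (_ : 2 * 1 - 1 = 1) ?cR1 ?scale1r //; ring|ring].
  apply/negP => /eqP E.
  (* [l k] vanishes at x and on the edge through the point, so it sees only the bend, on which it is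
     nonzero. *)
  have [k Hk] := polygon_kill Is l_lin (fun k => let: And4 _ h2 h3 _ := Hl k in conj h2 h3).
  have [lx _ _ lu] := Hl k; have [lD lZ] := l_lin k.
  have := congr1 (l k) E; rewrite (real_linear0 (l_lin k)) lD !lZ lx mulr0 addr0 /Q lD lZ Hk add0r => /eqP.
  have tlt : t < 1 by rewrite lt_neqAle t1' t1.
  apply/negP; apply: mulf_neq0; first by apply: lt0r_neq0; lra.
  apply: mulf_neq0 => //; apply: mulf_neq0; first exact: lt0r_neq0.
  by apply: mulf_neq0 => //; rewrite subr_eq0 eq_sym.
- rewrite /H /= mulr0 subr0 sub0r pos_part_ge0E // (pos_part_le0E (a := -1)) ?lerN10 //.
  by rewrite cR1 !subr0 subrr cR0 !scale0r scale1r !addr0.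
- rewrite /H /= mulr1 (pos_part_le0E (a := 1 - 2)); last lra.
  rewrite (pos_part_ge0E (a := 2 - 1)); last lra.
  rewrite (_ : 1 - 0 - (2 - 1) = 0); last ring.
  by rewrite (_ : 2 - 1 = 1); [rewrite cR0 cR1 !scale0r !add0r scale1r|ring].
- by rewrite /H /= Q0 cx0 affine3.
- by rewrite /H /= Q1 cx1 affine3.
Qed.

(** The line from x to y is bent by t (1 - t) u; a form vanishing at x and y but not at u excludes
    zeros for t other than 0 and 1. *)
Lemma punctured_path (x y : V) : x != 0 -> y != 0 ->
  exists g : R -> V, [/\ continuous g, g 0 = x, g 1 = y & forall t, g t != 0].
Proof.
move=> x0 y0.
have [u Hu] := generic_vector x (fun k : 'I_1 => y) (fun k : 'I_1 => y).
have [l [lD lZ] [lx ly _ lu]] := Hu ord0.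
exists (fun t => cR (1 - t) *: x + cR t *: y + cR (t * (1 - t)) *: u); split.
- move=> t; have c1 : (fun t : R => 1 - t) @ t --> 1 - t by apply: cvgB; [exact: cvg_cst|exact: cvg_id].
  have c2 : (fun t : R => t) @ t --> t by exact: cvg_id.
  have c3 : (fun t : R => t * (1 - t)) @ t --> t * (1 - t) by exact: (cvgM c2 c1).
  apply: cvgD; [apply: cvgD|].
  + exact: (@cvg_cRZ _ _ _ _ (fun=> x) _ _ c1 (cvg_cst _)).
  + exact: (@cvg_cRZ _ _ _ _ (fun=> y) _ _ c2 (cvg_cst _)).
  + exact: (@cvg_cRZ _ _ _ _ (fun=> u) _ _ c3 (cvg_cst _)).
- by rewrite subr0 mul0r cR1 cR0 !scale0r scale1r !addr0.
- by rewrite subrr mulr0 cR1 cR0 !scale0r scale1r add0r addr0.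
- move=> t; apply/negP => /eqP E.
  have [t0|t0] := eqVneq t 0; first by move/eqP: E; rewrite t0 subr0 mul0r cR1 cR0 !scale0r scale1r !addr0 (negbTE x0).
  have [t1|t1] := eqVneq t 1; first by move/eqP: E; rewrite t1 subrr mulr0 cR1 cR0 !scale0r scale1r add0r addr0 (negbTE y0).
  have := congr1 l E; rewrite (real_linear0 (conj lD lZ)) !lD !lZ lx ly !mulr0 !add0r => /eqP.
  by rewrite !mulf_eq0 (negbTE lu) (negbTE t0) subr_eq0 (eq_sym 1) (negbTE t1).
Qed.

End PuncturedPlane.

(** * The link *)

Section Link.
Variables (R : realType) (K : numClosedFieldType) (S : real_structure R K).
Local Notation rn := (rn S).
Local Notation cR := (cR S).
Local Notation V := 'rV[K]_2.
Local Notation Y := (range (@F K)).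
Local Notation I := (`[(0 : R), (1 : R)]%classic).

Definition sqnorm4 (q : 'rV[K]_4) : R := rn (q 0 i0) ^+ 2 + rn (q 0 i1) ^+ 2 + rn (q 0 i2) ^+ 2 + rn (q 0 i3) ^+ 2.

Lemma sqnorm4_ge0 q : 0 <= sqnorm4 q.
Proof. by rewrite /sqnorm4 !addr_ge0 // exprn_ge0 // rn_ge0. Qed.

Lemma eucl_sqnorm4 (q : 'rV[K]_4) : eucl_dist q 0 = cR (Num.sqrt (sqnorm4 q)).
Proof.
rewrite /eucl_dist (_ : \sum_i _ = cR (Num.sqrt (sqnorm4 q)) ^+ 2).
  by rewrite sqrCK // -(cR0 S) cR_le sqrtr_ge0.
rewrite -cRX sqr_sqrtr ?sqnorm4_ge0 // /sqnorm4 !cRD !cRX -!rnE.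
rewrite !big_ord_recl big_ord0 addr0 !addrA.
by rewrite !mxE !subr0; congr (`|q 0 _| ^+ 2 + `|q 0 _| ^+ 2 + `|q 0 _| ^+ 2 + `|q 0 _| ^+ 2); apply: val_inj.
Qed.

Lemma eucl_eq q (e : R) : 0 < e -> eucl_dist q 0 = cR e <-> sqnorm4 q = e ^+ 2.
Proof.
move=> e0; rewrite eucl_sqnorm4; split=> [/(@cR_inj _ _ S) <-|->]; first by rewrite sqr_sqrtr ?sqnorm4_ge0.
by rewrite sqrtr_sqr gtr0_norm.
Qed.

Lemma eucl_le q (e : R) : 0 < e -> (eucl_dist q 0 <= cR e) = (sqnorm4 q <= e ^+ 2).
Proof.
move=> e0; rewrite eucl_sqnorm4 cR_le -[X in _ <= X](gtr0_norm e0) -sqrtr_sqr.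
by rewrite ler_sqrt // exprn_ge0 // ltW.
Qed.

Lemma sqnorm4_continuous : continuous sqnorm4.
Proof.
move=> q; have h i : (fun q : 'rV[K]_4 => rn (q 0 i) ^+ 2) @ q --> rn (q 0 i) ^+ 2.
  have h1 : (fun q : 'rV[K]_4 => rn (q 0 i)) @ q --> rn (q 0 i).
    exact: (cvg_comp _ _ (@coord_continuous K 1 4 0 i q) (@rn_continuous R K S K (q 0 i))).
  exact: (cvgM h1 h1).
exact: (cvgD (cvgD (cvgD (h i0) (h i1)) (h i2)) (h i3)).
Qed.

Definition rho (z : V) : R := sqnorm4 (F z).

Lemma rho_continuous : continuous rho.
Proof. move=> z; exact: (cvg_comp _ _ (@F_continuous R K S z) (@sqnorm4_continuous (F z))). Qed.

(* F is quasi-homogeneous of weights (2, 2, 5, 3) for the weights (2, 1) of (x, y). *)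
Definition scal (s : R) (z : V) : V := pt2 (cR s ^+ 2 * z 0 0) (cR s * z 0 1).

Lemma rho_scal s z : rho (scal s z) = s ^+ 4 * (rn (z 0 0) ^+ 2 + rn (z 0 1) ^+ 4)
  + s ^+ 10 * rn (z 0 0 * z 0 1 ^+ 3) ^+ 2 + s ^+ 6 * rn (z 0 0 * z 0 1 + z 0 1 ^+ 3) ^+ 2.
Proof.
rewrite /rho /sqnorm4 /scal F_pt2 !pt4s.
set x := z 0 0; set y := z 0 1.
have -> : cR s ^+ 2 * x * (cR s * y) ^+ 3 = cR s ^+ 5 * (x * y ^+ 3) by ring.
have -> : cR s ^+ 2 * x * (cR s * y) + (cR s * y) ^+ 3 = cR s ^+ 3 * (x * y + y ^+ 3) by ring.
have N k w : rn (cR s ^+ k * w) ^+ 2 = s ^+ (2 * k) * rn w ^+ 2.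
  by rewrite rnM rnX rn_cR exprMn -exprM mulnC exprM real_normK ?num_real // -exprM.
by rewrite !N exprMn N rnX -(exprM (rn y)); ring.
Qed.

Lemma scal1 z : scal 1 z = z.
Proof. by rewrite [RHS]pt2E /scal cR1 expr1n !mul1r. Qed.

(** All coefficients in [rho_scal] are nonnegative, and that of s^4, |x|^2 + |y|^4, is positive. *)
Lemma rho_gt z s t : z != 0 -> 0 <= s -> s < t -> rho (scal s z) < rho (scal t z).
Proof.
move=> z0 s0 st; rewrite !rho_scal.
have A0 : 0 < rn (z 0 0) ^+ 2 + rn (z 0 1) ^+ 4.
  have [h|h] := eqVneq (z 0 0) 0; last by rewrite ltr_pwDl ?exprn_gt0 ?rn_gt0 ?exprn_ge0 ?rn_ge0.
  rewrite ltr_wpDl ?exprn_ge0 ?rn_ge0 // exprn_gt0 // rn_gt0; apply: contraNneq z0 => h1.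
  by rewrite (pt2E z) h h1; apply/eqP/rowP => -[[|[|//]] hj]; rewrite !mxE.
have mono k : (0 < k)%N -> s ^+ k < t ^+ k by move=> k0; rewrite ltr_pXn2r // nnegrE // (le_trans s0) // ltW.
apply: ltr_leD; last by apply: ler_wpM2r; [rewrite exprn_ge0 ?rn_ge0|exact: ltW (mono 6%N isT)].
apply: ltr_leD; last by apply: ler_wpM2r; [rewrite exprn_ge0 ?rn_ge0|exact: ltW (mono 10%N isT)].
by rewrite ltr_pM2r // mono.
Qed.

Lemma scal_exists z (e : R) : z != 0 -> 0 < e -> exists2 s, 0 < s & rho (scal s z) = e.
Proof.
move=> z0 e0.
have r0 : rho (scal 0 z) = 0 by rewrite rho_scal !expr0n /= !mul0r !addr0.
have a0 : 0 < rho (scal 1 z) by rewrite -r0; apply: rho_gt.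
(* As T >= 1, every power of T in [rho_scal] is at least T, so the value at T is at least T rho(z)
   >= e. *)
pose T := 1 + e / rho (scal 1 z).
have T1 : 1 <= T by rewrite lerDl divr_ge0 ?ltW.
have big : e <= rho (scal T z).
  apply: (@le_trans _ _ (T * rho (scal 1 z))).
    by rewrite /T mulrDl mul1r divfK ?gt_eqF // lerDr ltW.
  have Tk k : T <= T ^+ k.+1 by rewrite exprS ler_peMr ?exprn_ege1 // (le_trans ler01).
  rewrite !rho_scal !expr1n !mul1r !mulrDr.
  apply: lerD; last by apply: ler_wpM2r; [rewrite exprn_ge0 ?rn_ge0|exact: Tk].
  apply: lerD; last by apply: ler_wpM2r; [rewrite exprn_ge0 ?rn_ge0|exact: Tk].
  by apply: lerD; apply: ler_wpM2r; rewrite ?exprn_ge0 ?rn_ge0 //; exact: Tk.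
have [|||c cI Ec] := @IVT R (fun s => rho (scal s z)) 0 T e.
- exact: le_trans ler01 T1.
- apply: continuous_subspaceT => s.
  have E : (fun s => rho (scal s z)) = fun s => s ^+ 4 * (rn (z 0 0) ^+ 2 + rn (z 0 1) ^+ 4)
    + s ^+ 10 * rn (z 0 0 * z 0 1 ^+ 3) ^+ 2 + s ^+ 6 * rn (z 0 0 * z 0 1 + z 0 1 ^+ 3) ^+ 2.
    by apply/funext => s'; rewrite rho_scal.
  have c k a : (fun s : R => s ^+ k * a) @ s --> s ^+ k * a.
    by apply: cvgM; [exact: exprn_continuous|exact: cvg_cst].
  by rewrite E; exact: (cvgD (cvgD (c 4%N _) (c 10%N _)) (c 6%N _)).
- by rewrite r0 ge_min le_max (ltW e0) big orbT.
exists c => //; move: cI; rewrite in_itv /= => /andP[c0 _].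
by rewrite lt_def c0 andbT; apply/eqP => h; move: Ec; rewrite h r0 => /esym/eqP; rewrite gt_eqF.
Qed.

(** The factor carrying z along its weighted ray to the level e of [rho], unique by [rho_gt]. For e
    > 0 the default 1 is the value at z = 0. *)
Definition tau (e : R) (z : V) : R := xget 1 [set s | 0 < s /\ rho (scal s z) = e].

Lemma tauP e z : z != 0 -> 0 < e -> 0 < tau e z /\ rho (scal (tau e z) z) = e.
Proof.
move=> z0 e0; have [s s0 sE] := scal_exists z0 e0.
exact: (@xgetPex _ 1 [set s | 0 < s /\ rho (scal s z) = e] (ex_intro _ s (conj s0 sE))).
Qed.

Lemma tau_bounds e z a b : z != 0 -> 0 < e -> 0 <= a -> 0 <= b -> rho (scal a z) < e -> e < rho (scal b z) -> a < tau e z < b.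
Proof.
move=> z0 e0 a0 b0 ha hb; have [t0 tE] := tauP z0 e0.
apply/andP; split.
  rewrite ltNge; apply/negP => h; move: ha; rewrite -tE ltNge => /negP; apply.
  by move: h; rewrite le_eqVlt => /orP[/eqP -> //|h]; apply/ltW/rho_gt => //; exact: ltW.
rewrite ltNge; apply/negP => h; move: hb; rewrite -tE ltNge => /negP; apply.
by move: h; rewrite le_eqVlt => /orP[/eqP -> //|h]; apply/ltW/rho_gt.
Qed.

Lemma tau1 e z : z != 0 -> 0 < e -> rho z = e -> tau e z = 1.
Proof.
move=> z0 e0 E; have [t0 tE] := tauP z0 e0.
have [h|h|//] := ltgtP (tau e z) 1.
  by have := rho_gt z0 (ltW t0) h; rewrite tE scal1 E ltxx.
by have := rho_gt z0 ler01 h; rewrite tE scal1 E ltxx.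
Qed.

Lemma cvg_pt2 {T} {Fl : set_system T} {FF : Filter Fl} (f g : T -> K) a b :
  f @ Fl --> a -> g @ Fl --> b -> (fun t => pt2 (f t) (g t)) @ Fl --> pt2 a b.
Proof.
move=> hf hg; apply: (cvg_row S) => -[[|[|//]] h].
  by rewrite mxE /= (_ : (fun t => _) = f) //; apply/funext => t; rewrite mxE.
by rewrite mxE /= (_ : (fun t => _) = g) //; apply/funext => t; rewrite mxE.
Qed.

Lemma cvg_scal {T} {Fl : set_system T} {FF : Filter Fl} (s : T -> R) (v : T -> V) (s0 : R) (v0 : V) :
  s @ Fl --> s0 -> v @ Fl --> v0 -> (fun t => scal (s t) (v t)) @ Fl --> scal s0 v0.
Proof.
move=> hs hv.
have cs : (fun t => cR (s t)) @ Fl --> cR s0 by exact: (cvg_comp _ _ hs (@cR_continuous R K S s0)).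
have cv i : (fun t => v t 0 i) @ Fl --> v0 0 i by exact: (cvg_comp _ _ hv (@coord_continuous K 1 2 0 i v0)).
by apply: cvg_pt2; [exact: (cvgM (cvgM cs cs) (cv 0))|exact: (cvgM cs (cv 1))].
Qed.

(** The strict inequalities at tau - d' and tau + d' persist at nearby points, where monotonicity
    along rays traps tau in between. *)
Lemma tau_continuous e z : z != 0 -> 0 < e -> {for z, continuous (tau e)}.
Proof.
move=> z0 e0; have [t0 tE] := tauP z0 e0.
apply: (@cvgrPdist_lt _ _ _ (nbhs z) _ _ _).2 => d d0.
(* d' < tau e z keeps tau e z - d' in the range s >= 0 of [rho_gt]. *)
pose d' := Num.min d (tau e z) / 2.
have m0 : 0 < Num.min d (tau e z) by rewrite lt_min d0.
have d'0 : 0 < d' by rewrite divr_gt0.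
have d'm : d' < Num.min d (tau e z) by rewrite ltr_pdivrMr // mulr_natr mulr2n ltrDl.
have [d'd d't] : d' < d /\ d' < tau e z by move: d'm; rewrite lt_min => /andP.
have a0 : 0 <= tau e z - d' by rewrite subr_ge0 ltW.
have b0 : 0 <= tau e z + d' by rewrite addr_ge0 // ltW.
have cs s : {for z, continuous (fun w => rho (scal s w))}.
  have h : (fun w => scal s w) @ z --> scal s z by exact: (@cvg_scal _ (nbhs z) _ (fun=> s) (fun w => w) s z (cvg_cst _) cvg_id).
  exact: (cvg_comp _ _ h (@rho_continuous (scal s z))).
have ha : rho (scal (tau e z - d') z) < e by rewrite -[ltRHS]tE; apply: rho_gt => //; rewrite ltrBlDr ltrDl.
have hb : e < rho (scal (tau e z + d') z) by rewrite -[ltLHS]tE; apply: rho_gt; rewrite ?ltrDl // ltW.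
have na : \forall w \near z, rho (scal (tau e z - d') w) < e by exact: (cvgr_lt _ (cs _) _ ha).
have nb : \forall w \near z, e < rho (scal (tau e z + d') w) by exact: (cvgr_gt _ (cs _) _ hb).
have n0 : \forall w \near z, w != 0.
  apply/(nearP_rn S); exists (rn z); first by rewrite rn_gt0.
  by move=> w; apply: contraTneq => ->; rewrite sub0r rnN ltxx.
near=> w.
have /andP[h1 h2] : tau e z - d' < tau e w < tau e z + d'.
  by apply: tau_bounds => //; near: w.
by rewrite distrC ltr_norml; apply/andP; split; lra.
Unshelve. all: by end_near. Qed.

Definition retr (e : R) (z : V) : V := scal (tau e z) z.

Lemma retr_continuous e z : z != 0 -> 0 < e -> {for z, continuous (retr e)}.
Proof.
move=> z0 e0.
exact: (@cvg_scal _ (nbhs z) _ (tau e) (fun w => w) (tau e z) z (tau_continuous z0 e0) cvg_id).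
Qed.

(** The second formula for y holds on both sides of x + u = 0, which yields the continuity of
    [F_inv] across that locus. *)
Lemma F_inv_axis (z : V) : z 0 0 != 0 -> z 0 1 != 0 ->
  pt2 (F z 0 i0) (F z 0 i2 / (F z 0 i0 * F z 0 i1)) = z.
Proof. by move=> x0 y0; rewrite [RHS]pt2E F_pt4 !pt4s; congr pt2; field; rewrite x0 y0. Qed.

Lemma cvg_near_eq (W : normedModType K) {T} {Fl : set_system T} {FF : Filter Fl} (f g : T -> W) (l : W) :
  (\forall t \near Fl, f t = g t) -> g @ Fl --> l -> f @ Fl --> l.
Proof.
move=> fg gl; apply/(cvg_rnP S) => e e0.
have : \forall t \near Fl, rn (g t - l) < e by exact: ((cvg_rnP S g l).1 gl e e0).
by apply: filterS2 fg => t -> .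
Qed.

(** Where x + u != 0 the first formula of [F_inv] is continuous. At the other points of Y except 0
    one has x u != 0, and the second formula represents [F_inv] on Y nearby, whichever branch is
    selected. *)
Lemma F_inv_cvg {T} {Fl : set_system T} {FF : Filter Fl} (f : T -> 'rV[K]_4) (q : 'rV[K]_4) :
  Y q -> q != 0 -> f @ Fl --> q -> (\forall t \near Fl, Y (f t)) -> (fun t => F_inv (f t)) @ Fl --> F_inv q.
Proof.
move=> Yq q0 fq Yf.
have c i : (fun t => f t 0 i) @ Fl --> q 0 i by exact: (cvg_comp _ _ fq (@coord_continuous K 1 4 0 i q)).
have nz (g : T -> K) (l : K) : g @ Fl --> l -> l != 0 -> \forall t \near Fl, g t != 0.
  move=> gl l0; have : \forall t \near Fl, rn (g t - l) < rn l.
    by apply: ((cvg_rnP S g l).1 gl); rewrite rn_gt0.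
  by apply: filterS => t; apply: contraTneq => ->; rewrite sub0r rnN ltxx.
have [h|h] := eqVneq (q 0 i0 + q 0 i1) 0; last first.
  have n1 : \forall t \near Fl, f t 0 i0 + f t 0 i1 != 0 by exact: (nz (fun t => f t 0 i0 + f t 0 i1) _ (cvgD (c i0) (c i1)) h).
  rewrite {2}/F_inv h.
  apply: (@cvg_near_eq _ _ _ _ _ (fun t => pt2 (f t 0 i0) (f t 0 i3 / (f t 0 i0 + f t 0 i1)))).
    by apply: filterS n1 => t ht; rewrite /F_inv ifT.
  by apply: cvg_pt2; [exact: c|apply: cvgM; [exact: c|apply: cvgV => //; exact: (cvgD (c i0) (c i1))]].
have [z _ zq] := Yq.
have u0 : q 0 i1 != 0.
  apply: contraNneq q0 => u0; move: h; rewrite u0 addr0 => x0.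
  move: x0 u0; rewrite -zq F_pt4 !pt4s => -> /eqP; rewrite sqrf_eq0 => /eqP ->.
  by apply/eqP/rowP => -[[|[|[|[|//]]]] hj]; rewrite !mxE /= ?expr0n ?mul0r ?addr0.
have x0 : q 0 i0 != 0 by apply: contraNneq u0 => x0; move: h; rewrite x0 add0r => ->.
have GG p : Y p -> p 0 i0 != 0 -> p 0 i1 != 0 -> F_inv p = pt2 (p 0 i0) (p 0 i2 / (p 0 i0 * p 0 i1)).
  move=> [w _ <-] hx hu; rewrite FK F_inv_axis //; first by move: hx; rewrite F_pt4 pt4s.
  by move: hu; rewrite F_pt4 pt4s sqrf_eq0.
rewrite (GG q Yq x0 u0).
apply: (@cvg_near_eq _ _ _ _ _ (fun t => pt2 (f t 0 i0) (f t 0 i2 / (f t 0 i0 * f t 0 i1)))).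
  have n1 : \forall t \near Fl, f t 0 i0 != 0 by exact: (nz _ _ (c i0) x0).
  have n2 : \forall t \near Fl, f t 0 i1 != 0 by exact: (nz _ _ (c i1) u0).
  by apply: filterS3 Yf n1 n2 => t h1 h2 h3; rewrite GG.
apply: cvg_pt2; first exact: c.
by apply: cvgM; [exact: c|apply: cvgV; [exact: mulf_neq0|exact: (cvgM (c i0) (c i1))]].
Qed.

(** [F_inv] lifts the link to the level e^2 of [rho]; [retr] followed by F brings paths and
    homotopies of C^2 minus 0 back and undoes the lift. *)
Lemma link_simply_connected (e : R) : 0 < e -> simply_connected R (link Y 0 (cR e)).
Proof.
move=> e0; have ee0 : 0 < e ^+ 2 by rewrite exprn_gt0.
have linkP q : link Y 0 (cR e) q <-> Y q /\ sqnorm4 q = e ^+ 2.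
  by rewrite -(eucl_eq q e0).
have nz q : link Y 0 (cR e) q -> q != 0.
  move=> /linkP[_ h]; apply: contra_eq_neq h => ->.
  by rewrite /sqnorm4 !mxE rn0 expr0n /= !addr0 eq_sym gt_eqF.
have Gnz q : link Y 0 (cR e) q -> [/\ F (F_inv q) = q, F_inv q != 0 & rho (F_inv q) = e ^+ 2].
  move=> Lq; have q0 := nz q Lq; move/linkP: Lq => [[z _ zq] h].
  rewrite -zq FK; split=> //; last by rewrite /rho zq.
  by apply: contraNneq q0 => z0; rewrite -zq z0 (F0 K).
have Lretr z : z != 0 -> link Y 0 (cR e) (F (retr (e ^+ 2) z)).
  by move=> z0; apply/linkP; split; [exists (retr (e ^+ 2) z)|have [_ ] := tauP z0 ee0].
have retr_id z : z != 0 -> rho z = e ^+ 2 -> retr (e ^+ 2) z = z.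
  by move=> z0 h; rewrite /retr tau1 // scal1.
have cFr z : z != 0 -> {for z, continuous (fun w => F (retr (e ^+ 2) w))}.
  by move=> z0; exact: (cvg_comp _ _ (retr_continuous z0 ee0) (@F_continuous R K S _)).
have one0 : (pt2 1 0 : V) != 0.
  by apply/eqP => /rowP/(_ 0); rewrite !mxE /= => /eqP; rewrite oner_eq0.
split; first split.
- by exists (F (retr (e ^+ 2) (pt2 1 0))); apply: Lretr.
- move=> p q Lp Lq; have [Fp p0 rp] := Gnz p Lp; have [Fq q0 rq] := Gnz q Lq.
  have [g [cg g0 g1 gnz]] := punctured_path S p0 q0.
  exists (fun t => F (retr (e ^+ 2) (g t))); split.
  + by apply: continuous_subspaceT => t; exact: (cvg_comp _ _ (cg t) (cFr _ (gnz t))).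
  + by rewrite g0 retr_id.
  + by rewrite g1 retr_id.
  + by move=> t _; apply: Lretr.
move=> x c [cc c0 c1 cL].
have cI (s : R) : I s -> s \in `[0, 1]%R by [].
have [||||H [Hc HH]] := @loop_null R K S (fun s => F_inv (c s)) (F_inv x).
- apply/subspace_continuousP => s Is; move/subspace_continuousP: cc => /(_ s Is) cs.
  have Ls := cL s (cI s Is).
  apply: (F_inv_cvg _ (nz _ Ls) cs); first by have /linkP[] := Ls.
  by apply: (@filterE _ (nbhs s) _ (fun t => I t -> Y (c t))) => t It; have /linkP[] := cL t (cI t It).
- by move=> s Is; have [] := Gnz _ (cL s Is).
- by rewrite c0.
- by rewrite c1.
have I0 : (0 : R) \in `[0, 1]%R by rewrite in_itv /= lexx ler01.
have I1 : (1 : R) \in `[0, 1]%R by rewrite in_itv /= lexx ler01.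
have Lx : link Y 0 (cR e) x by rewrite -c0; apply: cL.
have [Fx x0 rx] := Gnz x Lx.
exists (fun p => F (retr (e ^+ 2) (H p))); split.
  apply/subspace_continuousP => -[s t] [Is It]; move/subspace_continuousP: Hc => /(_ (s, t) (conj Is It)) cs.
  have [h _ _ _ _] := HH s t (cI s Is) (cI t It).
  exact: (cvg_comp _ _ cs (cFr _ h)).
move=> s t Is It; have [h1 h2 h3 h4 h5] := HH s t Is It; split.
- exact: Lretr.
- by have [Fc cs0 rc] := Gnz _ (cL s Is); rewrite h2 retr_id.
- by rewrite h3 retr_id.
- by rewrite h4 retr_id.
- by rewrite h5 retr_id.
Qed.

End Link.

(** * Tangent vectors of submanifolds *)

Section Tangents.
Variables (R : realType) (K : numClosedFieldType) (S : real_structure R K).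
Local Notation rn := (rn S).
Local Notation cR := (cR S).

(** Let w minimise |T w| on the ball. The Newton step w - T w at least halves |T w|, which
    contradicts minimality unless T w = 0; |T 0| <= p / 8 keeps both points in the ball. *)
Lemma approx_zero m (T : 'rV[K]_m -> 'rV[K]_m) (p : R) : 0 < p ->
  (forall w w', rn w <= p -> rn w' <= p -> rn (T w - T w' - (w - w')) <= 1 / 2 * rn (w - w')) ->
  rn (T 0) <= p / 8 -> exists2 w, rn w <= 2 * rn (T 0) & T w = 0.
Proof.
move=> p0 H T0.
pose A := [set w : 'rV[K]_m | rn w <= p].
have A0 : A 0 by rewrite /A /= rn0 ltW.
have lip w w' : A w -> A w' -> rn (T w - T w') <= 3 / 2 * rn (w - w').
  move=> hw hw'; rewrite -[T w - T w'](subrK (w - w')); apply: le_trans (rnD _ _) _.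
  by have := H w w' hw hw'; lra.
have cA : {within A, continuous (fun w => rn (T w))}.
  apply/subspace_continuousP => w Aw.
  suff cT : T @ within A (nbhs w) --> T w by exact: (cvg_comp _ _ cT (@rn_continuous R K S _ (T w))).
  apply/(cvg_rnP S) => e e0.
  suff : \forall w' \near w, A w' -> rn (T w' - T w) < e by [].
  apply/(nearP_rn S); exists (e / 2); first by rewrite divr_gt0.
  move=> w' hw' Aw'; apply: le_lt_trans (lip _ _ Aw' Aw) _; lra.
have [|w /set_mem Aw Hw] := compact_EVT_min _ (@rvball_compact R K S m p) cA; first by exists 0.
have wT0 : rn (T w) <= rn (T 0) by apply: Hw; rewrite inE.
(* With |T w| <= |T 0| this gives |w| <= 4 |T 0|, and |w| <= 2 |T 0| once T w = 0. *)
have E1 : rn w <= rn (T w) + rn (T 0) + 1 / 2 * rn w.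
  have := H w 0 Aw A0; rewrite !subr0 => h.
  rewrite {1}(_ : rn w = rn (T w - T 0 - (T w - T 0 - w))); last by rewrite subKr.
  apply: le_trans (rnB _ _) _; apply: lerD h; exact: rnB.
have [h|h] := eqVneq (T w) 0.
  by exists w => //; move: E1; rewrite h rn0; lra.
have w1A : A (w - T w) by apply: le_trans (rnB _ _) _; lra.
have := H (w - T w) w w1A Aw.
rewrite (_ : w - T w - w = - T w); last by rewrite addrAC subrr add0r.
rewrite opprK subrK rnN => h1.
have h2 : rn (T w) <= rn (T (w - T w)) by apply: Hw; rewrite inE.
have : 0 < rn (T w) by rewrite rn_gt0.
lra.
Qed.

(* Lyusternik's theorem: q + t v is corrected along a right inverse of the differential. *)
Lemma submersion_tangent n m (f : 'rV[K]_n -> 'rV[K]_m) q v : holomorphic_map_at f q -> f q = 0 ->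
  \rank ('J f q) = m -> v *m 'J f q = 0 -> forall eta : R, 0 < eta ->
  exists2 dl : R, 0 < dl & forall t, 0 < t -> t <= dl ->
    exists2 a, f a = 0 & rn (a - q - cR t *: v) <= eta * t.
Proof.
move=> hf fq rk vJ eta eta0.
have [M [r [r0 M0 H]]] := holo_map_strict S hf.
have /row_fullP[Sm HSm] : row_full ('J f q) by rewrite /row_full rk.
have [B B0 HB] := rn_mulmx S Sm.
set nv := rn v + 1; have nv1 : 1 <= nv by rewrite lerDr rn_ge0.
have nv0 : 0 < nv by apply: lt_le_trans nv1.
set Q := nv + B; have Q0 : 0 < Q by rewrite addr_gt0.
(* k is a lower bound for 1 / t. After the 1, which makes it positive, its summands ensure |T 0| <=
   t / 8, a correction of norm at most eta t, and the factor 1 / 2 in [TH]. *)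
pose k := 1 + 8 * M * nv ^+ 2 + 2 * B * M * nv ^+ 2 / eta + 2 * M * Q * B.
have k1 : [/\ 1 <= k, 8 * M * nv ^+ 2 <= k, 2 * B * M * nv ^+ 2 / eta <= k & 2 * M * Q * B <= k].
  have h1 : 0 <= 8 * M * nv ^+ 2 by rewrite !mulr_ge0 // ltW.
  have h2 : 0 <= 2 * B * M * nv ^+ 2 / eta by rewrite divr_ge0 ?(ltW eta0) // !mulr_ge0 ?(ltW B0) // ltW.
  have h3 : 0 <= 2 * M * Q * B by rewrite !mulr_ge0 // ltW.
  by rewrite /k; split; lra.
have {}k1 : [/\ 0 < k, 8 * M * nv ^+ 2 <= k, 2 * B * M * nv ^+ 2 / eta <= k & 2 * M * Q * B <= k].
  by case: k1 => h1 ? ? ?; split=> //; apply: lt_le_trans h1.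
clearbody k; case: k1 => k0 k2 k3 k4.
exists (Num.min (r / Q) k^-1); first by rewrite lt_min divr_gt0 // invr_gt0.
move=> t t0; rewrite le_min ler_pdivlMr // => /andP[tr tk].
have tk' : t * k <= 1 by rewrite -ler_pdivlMr // mul1r.
have tnv : rn (cR t *: v) <= t * nv by rewrite rnZ rn_cR gtr0_norm // ler_wpM2l ?(ltW t0) // lerDl.
(* The correction w is measured in the target: [Sm *m 'J f q = 1] makes T close to the identity, and
   as v is in the kernel, T 0 is quadratic in t. *)
pose T w := f (q + cR t *: v + w *m Sm).
have T0 : rn (T 0) <= M * (t * nv) * (t * nv).
  have := H (t * nv) (q + cR t *: v) q; rewrite mulr_gt0 // addrAC subrr add0r rn0.
  have -> : t * nv <= r by apply: le_trans tr; rewrite ler_wpM2l ?(ltW t0) // lerDl ltW.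
  rewrite fq subr0 -scalemxAl vJ scaler0 subr0 /T mul0mx addr0.
  move=> /(_ isT isT tnv (mulr_ge0 (ltW t0) (ltW nv0))) h; apply: le_trans h _.
  by apply: ler_wpM2l; rewrite // !mulr_ge0 // ltW.
have TH w w' : rn w <= t -> rn w' <= t -> rn (T w - T w' - (w - w')) <= 1 / 2 * rn (w - w').
  move=> hw hw'.
  have bnd u : rn u <= t -> rn (q + cR t *: v + u *m Sm - q) <= t * Q.
    move=> hu; rewrite addrAC (addrAC q) subrr add0r; apply: le_trans (rnD _ _) _.
    rewrite mulrDr; apply: lerD => //; apply: le_trans (HB _) _.
    by rewrite mulrC ler_wpM2r // ltW.
  have := H (t * Q) (q + cR t *: v + w *m Sm) (q + cR t *: v + w' *m Sm) (mulr_gt0 t0 Q0) tr (bnd _ hw) (bnd _ hw').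
  have -> : q + cR t *: v + w *m Sm - (q + cR t *: v + w' *m Sm) = (w - w') *m Sm.
    by rewrite mulmxBl opprD addrACA subrr add0r.
  rewrite -mulmxA HSm mulmx1 => h; apply: le_trans h _.
  apply: (@le_trans _ _ (M * (t * Q) * (B * rn (w - w')))).
    by apply: ler_wpM2l (HB _); rewrite !mulr_ge0 // ltW.
  rewrite mulrA; apply: ler_wpM2r; first exact: rn_ge0.
  have : t * (2 * M * Q * B) <= 1 by apply: le_trans tk'; rewrite ler_wpM2l // ltW.
  have -> : t * (2 * M * Q * B) = 2 * (M * (t * Q) * B) by ring.
  lra.
have T08 : rn (T 0) <= t / 8.
  apply: le_trans T0 _.
  have : t * (t * (8 * M * nv ^+ 2)) <= t * 1.
    by rewrite ler_wpM2l ?(ltW t0) //; apply: le_trans tk'; rewrite ler_wpM2l // ltW.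
  have -> : t * (t * (8 * M * nv ^+ 2)) = 8 * (M * (t * nv) * (t * nv)) by ring.
  lra.
have [w hw Tw] := approx_zero t0 TH T08.
exists (q + cR t *: v + w *m Sm) => //.
rewrite (_ : _ - q - _ = w *m Sm); last by rewrite -addrA addrC -opprD addrA addNr add0r.
apply: le_trans (HB _) _.
apply: (@le_trans _ _ (B * (2 * (M * (t * nv) * (t * nv))))).
  by rewrite ler_wpM2l ?(ltW B0) //; apply: le_trans hw _; rewrite ler_wpM2l.
have : t * (t * (2 * B * M * nv ^+ 2 / eta)) <= t * 1.
  by rewrite ler_wpM2l ?(ltW t0) //; apply: le_trans tk'; rewrite ler_wpM2l // ltW.
have -> : t * (t * (2 * B * M * nv ^+ 2 / eta)) = (B * (2 * (M * (t * nv) * (t * nv)))) / eta by ring.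
by rewrite ler_pdivrMr // mulr1 [eta * t]mulrC.
Qed.

(** A kernel vector of the equations of A is a limit of secants of A through q, by
    [submersion_tangent], so [secant_kernel] applies to any h vanishing on A. *)
Lemma tangent_kills n k d (A : set 'rV[K]_n) q (f : 'rV[K]_n -> 'rV[K]_(n - d)) (v : 'rV[K]_n) (h : 'rV[K]_n -> 'rV[K]_k) :
  submersive_equations A q f -> v *m 'J f q = 0 -> holomorphic_map_at h q ->
  (\forall z \near q, A z -> h z = 0) -> v *m 'J h q = 0.
Proof.
move=> [_ Aq hf rk /(nearP_rn S)[e e0 He]] vJ hh Ah.
have fq : f q = 0 by apply/He => //; rewrite subrr rn0.
apply: (@secant_kernel R K S _ _ h A q v (rn v + 1) 1 hh Ah ltr01) => t t0 t1.
(* The relative error eta is t itself, in accordance with the bound that [secant_kernel]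
   requires. *)
have [dl dl0 Hd] := submersion_tangent hf fq rk vJ t0.
have v1 : 0 < rn v + 1 by rewrite ltr_wpDl ?rn_ge0.
pose u := Num.min dl (Num.min t (e / 2 / (rn v + 1))).
have u0 : 0 < u by rewrite !lt_min dl0 t0 !divr_gt0.
have [ud ut ue] : [/\ u <= dl, u <= t & u * (rn v + 1) <= e / 2].
  by rewrite -ler_pdivlMr // /u !ge_min !lexx /= !orbT.
have [a fa ha] := Hd u u0 ud.
have ua : rn (a - q) <= u * (rn v + 1).
  rewrite -[a - q](subrK (cR u *: v)); apply: le_trans (rnD _ _) _.
  rewrite rnZ rn_cR gtr0_norm //.
  have : t * u <= u by rewrite ler_piMl // ltW.
  rewrite mulrDr mulr1; lra.
have Aa : A a.
  by apply/He => //; apply: le_lt_trans ua _; apply: le_lt_trans ue _; rewrite ltr_pdivrMr // mulr_natr mulr2n ltrDl.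
exists a, q, (cR u); split=> //.
- by rewrite (cR_eq0 S) gt_eqF.
- split; last by rewrite subrr rn0 mulr_ge0 // ltW.
  by apply: le_trans ua _; rewrite mulrC ler_wpM2l // ltW.
- apply: le_trans ha _; rewrite rn_cR gtr0_norm //; apply: ler_wpM2r; first exact: ltW.
  by rewrite ler_peMl ?(ltW t0) // lerDr rn_ge0.
Qed.

(** That is, v = v_x F_x + v_u / (2 y) F_y, where F_x = (1, 0, y^3, y) and F_y = (0, 2 y, 3 x y^2, x
    + 3 y^2): the kernel lies in the image of the differential of F. *)
Lemma tangent_F (x y : K) v : y != 0 -> x + y ^+ 2 != 0 ->
  d1 (F (pt2 x y)) v = 0 -> d2 (F (pt2 x y)) v = 0 ->
  v 0 i2 = v 0 i0 * y ^+ 3 + v 0 i1 / (2 * y) * (3 * x * y ^+ 2) /\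
  v 0 i3 = v 0 i0 * y + v 0 i1 / (2 * y) * (x + 3 * y ^+ 2).
Proof.
move=> y0 xy; rewrite F_pt2 /d1 /d2 !pt4s.
set a := v 0 i0; set b := v 0 i1; set c := v 0 i2; set d := v 0 i3 => e1 e2.
have n2 : (2 : K) != 0 by rewrite pnatr_eq0.
have D : d = a * y + b / (2 * y) * (x + 3 * y ^+ 2).
  apply: (mulfI (mulf_neq0 (mulf_neq0 n2 y0) xy)).
  apply/eqP; rewrite -subr_eq0 -[X in _ == X]e1; apply/eqP.
  by field; rewrite y0.
split=> //; apply: (mulfI xy); apply/eqP; rewrite -subr_eq0 -[X in _ == X]e2 D; apply/eqP.
by field; rewrite y0.
Qed.

(** In dimension 0 the Jacobian of the equations is injective, so a zero z within s of q satisfies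
    |z - q| <= D M s |z - q| with D M s <= 1 / 2. *)
Lemma discrete_stratum (A : set 'rV[K]_4) q : smooth_at 0 A q ->
  exists2 r, 0 < r & forall z, A z -> rn (z - q) <= r -> z = q.
Proof.
move=> [f [_ Aq hf rk /(nearP_rn S)[e e0 He]]].
have [M [r [r0 M0 H]]] := holo_map_strict S hf.
have /row_freeP[B HB] : row_free ('J f q) by rewrite /row_free rk.
have [D D0 HD] := rn_mulmx S B.
have fq : f q = 0 by apply/He => //; rewrite subrr rn0.
pose s := Num.min (e / 2) (Num.min r (2 * D * (M + 1))^-1).
have D1 : 0 < 2 * D * (M + 1) by rewrite !mulr_gt0 // ltr_wpDl.
have s0 : 0 < s by rewrite !lt_min r0 divr_gt0 // invr_gt0.
exists s => // z Az zs.
have [se sr sD] : [/\ s <= e / 2, s <= r & s * (2 * D * (M + 1)) <= 1].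
  by rewrite -ler_pdivlMr // mul1r /s !ge_min !lexx /= !orbT.
have fz : f z = 0.
  by apply/He => //; apply: le_lt_trans (le_trans zs se) _; rewrite ltr_pdivrMr // mulr_natr mulr2n ltrDl.
have := H s z q s0 sr zs; rewrite subrr rn0 fz fq subrr sub0r rnN => /(_ (ltW s0)) h.
apply/eqP; rewrite -subr_eq0 -(rn_eq0 S); apply/eqP.
have h2 : rn (z - q) <= D * (M * s * rn (z - q)).
  rewrite -{1}[z - q]mulmx1 -HB mulmxA; apply: le_trans (HD _) _; by rewrite ler_wpM2l // ltW.
apply/eqP; rewrite eq_le rn_ge0 andbT leNgt; apply/negP => p0; move: h2; apply/negP; rewrite -ltNge.
rewrite !mulrA gtr_pMl //.
have -> : D * M * s = s * (2 * D * M) / 2 by field.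
have : s * (2 * D * M) <= s * (2 * D * (M + 1)).
  by rewrite ler_wpM2l ?(ltW s0) // ler_wpM2l ?lerDl // mulr_ge0 // ltW.
lra.
Qed.

(** The points of P D are isolated but may accumulate outside P D; the interval is therefore shrunk
    once for each D. *)
Lemma interval_avoids (T : eqType) (P : T -> R -> Prop) (s : seq T) :
  (forall D, D \in s -> forall x, P D x -> exists2 r, 0 < r & forall y, P D y -> `|y - x| < r -> y = x) ->
  forall a b : R, a < b -> exists a' b', [/\ a <= a', a' < b', b' <= b &
    forall D, D \in s -> forall x, a' < x < b' -> ~ P D x].
Proof.
elim: s => [|D s IH] H a b ab; first by exists a, b; split.
have [a1 [b1 [h1 h2 h3 h4]]] : exists a' b', [/\ a <= a', a' < b', b' <= b & forall x, a' < x < b' -> ~ P D x].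
  have [[x [/andP[ax xb] Px]]|no] := pselect (exists x, a < x < b /\ P D x); last first.
    by exists a, b; split=> // x hx Px; apply: no; exists x.
  have [r r0 Hr] := H D (mem_head _ _) x Px.
  (* The new interval starts at a point x of P D, within r of which there is no other. *)
  exists x, (Num.min b (x + r)); split; rewrite ?(ltW ax) ?lt_min ?xb ?ltrDl ?ge_min ?lexx //.
  move=> y; rewrite lt_min => /and3P[xy yb yr] Py; have := Hr y Py.
  rewrite gtr0_norm ?subr_gt0 // ltrBlDl => /(_ yr) E; by rewrite E ltxx in xy.
have IHs D' (hD : D' \in s) : forall x, P D' x -> exists2 r, 0 < r & forall y, P D' y -> `|y - x| < r -> y = x.
  by apply: H; rewrite inE hD orbT.
have [a2 [b2 [k1 k2 k3 k4]]] := IH IHs a1 b1 h2.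
exists a2, b2; split=> //; [exact: le_trans k1|exact: le_trans h3|].
move=> D'; rewrite inE => /predU1P[->|hD'] x /andP[x1 x2]; last by apply: k4 => //; rewrite x1.
by apply: h4; rewrite (le_lt_trans k1) // (lt_le_trans x2).
Qed.

End Tangents.

(** * Limits of tangent spaces and general functions *)

Section GeneralFunctions.
Variables (R : realType) (K : numClosedFieldType) (S : real_structure R K).
Local Notation rn := (rn S).
Local Notation cR := (cR S).
Local Notation Y := (range (@F K)).

Lemma common_bound (T : eqType) (s : seq T) (P : T -> R -> Prop) :
  (forall A, A \in s -> exists2 e, 0 < e & P A e) ->
  (forall A e e', P A e -> 0 < e' -> e' <= e -> P A e') ->
  exists2 e, 0 < e & forall A, A \in s -> P A e.
Proof.
move=> + mono; elim: s => [|A s IH] H; first by exists 1.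
have [|e e0 He] := IH; first by move=> B hB; apply: H; rewrite inE hB orbT.
have [e1 e10 He1] := H A (mem_head _ _).
have m0 : 0 < Num.min e e1 by rewrite lt_min e0.
exists (Num.min e e1) => // B; rewrite inE => /predU1P[->|hB].
  by apply: mono He1 m0 _; rewrite ge_min lexx orbT.
by apply: mono (He B hB) m0 _; rewrite ge_min lexx.
Qed.

(* Finitely many strata meet a neighbourhood of 0, and the zero-dimensional ones are discrete. *)
Lemma positive_stratum (SS : set (set 'rV[K]_4)) (gam : R -> 'rV[K]_4) (t0 : R) :
  whitney_stratification Y SS -> (forall t, Y (gam t)) -> 0 < t0 ->
  (forall x y, 0 < x < t0 -> 0 < y < t0 -> gam x = gam y -> x = y) -> continuous gam -> gam 0 = 0 ->
  exists A d, [/\ SS A, (0 < d)%N, forall q, A q -> smooth_at d A q &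
    forall e : R, 0 < e -> exists2 t, 0 < t < e & A (gam t)].
Proof.
move=> WS Yg t00 gi gc g0.
have [U nU] := strata_locally_finite WS 0; move=> /finite_seqP[s Es].
have [e1 e10 He1] : exists2 e : R, 0 < e & forall t, 0 < t < e -> U (gam t).
  have : \forall t \near (0 : R), U (gam t) by apply: gc; rewrite g0.
  move=> /nbhs_ballP[e /= e0 He]; exists e => // t /andP[tp te]; apply: He.
  by rewrite /ball /= sub0r normrN gtr0_norm.
apply: contrapT => no.
have inS A : A \in s -> SS A.
  by move=> As; have : [set` s] A by []; rewrite -Es => -[].
(* If no stratum qualifies, each one in s has dimension 0 or misses an initial piece of the arc. *)
have [e e0 He] : exists2 e : R, 0 < e & forall A, A \in s ->
   (forall q, A q -> smooth_at 0 A q) \/ (forall t, 0 < t < e -> ~ A (gam t)).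
  apply: (@common_bound _ s (fun A e => (forall q, A q -> smooth_at 0 A q) \/ (forall t, 0 < t < e -> ~ A (gam t)))).
    move=> A /inS SA; have [_ [[|d] hd]] := strata_smooth WS SA; first by exists 1 => //; left.
    apply: contrapT => H; apply: no; exists A, d.+1; split=> // e e0.
    apply: contrapT => H2; apply: H; exists e => //; right => t ht At; apply: H2; by exists t.
  move=> A e e' [h|h] e'0 ee; [by left|right => t /andP[t1 t2]].
  by apply: h; rewrite t1 (lt_le_trans t2).
pose P (A : set 'rV[K]_4) (t : R) := [/\ forall q, A q -> smooth_at 0 A q, 0 < t < t0 & A (gam t)].
have m0 : 0 < Num.min e (Num.min e1 t0) by rewrite !lt_min e0 e10.
(* Injectivity of [gam] turns the discreteness of a stratum into the isolation of its parameters. *)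
have disc A : A \in s -> forall x, P A x -> exists2 r, 0 < r & forall y, P A y -> `|y - x| < r -> y = x.
  move=> As x [h hx Ax]; have [r r0 Hr] := discrete_stratum S (h _ Ax).
  have : \forall y \near x, rn (gam y - gam x) < r by exact: ((cvg_rnP S gam (gam x)).1 (gc x) r r0).
  move=> /nbhs_ballP[dl /= dl0 Hdl]; exists dl => // y [_ hy Ay] yx.
  by apply: gi => //; apply: Hr => //; apply: ltW; apply: Hdl; rewrite /ball /= distrC.
have [a [b [a0 ab bm Hab]]] := interval_avoids disc m0.
(* This parameter lies on a stratum of s, against both alternatives of [He]. *)
pose t := (a + b) / 2.
have tI : a < t < b by rewrite /t; apply/andP; split; lra.
have [t1 t2] : 0 < t /\ t < Num.min e (Num.min e1 t0) by move: tI => /andP[h1 h2]; split; lra.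
have [te te1 tt0] : [/\ t < e, t < e1 & t < t0] by move: t2; rewrite !lt_min => /and3P.
have [A SA At] : (\bigcup_(A in SS) A) (gam t) by rewrite (strata_cover WS).
have As : A \in s.
  suff : [set` s] A by [].
  by rewrite -Es; split=> //; exists (gam t); split=> //; apply: He1; rewrite t1.
case: (He A As) => [h|h]; first by apply: (Hab A As t tI); split=> //; rewrite t1.
by apply: (h t _ At); rewrite t1.
Qed.

Lemma kernel_basis N d (J : 'M[K]_(N, N - d)) : (d <= N)%N -> \rank J = (N - d)%N ->
  exists2 T : 'M[K]_(d, N), row_free T & T *m J = 0.
Proof.
move=> dN rk; have : \rank (kermx J) = d by rewrite mxrank_ker rk subKn.
move=> E; suff [T h1 h2] : exists2 T : 'M[K]_(\rank (kermx J), N), row_free T & T *m J = 0.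
  by move: T h1 h2; rewrite E => T h1 h2; exists T.
exists (row_base (kermx J)); first exact: row_base_free.
by apply/sub_kermxP; rewrite eq_row_base.
Qed.

Lemma cvg_mx {T} {Fl : set_system T} {FF : Filter Fl} m n (f : T -> 'M[K]_(m, n)) (l : 'M[K]_(m, n)) :
  (forall i j, (fun t => f t i j) @ Fl --> l i j) -> f @ Fl --> l.
Proof.
move=> H A [P HP PA]; have : \forall t \near Fl, forall i j, P i j (f t i j).
  apply: filter_forall => i; apply: filter_forall => j; exact: (H i j _ (HP i j)).
by apply: filterS => t Ht; apply: PA.
Qed.

Lemma mul_row2 n (c : 'rV[K]_2) (u v : 'rV[K]_n) :
  c *m (\matrix_(i < 2) (if i == 0 then u else v)) = c 0 0 *: u + c 0 1 *: v.
Proof.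
apply/rowP => j; rewrite !mxE !big_ord_recl big_ord0 addr0 !mxE /=.
by congr (_ * _ + _ * _); congr (c 0 _); apply: val_inj.
Qed.

Lemma mx1_row_free n (v : 'rV[K]_n) : row_free v = (v != 0).
Proof. by rewrite /row_free rank_rV; case: (v != 0). Qed.

(** * An arc in Y with a prescribed limit of tangent planes *)

Section LimitPlane.
Variables s t : K.
Hypothesis st0 : (s != 0) || (t != 0).
(** The summand [cR x] keeps [sg x] nonzero for small x > 0 even when s = 0, without changing the
    limit s / 2. *)
Let sg (x : R) := s / 2 + cR x.
Let px (x : R) := cR x * t.
Let py (x : R) := cR x * sg x.
(* An arc in Y ending at 0 along which the tangent plane tends to the span of e1 and (0, s, 0, t). *)
Definition arc (x : R) : 'rV[K]_4 := F (pt2 (px x) (py x)).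
Let row1 (x : R) := pt4 1 0 (py x ^+ 3) (py x).
Let row2' (x : R) := pt4 0 (2 * sg x) (3 * t * cR x ^+ 2 * sg x ^+ 2) (t + 3 * cR x * sg x ^+ 2).
(** The rows are the partial derivatives of F at (px, py), the second divided by x so that it tends
    to (0, s, 0, t). *)
Definition frame (x : R) : 'M[K]_(2, 4) := \matrix_(i < 2) (if i == 0 then row1 x else row2' x).

Lemma frame0 : frame 0 = \matrix_(i < 2) (if i == 0 then pt4 1 0 0 0 else pt4 0 s 0 t).
Proof.
apply/row_matrixP => i; rewrite !rowK; case: ifP => _.
  by rewrite /row1 /py cR0 !mul0r expr0n.
by rewrite /row2' /sg cR0 addr0 expr0n /= !mulr0 !mul0r addr0; congr (pt4 0 _ 0 _); field.
Qed.

Lemma frame0_free : row_free (frame 0).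
Proof.
rewrite frame0; apply: inj_row_free => c; rewrite mul_row2 => /rowP H.
have c0 : c 0 0 = 0 by have := H i0; rewrite !mxE /= !mulr0 mulr1 addr0.
have c1 : c 0 1 = 0.
  have h1 : c 0 1 * s = 0 by have := H i1; rewrite !mxE /= !mulr0 add0r.
  have h2 : c 0 1 * t = 0 by have := H i3; rewrite !mxE /= !mulr0 add0r.
  apply/eqP; case/orP: st0 => z0; [move/eqP: h1|move/eqP: h2]; by rewrite mulf_eq0 (negbTE z0) orbF.
by rewrite (pt2E c) c0 c1; apply/rowP => -[[|[|//]] h]; rewrite !mxE.
Qed.

Lemma arc0 : arc 0 = 0.
Proof.
rewrite /arc /px /py cR0 !mul0r (_ : pt2 0 0 = 0) ?F0 //.
by apply/rowP => -[[|[|//]] h]; rewrite !mxE.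
Qed.

Let cid : forall x : R, (fun x : R => cR x) @ x --> cR x.
Proof. by move=> x; exact: cR_continuous. Qed.
Let ck (k : K) : forall x : R, (fun _ : R => k) @ x --> k.
Proof. by move=> x; exact: cvg_cst. Qed.
Let csg x : sg @ x --> sg x.
Proof. exact: (cvgD (@ck (s / 2) _) (@cid x)). Qed.
Let cpy x : py @ x --> py x.
Proof. exact: (cvgM (@cid x) (@csg x)). Qed.

Lemma arc_continuous : continuous arc.
Proof.
move=> x; have h : (fun x => pt2 (px x) (py x)) @ x --> pt2 (px x) (py x).
  by apply: (cvg_pt2 S); [exact: (cvgM (@cid x) (@ck t _))|exact: cpy].
exact: (cvg_comp _ _ h (@F_continuous R K S _)).
Qed.

Lemma frame_continuous x : frame @ x --> frame x.
Proof.
have c2 : (fun x : R => cR x ^+ 2) @ x --> cR x ^+ 2 by exact: (cvgM (@cid x) (@cid x)).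
have s2 : (fun x : R => sg x ^+ 2) @ x --> sg x ^+ 2 by exact: (cvgM (@csg x) (@csg x)).
have p3 : (fun x : R => py x ^+ 3) @ x --> py x ^+ 3 by exact: (cvgM (@cpy x) (cvgM (@cpy x) (@cpy x))).
have e1 : (fun x : R => 2 * sg x) @ x --> 2 * sg x by exact: (cvgM (@ck 2 _) (@csg x)).
have e2 : (fun x : R => 3 * t * cR x ^+ 2 * sg x ^+ 2) @ x --> 3 * t * cR x ^+ 2 * sg x ^+ 2.
  exact: (cvgM (cvgM (@ck (3 * t) _) c2) s2).
have e3 : (fun x : R => t + 3 * cR x * sg x ^+ 2) @ x --> t + 3 * cR x * sg x ^+ 2.
  exact: (cvgD (@ck t _) (cvgM (cvgM (@ck 3 _) (@cid x)) s2)).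
apply: (@cvg_mx _ (nbhs x)) => i j; rewrite !mxE.
case: ifP => h.
  rewrite (_ : (fun t => _) = fun x => row1 x 0 j); last by apply/funext => y; rewrite mxE h.
  rewrite (_ : (fun t => _) = fun x => [:: 1; 0; py x ^+ 3; py x]`_j); last by apply/funext => y; rewrite mxE.
  rewrite mxE; case: j => [[|[|[|[|//]]]] hj] /=; by [exact: cvg_cst|exact: p3|exact: cpy].
rewrite (_ : (fun t => _) = fun x => row2' x 0 j); last by apply/funext => y; rewrite mxE h.
rewrite (_ : (fun t => _) = fun x => [:: 0; 2 * sg x; 3 * t * cR x ^+ 2 * sg x ^+ 2; t + 3 * cR x * sg x ^+ 2]`_j); last by apply/funext => y; rewrite mxE.
by rewrite mxE; case: j => [[|[|[|[|//]]]] hj] /=; [exact: cvg_cst|exact: e1|exact: e2|exact: e3].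
Qed.

(** These are the conditions of [tangent_F]; here px + py^2 = x (t + x sg^2), and for t = 0 this is
    nonzero because sg is. *)
Lemma arc_regular : exists2 e : R, 0 < e & forall x, 0 < x < e -> sg x != 0 /\ px x + py x ^+ 2 != 0.
Proof.
have n2 : (2 : K) != 0 by rewrite pnatr_eq0.
have near0 (f : R -> K) : f @ (0 : R) --> f 0 -> f 0 != 0 -> exists2 e : R, 0 < e & forall x, 0 < x < e -> f x != 0.
  move=> cf f0; have : \forall x \near (0 : R), rn (f x - f 0) < rn (f 0).
    by apply: ((cvg_rnP S f (f 0)).1 cf); rewrite rn_gt0.
  move=> /nbhs_ballP[e /= e0 He]; exists e => // x /andP[x0 xe].
  have := He x; rewrite /ball /= sub0r normrN gtr0_norm // => /(_ xe).
  by apply: contraTneq => ->; rewrite sub0r rnN ltxx.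
have [e1 e10 H1] : exists2 e : R, 0 < e & forall x, 0 < x < e -> sg x != 0.
  have [s0|s0] := eqVneq s 0.
    by exists 1 => // x /andP[x0 _]; rewrite /sg s0 mul0r add0r (cR_eq0 S) gt_eqF.
  by apply: near0 (@csg 0) _; rewrite /sg cR0 addr0 mulf_neq0 // invr_eq0.
have [e2 e20 H2] : exists2 e : R, 0 < e & forall x, 0 < x < e -> (sg x != 0) ==> (t + cR x * sg x ^+ 2 != 0).
  have [t0|t0] := eqVneq t 0.
    exists 1 => // x /andP[x0 _]; rewrite t0 add0r; apply/implyP => h.
    by rewrite mulf_neq0 ?expf_neq0 // (cR_eq0 S) gt_eqF.
  have c : (fun x : R => t + cR x * sg x ^+ 2) @ (0 : R) --> t + cR 0 * sg 0 ^+ 2.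
    exact: (cvgD (@ck t _) (cvgM (@cid 0) (cvgM (@csg 0) (@csg 0)))).
  have [|e e0 He] := near0 _ c; first by rewrite cR0 mul0r addr0.
  by exists e => // x hx; rewrite He // implybT.
exists (Num.min e1 e2); first by rewrite lt_min e10.
move=> x; rewrite lt_min => /and3P[x0 x1 x2].
have h1 : sg x != 0 by apply: H1; rewrite x0.
have := H2 x; rewrite x0 x2 h1 /= => /(_ isT) h2; split=> //.
rewrite (_ : _ + _ = cR x * (t + cR x * sg x ^+ 2)); last by rewrite /px /py; ring.
by rewrite mulf_neq0 // (cR_eq0 S) gt_eqF.
Qed.

(** As F is injective, equal points give (x - y) (s + 2 (x + y)) = 0. The second factor is nonzero
    for positive x, y below |s| / 4, and for all positive x, y if s = 0. *)
Lemma arc_inj_small : exists2 e : R, 0 < e & forall x y, 0 < x < e -> 0 < y < e -> arc x = arc y -> x = y.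
Proof.
have n2 : (2 : K) != 0 by rewrite pnatr_eq0.
have [e e0 He] : exists2 e : R, 0 < e & forall x y, 0 < x < e -> 0 < y < e -> s + 2 * (cR x + cR y) != 0.
  have E x y : 2 * (cR x + cR y) = cR (2 * (x + y)) by rewrite cRM cR_nat cRD.
  have [s0|s0] := eqVneq s 0.
    exists 1 => // x y /andP[x0 _] /andP[y0 _].
    by rewrite s0 add0r E (cR_eq0 S) gt_eqF // mulr_gt0 // addr_gt0.
  exists (rn s / 4); first by rewrite divr_gt0 // rn_gt0.
  move=> x y /andP[x0 xe] /andP[y0 ye]; rewrite E addr_eq0; apply/eqP => h.
  have /= := congr1 (fun z : K => rn z) h; rewrite rnN rn_cR ger0_norm; last by rewrite mulr_ge0 // addr_ge0 // ltW.
  lra.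
exists e => // x y hx hy /F_inj E; have := congr1 (fun z : 'rV[K]_2 => z 0 1) E.
rewrite !pt21 /py /sg => E1.
have /eqP : (cR x - cR y) * (s + 2 * (cR x + cR y)) = 0.
  have : 2 * (cR x * (s / 2 + cR x) - cR y * (s / 2 + cR y)) = 0 by rewrite E1 subrr mulr0.
  by move=> <-; field.
rewrite mulf_eq0 (negbTE (He x y hx hy)) orbF => h.
by apply: (@cR_inj _ _ S); apply/eqP; rewrite -subr_eq0.
Qed.

(** A lies in Y, so the differentials of [eq1] and [eq2] kill its tangent vectors, whatever its
    dimension d. *)
Lemma tangent_in_frame x d (A : set 'rV[K]_4) (f : 'rV[K]_4 -> 'rV[K]_(4 - d)) (T : 'M[K]_(d, 4)) :
  A `<=` Y -> 0 < x -> sg x != 0 -> px x + py x ^+ 2 != 0 ->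
  submersive_equations A (arc x) f -> T *m 'J f (arc x) = 0 -> (T <= frame x)%MS.
Proof.
move=> AY x0 s0 xy sub TJ; apply/row_subP => i.
have x1 : cR x != 0 by rewrite (cR_eq0 S) gt_eqF.
have y0 : py x != 0 by rewrite mulf_neq0.
set v := row i T.
have vJ : v *m 'J f (arc x) = 0 by rewrite -row_mul TJ row0.
have Yp : Y (arc x) by exists (pt2 (px x) (py x)).
have hol := row2_holo (polyfun_eq1 (arc x)) (polyfun_eq2 (arc x)).
have vh : v *m 'J (row2 (@eq1 K) (@eq2 K)) (arc x) = 0.
  apply: (tangent_kills S sub vJ hol); apply: (@filterE _ (nbhs (arc x))) => z /AY.
  by rewrite row2_eq0 => /YP[].
have D1 : d1 (arc x) v = 0 by rewrite -(J_eq1 S (j := 0) _ hol) ?vh ?mxE // => z; rewrite mxE.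
have D2 : d2 (arc x) v = 0 by rewrite -(J_eq2 S (j := 1) _ hol) ?vh ?mxE // => z; rewrite mxE.
have [E2 E3] := tangent_F y0 xy D1 D2.
(* Dividing the second row by x turns the coefficient v_u / (2 py) of F_y into v_u / (2 sg). *)
have -> : v = pt2 (v 0 i0) (v 0 i1 / (2 * sg x)) *m frame x.
  rewrite mul_row2 pt20 pt21; apply/rowP => j.
  rewrite [v]pt4E E2 E3 !mxE /=; have n2 : (2 : K) != 0 by rewrite pnatr_eq0.
  case: j => [[|[|[|[|//]]]] h] /=.
  - by ring.
  - by field; rewrite s0.
  - by rewrite /py /px; field; rewrite s0 x1.
  - by rewrite /py /px; field; rewrite s0 x1.
exact: submxMl.
Qed.

End LimitPlane.

Lemma sphere_cluster n (c : nat -> 'rV[K]_n) : (forall k, rn (c k) = 1) ->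
  exists2 l, rn l = 1 & forall e : R, 0 < e -> forall N, exists2 k, (N <= k)%N & rn (c k - l) < e.
Proof.
move=> c1; have [] := @rvball_compact R K S n 1 (c @ \oo) _ _.
  by exists 0%N => // k _ /=; rewrite c1.
move=> l [l1 Hl].
have H (e : R) : 0 < e -> forall N, exists2 k, (N <= k)%N & rn (c k - l) < e.
  move=> e0 N; have [] := Hl (c @` [set k | (N <= k)%N]) [set z | rn (z - l) < e].
  - by exists N => // k kN; exists k.
  - by apply: ((nearP_rn S (fun z => rn (z - l) < e) l).2); exists e.
  - by move=> _ [[k kN <-] h]; exists k.
exists l => //; apply/eqP; rewrite eq_le; apply/andP; split=> //.
rewrite leNgt; apply/negP => lt1; have e0 : 0 < 1 - rn l by rewrite subr_gt0.
have [k _ h] := H _ e0 0%N; have := rnD (c k - l) l (S := S); rewrite subrK c1; lra.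
Qed.

Lemma eqmx_rank_sub m1 m2 n (A : 'M[K]_(m1, n)) (B : 'M[K]_(m2, n)) :
  (A <= B)%MS -> (\rank B <= \rank A)%N -> (B == A)%MS.
Proof.
move=> AB rk; rewrite AB andbT; have [_ <-] := mxrank_leqif_sup AB.
by rewrite eqn_leq rk (mxrankS AB).
Qed.

(** Along the arc, the tangent spaces of some stratum of positive dimension lie in [frame], so a
    limit of them lies in [frame 0]; if ['d g 0] killed e1, the arc could be chosen so that it kills
    all of [frame 0]. *)
Lemma general_direction (SS : set (set 'rV[K]_4)) (g : 'rV[K]_4 -> K) :
  whitney_stratification Y SS -> holomorphic_at g 0 -> general_at SS g 0 -> 'd g 0 (pt4 1 0 0 0) != 0.
Proof.
move=> WS hg gen.
have [L [M [r [_ _ dL _]]]] := holo_strict_d S hg.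
have lin (a b : K) (u v : 'rV[K]_4) : 'd g 0 (a *: u + b *: v) = a * 'd g 0 u + b * 'd g 0 v.
  by rewrite !dL mulmxDl -!scalemxAl !mxE.
apply/eqP => e10.
(* A linear form on the plane of e2 and e4 has a nonzero kernel vector, and this vector fixes the
   arc. *)
have [s [t [st0 dst]]] : exists s t : K, (s != 0) || (t != 0) /\ 'd g 0 (pt4 0 s 0 t) = 0.
  have E s t : 'd g 0 (pt4 0 s 0 t) = s * 'd g 0 (pt4 0 1 0 0) + t * 'd g 0 (pt4 0 0 0 1).
    rewrite -lin; congr ('d g 0 _); apply/rowP => -[[|[|[|[|//]]]] h]; rewrite !mxE /=; ring.
  have [b0|b0] := eqVneq ('d g 0 (pt4 0 1 0 0)) 0.
    by exists 1, 0; rewrite oner_eq0 E b0 mulr0 mul0r addr0.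
  exists (- 'd g 0 (pt4 0 0 0 1) / 'd g 0 (pt4 0 1 0 0)), 1.
  by rewrite oner_eq0 orbT E divfK // mul1r addNr.
have [e1 e1p inj1] := arc_inj_small s t.
have [A [d [SA d0 smA HA]]] := positive_stratum (gam := arc s t) WS (fun x => ex_intro2 _ _ _ I erefl) e1p inj1 (@arc_continuous s t) (arc0 s t).
have [e2 e2p reg] := arc_regular s t.
have AY : A `<=` Y by rewrite -(strata_cover WS) => q Aq; exists A.
have ex n : exists x : R, [/\ 0 < x, x < n.+1%:R^-1, x < e2 & A (arc s t x)].
  have [|x /andP[x0]] := HA (Num.min n.+1%:R^-1 e2); first by rewrite lt_min invr_gt0 ltr0n.
  by rewrite lt_min => /andP[h1 h2] Ax; exists x.
have [tt Htt] := choice ex.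
have tt0 (ph : nat -> nat) : (forall k, (k <= ph k)%N) -> (fun k => tt (ph k)) @ \oo --> (0 : R).
  move=> phk; apply/cvgrPdist_lt => e e0; have H := near_infty_natSinv_lt (PosNum e0).
  apply: filterS H => k /= hk; rewrite sub0r normrN; have [h1 h2 _ _] := Htt (ph k).
  rewrite gtr0_norm //; apply: lt_trans h2 _; apply: le_lt_trans hk.
  by rewrite lef_pV2 ?posrE ?ltr0n // ler_nat ltnS; exact: phk.
have basis n : exists T : 'M[K]_(d, 4), tangent_basis A (arc s t (tt n)) T /\ (T <= frame s t (tt n))%MS.
  have [h1 h2 h3 h4] := Htt n.
  have [f sub] := smA _ h4; have [d4 _ _ rk _] := sub.
  have [T Tf TJ] := kernel_basis d4 rk; exists T; split; first by split=> //; exists f.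
  have [|h5 h6] := reg (tt n); first by rewrite h1.
  exact: (tangent_in_frame AY h1 h5 h6 sub TJ).
have [T HT] := choice basis.
have fr0 (ph : nat -> nat) : (forall k, (k <= ph k)%N) -> (fun k => frame s t (tt (ph k))) @ \oo --> frame s t 0.
  by move=> /tt0 h; exact: (cvg_comp _ _ h (@frame_continuous s t 0)).
have pa0 (ph : nat -> nat) : (forall k, (k <= ph k)%N) -> (fun k => arc s t (tt (ph k))) @ \oo --> (0 : 'rV[K]_4).
  by move=> /tt0 h; rewrite -(arc0 s t); exact: (cvg_comp _ _ h (@arc_continuous s t 0)).
have kill (c : 'rV[K]_2) : 'd g 0 (c *m frame s t 0) = 0.
  by rewrite frame0 mul_row2 lin e10 dst !mulr0 addr0.
have idk k : (k <= id k)%N by [].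
have d2 : (d <= 2)%N.
  have [[Tf _] sub] := HT 0%N; rewrite -(eqP Tf); apply: leq_trans (mxrankS sub) _; exact: rank_leq_row.
case: d d0 smA d2 T basis HT => [//|[|[|//]]] _ smA _ T basis HT.
  (* Dimension 1: the tangent lines have coordinate rows c in the frame, and normalised rows have a
     convergent subsequence. *)
  have [c Hc] := choice (fun n => let: conj _ sub := HT n in (let: ex_intro c e := submxP sub in ex_intro (fun c => T n = c *m _) c e)).
  have c0 n : c n != 0.
    have [[Tf _] _] := HT n; apply: contraTneq Tf => h; by rewrite mx1_row_free Hc h mul0mx eqxx.
  pose c1 n := `|c n|^-1 *: c n.
  have cn n : `|c n|^-1 != 0 by rewrite invr_eq0 normr_eq0.
  have c1n n : rn (c1 n) = 1.
    apply: (@cR_inj _ _ S); rewrite -rnE /c1 normrZ normfV normr_id mulVf ?cR1 //.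
    by rewrite normr_eq0.
  have [l l1 Hl] := sphere_cluster c1n.
  have l0 : l != 0 by rewrite -(rn_gt0 S) l1.
  have sel k : exists j, (k <= j)%N /\ rn (c1 j - l) < k.+1%:R^-1.
    have [|j h1 h2] := Hl k.+1%:R^-1 _ k; first by rewrite invr_gt0.
    by exists j.
  have [ph Hph] := choice sel.
  have phk k : (k <= ph k)%N by have [] := Hph k.
  have cl : (fun k => c1 (ph k)) @ \oo --> l.
    apply/(cvg_rnP S) => e e0; have H := near_infty_natSinv_lt (PosNum e0).
    by apply: filterS H => k /= hk; apply: lt_trans hk; have [] := Hph k.
  have lf0 : l *m frame s t 0 != 0.
    apply: contraNneq l0 => h; apply/eqP/(row_free_inj (frame0_free st0)).
    by rewrite /= h mul0mx.
  have [|v vt] := gen A 1%N (fun k => arc s t (tt (ph k))) (fun k => T (ph k)) (l *m frame s t 0) SA isT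
    (fun k => let: And4 _ _ _ h := Htt (ph k) in h) (pa0 ph phk) (fun k => (HT (ph k)).1) _.
    split; [by move=> k; have [[]] := HT (ph k)|by rewrite mx1_row_free|].
    exists (fun k => c1 (ph k) *m frame s t (tt (ph k))); split.
      move=> k; rewrite /c1 -scalemxAl -Hc; apply/eqmxP; exact: eqmx_scale.
    apply: (@cvg_mx _ \oo) => i j.
    rewrite mxE (_ : (fun t0 => _) = fun k => \sum_m c1 (ph k) i m * frame s t (tt (ph k)) m j); last by apply/funext => k; rewrite mxE.
    rewrite !big_ord_recl big_ord0 (_ : (fun k => _) = fun k => c1 (ph k) i ord0 * frame s t (tt (ph k)) ord0 j + (c1 (ph k) i (lift ord0 ord0) * frame s t (tt (ph k)) (lift ord0 ord0) j + 0)); last by apply/funext => k; rewrite !big_ord_recl big_ord0.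
    have e1' m : (fun k => c1 (ph k) i m) @ \oo --> l i m by exact: (cvg_comp _ _ cl (@coord_continuous K 1 2 i m l)).
    have e2' m : (fun k => frame s t (tt (ph k)) m j) @ \oo --> frame s t 0 m j by exact: (cvg_comp _ _ (fr0 ph phk) (@coord_continuous K 2 4 m j _)).
    by rewrite !addr0; under eq_fun do rewrite addr0; exact: (cvgD (cvgM (e1' _) (e2' _)) (cvgM (e1' _) (e2' _))).
  by move: vt => /submxP[k ->]; rewrite mulmxA kill eqxx.
(* Dimension 2: the tangent planes are those of the frame, by equality of ranks. *)
have [|v vt] := gen A 2%N (fun k => arc s t (tt k)) T (frame s t 0) SA isT
    (fun k => let: And4 _ _ _ h := Htt k in h) (pa0 id idk) (fun k => (HT k).1) _.
  split; [by move=> k; have [[]] := HT k|exact: frame0_free|].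
  exists (fun k => frame s t (tt k)); split; last exact: (fr0 id idk).
  move=> k; have [[Tf _] sub] := HT k; apply: eqmx_rank_sub => //.
  rewrite (eqP Tf); exact: rank_leq_row.
by move: vt => /submxP[k ->]; rewrite kill eqxx.
Qed.

End GeneralFunctions.

(** * The equation g(F(x, y)) = lambda near 0 *)

Section MilnorFibre.
Variables (R : realType) (K : numClosedFieldType) (S : real_structure R K).
Local Notation rn := (rn S).
Local Notation cR := (cR S).

Variables (g : 'rV[K]_4 -> K) (L : 'cV[K]_4) (M r : R).
Hypothesis r0 : 0 < r.
Hypothesis M0 : 0 <= M.
Hypothesis strict : forall s z w, 0 < s -> s <= r -> rn z <= s -> rn w <= s ->
  rn (g z - g w - ((z - w) *m L) 0 0) <= M * s * rn (z - w).
Hypothesis g0 : g 0 = 0.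
Let a := L i0 0.
Let b := L i1 0.
Let c := L i2 0.
Let d := L i3 0.
Hypothesis a0 : a != 0.
Let al := rn a.
(** A common bound for the coefficients in [remainder_lip]: the coordinates v and w contribute the
    terms in c and d, the two-point estimate of g the term in M. *)
Let ch := 3 * rn c + 3 * rn d + 9 * M.
Let gF (x y : K) : K := g (F (pt2 x y)).
(** The remainder of g(F(x, y)) after its part of weight 2, x and y having weights 2 and 1. *)
Let E (x y : K) : K := gF x y - (a * x + b * y ^+ 2).

Lemma mulL4 (v : 'rV[K]_4) : (v *m L) 0 0 = v 0 i0 * a + v 0 i1 * b + v 0 i2 * c + v 0 i3 * d.
Proof.
rewrite mxE !big_ord_recl big_ord0 addr0 !addrA /a /b /c /d.
by congr (v 0 _ * L _ 0 + v 0 _ * L _ 0 + v 0 _ * L _ 0 + v 0 _ * L _ 0); apply: val_inj.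
Qed.

Lemma ch_ge0 : 0 <= ch.
Proof. by rewrite /ch !addr_ge0 // ?mulr_ge0 ?rn_ge0. Qed.

Lemma al_gt0 : 0 < al. Proof. by rewrite /al rn_gt0. Qed.

Lemma remainder00 : E 0 0 = 0.
Proof.
rewrite /E /gF (_ : pt2 0 0 = 0) ?F0 ?g0 ?expr0n /= ?mulr0 ?addr0 ?subrr //.
by apply/rowP => -[[|[|//]] h]; rewrite !mxE.
Qed.

(** X and m bound |x| and |y| separately: for X of order m^2 the coefficients are O(m) for x and
    O(m^2) for y, which is what [shrink] relies on. In [solve_x], X = m or X = 0. *)
Lemma remainder_lip (X m : R) x y x' y' : 0 <= X -> X <= 1 -> 0 < m -> m <= 1 -> X + m ^+ 2 <= r ->
  rn x <= X -> rn x' <= X -> rn y <= m -> rn y' <= m ->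
  rn (E x y - E x' y') <= ch * ((m + X) * rn (x - x') + (X + m ^+ 2) * rn (y - y')).
Proof.
move=> X0 X1 m0 m1 Xr hx hx' hy hy'.
have m0' := ltW m0.
have mX k : m ^+ k.+1 <= m by rewrite exprS ler_piMr // exprn_ile1.
have mX2 k : m ^+ k.+2 <= m ^+ 2 by rewrite -addn2 exprD ler_piMl ?exprn_ge0 // exprn_ile1.
have m21 : m ^+ 2 <= 1 by rewrite exprn_ile1.
have m2p : 0 < m ^+ 2 by rewrite exprn_gt0.
set Dx := rn (x - x'); set Dy := rn (y - y').
have Dx0 : 0 <= Dx := rn_ge0 _.
have Dy0 : 0 <= Dy := rn_ge0 _.
have ry k (z : K) : rn z <= m -> rn (z ^+ k) <= m ^+ k by move=> hz; rewrite rnX lerXn2r ?nnegrE ?rn_ge0.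
have p4 : rn (y ^+ 2 - y' ^+ 2) <= 2 * m * Dy.
  rewrite subr_sqr rnM mulrC; apply: ler_wpM2r => //.
  by apply: le_trans (rnD _ _) _; rewrite mulr_natl mulr2n lerD.
have p3 : rn (y ^+ 3 - y' ^+ 3) <= 3 * m ^+ 2 * Dy.
  rewrite (_ : y ^+ 3 - y' ^+ 3 = (y ^+ 2 + y * y' + y' ^+ 2) * (y - y')); last by ring.
  rewrite rnM; apply: ler_wpM2r => //.
  apply: le_trans (rnD _ _) _; rewrite (_ : 3 * m ^+ 2 = m ^+ 2 + m * m + m ^+ 2); last by ring.
  apply: lerD; last exact: ry; apply: le_trans (rnD _ _) _; apply: lerD; first exact: ry.
  by rewrite rnM ler_pM ?rn_ge0.
have p1 : rn (x * y ^+ 3 - x' * y' ^+ 3) <= m * Dx + 3 * (X * Dy).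
  rewrite (_ : _ - _ = y ^+ 3 * (x - x') + x' * (y ^+ 3 - y' ^+ 3)); last by ring.
  apply: le_trans (rnD _ _) _; rewrite (rnM S (y ^+ 3)) (rnM S x'); apply: lerD.
    by apply: ler_wpM2r => //; apply: le_trans (ry 3%N y hy) (mX _).
  apply: (@le_trans _ _ (X * (3 * m ^+ 2 * Dy))); first by rewrite ler_pM ?rn_ge0.
  rewrite (_ : X * _ = 3 * (m ^+ 2 * (X * Dy))); last by ring.
  by apply: ler_wpM2l => //; apply: ler_piMl => //; exact: mulr_ge0.
have p2 : rn (x * y - x' * y') <= m * Dx + X * Dy.
  rewrite (_ : _ - _ = y * (x - x') + x' * (y - y')); last by ring.
  by apply: le_trans (rnD _ _) _; rewrite !rnM; apply: lerD; apply: ler_wpM2r.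
have p23 : rn (x * y + y ^+ 3 - (x' * y' + y' ^+ 3)) <= m * Dx + X * Dy + 3 * m ^+ 2 * Dy.
  rewrite (_ : _ - _ = (x * y - x' * y') + (y ^+ 3 - y' ^+ 3)); last by ring.
  by apply: le_trans (rnD _ _) _; apply: lerD.
have Fs u v : rn u <= X -> rn v <= m -> rn (F (pt2 u v)) <= X + m ^+ 2.
  move=> hu hv; rewrite F_pt2; apply: rn_pt4; first by rewrite addr_ge0 // ltW.
  - by apply: le_trans hu _; rewrite lerDl ltW.
  - by apply: le_trans (ry 2%N v hv) _; rewrite lerDr.
  - rewrite rnM; apply: (@le_trans _ _ (X * 1)); last by rewrite mulr1 lerDl ltW.
    by apply: ler_pM; rewrite ?rn_ge0 //; apply: le_trans (ry 3%N v hv) _; rewrite exprn_ile1.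
  - apply: le_trans (rnD _ _) _; apply: lerD; last exact: le_trans (ry 3%N v hv) (mX2 1%N).
    rewrite rnM -[leRHS]mulr1; apply: ler_pM; rewrite ?rn_ge0 //; exact: le_trans hv m1.
set z := F (pt2 x y); set w := F (pt2 x' y').
have zw : z - w = pt4 (x - x') (y ^+ 2 - y' ^+ 2) (x * y ^+ 3 - x' * y' ^+ 3) (x * y + y ^+ 3 - (x' * y' + y' ^+ 3)).
  by rewrite /z /w !F_pt2; apply/rowP => -[[|[|[|[|//]]]] h]; rewrite !mxE.
have XDy : X * Dy <= Dy by rewrite ler_piMl.
have mDy : m * Dy <= Dy by rewrite ler_piMl.
have mDx : m * Dx <= Dx by rewrite ler_piMl.
have m2Dy : m ^+ 2 * Dy <= Dy by rewrite ler_piMl.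
have N1 : rn (z - w) <= Dx + 4 * Dy.
  rewrite zw; apply: rn_pt4; first by rewrite addr_ge0 // mulr_ge0.
  - by rewrite -/Dx lerDl mulr_ge0.
  - apply: le_trans p4 _; lra.
  - apply: le_trans p1 _; lra.
  - apply: le_trans p23 _; lra.
have s0 : 0 < X + m ^+ 2 by rewrite ltr_wpDl.
have st := strict s0 Xr (Fs _ _ hx hy) (Fs _ _ hx' hy').
rewrite -/z -/w in st.
(* The terms in a and b cancel against the linear part; the error of the two-point estimate and the
   coordinates v and w remain. *)
have -> : E x y - E x' y' = (g z - g w - ((z - w) *m L) 0 0) + (c * (x * y ^+ 3 - x' * y' ^+ 3) + d * (x * y + y ^+ 3 - (x' * y' + y' ^+ 3))).
  by rewrite mulL4 zw !pt4s /E /gF -/z -/w; ring.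
set A := (m + X) * Dx; set B := (X + m ^+ 2) * Dy.
have A0 : 0 <= A by rewrite mulr_ge0 // addr_ge0.
have B0 : 0 <= B by rewrite mulr_ge0 // ltW.
have XD : 0 <= X * Dx by rewrite mulr_ge0.
have XDy0 : 0 <= X * Dy by rewrite mulr_ge0.
have mm : 0 <= m ^+ 2 * Dy by rewrite mulr_ge0 // ltW.
have AE : A = m * Dx + X * Dx by rewrite /A mulrDl.
have BE : B = X * Dy + m ^+ 2 * Dy by rewrite /B mulrDl.
have t1 : rn (c * (x * y ^+ 3 - x' * y' ^+ 3)) <= rn c * (A + 3 * B).
  by rewrite rnM; apply: ler_wpM2l; rewrite ?rn_ge0 //; apply: le_trans p1 _; lra.
have t2 : rn (d * (x * y + y ^+ 3 - (x' * y' + y' ^+ 3))) <= rn d * (A + 3 * B).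
  by rewrite rnM; apply: ler_wpM2l; rewrite ?rn_ge0 //; apply: le_trans p23 _; lra.
have t3 : M * (X + m ^+ 2) * rn (z - w) <= M * (A + 4 * B).
  rewrite -mulrA; apply: ler_wpM2l => //.
  apply: (@le_trans _ _ ((X + m ^+ 2) * (Dx + 4 * Dy))); first by rewrite ler_wpM2l // ltW.
  rewrite mulrDr mulrCA -/B lerD2r /A; apply: ler_wpM2r => //.
  by rewrite addrC lerD2r; exact: (mX 1%N).
apply: le_trans (rnD _ _) _.
have t12 := le_trans (rnD (c * (x * y ^+ 3 - x' * y' ^+ 3)) (d * (x * y + y ^+ 3 - (x' * y' + y' ^+ 3))) (S := S)) (lerD t1 t2).
apply: le_trans (lerD (le_trans st t3) t12) _.
rewrite /ch -/A -/B.
have q1 : 0 <= rn c * A by rewrite mulr_ge0 ?rn_ge0.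
have q2 : 0 <= rn c * B by rewrite mulr_ge0 ?rn_ge0.
have q3 : 0 <= rn d * A by rewrite mulr_ge0 ?rn_ge0.
have q4 : 0 <= rn d * B by rewrite mulr_ge0 ?rn_ge0.
have q5 : 0 <= M * A by rewrite mulr_ge0.
have q6 : 0 <= M * B by rewrite mulr_ge0.
rewrite -subr_ge0.
have -> : (3 * rn c + 3 * rn d + 9 * M) * (A + B) - (M * (A + 4 * B) + (rn c * (A + 3 * B) + rn d * (A + 3 * B))) =
  2 * (rn c * A) + 2 * (rn d * A) + 8 * (M * A) + 5 * (M * B) by ring.
by move: q1 q3 q5 q6; lra.
Qed.

(** The map x |-> (g(F(x, y)) - lambda) / a is close to the identity, as E has a small Lipschitz
    constant in x. Since a x + b y^2 has no linear term in y, x is bounded by |y|^2 + |lambda|. *)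
Lemma solve_x : exists r1 r2 dl C' : R, [/\ 0 < r1, r1 <= 1, 0 < r2 /\ r2 <= r1, 0 < dl /\ 0 < C' &
  (forall y lam, rn y <= r2 -> rn lam <= dl ->
    exists x, [/\ rn x <= r1, rn x <= C' * (rn y ^+ 2 + rn lam) & gF x y = lam]) /\
  (forall x y x' y', rn x <= r1 -> rn x' <= r1 -> rn y <= r2 -> rn y' <= r2 ->
     gF x y = gF x' y' -> rn (x - x') <= C' * rn (y - y'))].
Proof.
have al0 := al_gt0; have ch0 := ch_ge0.
(* 4 r1 (ch + 1) <= al makes the Lipschitz constant of E in x at most al / 2, whence the factor 1 /
   2 in [TH]. *)
pose r1 := Num.min 1 (Num.min (r / 2) (al / (4 * (ch + 1)))).
have c1 : 0 < 4 * (ch + 1) by rewrite mulr_gt0 // ltr_wpDl.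
have r10 : 0 < r1 by rewrite !lt_min ltr01 !divr_gt0.
have [r11 r12 r13] : [/\ r1 <= 1, r1 <= r / 2 & r1 * (4 * (ch + 1)) <= al].
  by rewrite -ler_pdivlMr // /r1 !ge_min !lexx /= !orbT.
clearbody r1.
have b1 : 0 < 16 * (rn b + ch + 1) by rewrite mulr_gt0 // ltr_wpDl // addr_ge0 // rn_ge0.
(* With this r2 and |lambda| <= al r1 / 16, the terms in y and in lambda each contribute at most r1
   / 16 to |T 0|. *)
pose r2 := Num.min r1 (al * r1 / (16 * (rn b + ch + 1))).
have r20 : 0 < r2 by rewrite lt_min r10 divr_gt0 // mulr_gt0.
have [r21 r22] : r2 <= r1 /\ r2 * (16 * (rn b + ch + 1)) <= al * r1.
  by rewrite -ler_pdivlMr // /r2 !ge_min !lexx orbT.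
clearbody r2.
have q1 : r1 + r1 ^+ 2 <= r.
  have : r1 ^+ 2 <= r1 by rewrite expr2 ler_piMl // ltW.
  lra.
have Elip x y x' y' : rn x <= r1 -> rn x' <= r1 -> rn y <= r2 -> rn y' <= r2 ->
    rn (E x y - E x' y') <= al / 2 * rn (x - x') + 2 * ch * rn (y - y').
  move=> hx hx' hy hy'.
  have h := remainder_lip (ltW r10) r11 r10 r11 q1 hx hx' (le_trans hy r21) (le_trans hy' r21).
  apply: le_trans h _; rewrite mulrDr; apply: lerD; rewrite mulrA; apply: ler_wpM2r; rewrite ?rn_ge0 //.
    have : 0 <= r1 * ch by rewrite mulr_ge0 // ltW.
    have -> : ch * (r1 + r1) = 2 * (r1 * ch) by ring.
    lra.
  rewrite [leRHS]mulrC; apply: ler_wpM2l => //.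
  have : r1 ^+ 2 <= r1 by rewrite expr2 ler_piMl // ltW.
  lra.
pose C' := 4 * (rn b + ch + 1) / al.
have C'0 : 0 < C' by rewrite divr_gt0 // mulr_gt0 // ltr_wpDl // addr_ge0 // rn_ge0.
exists r1, r2, (al * r1 / 16), C'; split=> //; first by split=> //; rewrite divr_gt0 // mulr_gt0.
have CE u : al * (C' * u) = 4 * (rn b + ch + 1) * u by rewrite /C'; field; rewrite gt_eqF.
split; last first.
  move=> x y x' y' hx hx' hy hy' gg.
  have Ed := Elip x y x' y' hx hx' hy hy'.
  have Eq : a * (x - x') = - (b * (y ^+ 2 - y' ^+ 2) + (E x y - E x' y')).
    by rewrite /E gg; ring.
  have h1 : al * rn (x - x') <= rn b * (2 * rn (y - y')) + (al / 2 * rn (x - x') + 2 * ch * rn (y - y')).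
    rewrite /al -rnM Eq rnN; apply: le_trans (rnD _ _) _; apply: lerD => //.
    rewrite rnM; apply: ler_wpM2l; first exact: rn_ge0.
    rewrite subr_sqr rnM mulrC; apply: ler_wpM2r; first exact: rn_ge0.
    apply: le_trans (rnD _ _) _; have := le_trans hy r21; have := le_trans hy' r21; lra.
  rewrite -(ler_pM2l al0) CE.
  have : 0 <= rn (y - y') := rn_ge0 _.
  move: h1; set u := rn (x - x'); set v := rn (y - y') => h1 v0.
  have -> : 4 * (rn b + ch + 1) * v = 2 * (rn b * (2 * v) + 2 * ch * v) + 4 * v by ring.
  have -> : al * u = 2 * (al * u - al / 2 * u) by field.
  lra.
move=> y lam hy hl.
pose T (w : 'rV[K]_1) : 'rV[K]_1 := const_mx ((gF (w 0 0) y - lam) / a).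
have rn1 (w : 'rV[K]_1) : rn w = rn (w 0 0).
  apply/eqP; rewrite eq_le rn_coord andbT; apply/rn_row_le; rewrite ?rn_ge0 // => i.
  by rewrite (ord1 i).
have TH w w' : rn w <= r1 -> rn w' <= r1 -> rn (T w - T w' - (w - w')) <= 1 / 2 * rn (w - w').
  rewrite !rn1 => hw hw'; rewrite !mxE.
  rewrite (_ : _ - _ - _ = (E (w 0 0) y - E (w' 0 0) y) / a); last by rewrite /E; field.
  have := Elip _ _ _ _ hw hw' hy hy; rewrite subrr rn0 mulr0 addr0 => h.
  by rewrite rnM rnV ler_pdivrMr // -/al; move: h; congr (_ <= _); ring.
have y21 : rn y ^+ 2 <= rn y by rewrite expr2 ler_piMl ?rn_ge0 //; apply: le_trans hy (le_trans r21 r11).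
have gy : rn (gF 0 y) <= (rn b + ch) * rn y ^+ 2.
  (* [remainder_lip] is to be applied with m = |y| > 0. *)
  have [->|y0] := eqVneq y 0.
    by have := remainder00; rewrite /E expr0n /= !mulr0 addr0 subr0 => ->; rewrite !rn0 expr2 !mulr0.
  have rr : 0 + rn y ^+ 2 <= r.
    by rewrite add0r; apply: le_trans y21 _; apply: le_trans hy _; apply: le_trans r21 _; apply: le_trans r12 _; move: r0; lra.
  have := @remainder_lip 0 (rn y) 0 y 0 0 (lexx _) ler01 _ (le_trans hy (le_trans r21 r11)) rr.
  rewrite rn_gt0 y0 !rn0 !subr0 remainder00 subr0 rn0 mulr0 !add0r => /(_ isT (lexx _) (lexx _) (lexx _) (rn_ge0 _)) h.
  have -> : gF 0 y = b * y ^+ 2 + E 0 y by rewrite /E; ring.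
  apply: le_trans (rnD _ _) _; rewrite mulrDl rnM rnX lerD2l; apply: le_trans h _.
  apply: ler_wpM2l => //; rewrite ler_piMr ?exprn_ge0 ?rn_ge0 //; exact: le_trans hy (le_trans r21 r11).
have T0 : al * rn (T 0) <= (rn b + ch) * rn y ^+ 2 + rn lam.
  rewrite rn1 !mxE rnM rnV mulrC divfK ?gt_eqF //; apply: le_trans (rnB _ _) _; exact: lerD.
have T08 : rn (T 0) <= r1 / 8.
  rewrite -(ler_pM2l al0); apply: le_trans T0 _.
  have h2 : (rn b + ch) * rn y ^+ 2 <= (rn b + ch + 1) * r2.
    apply: ler_pM; [exact: addr_ge0 (rn_ge0 _) ch0|by rewrite exprn_ge0 ?rn_ge0|by rewrite lerDl|exact: le_trans y21 hy].
  have h3 : 16 * ((rn b + ch + 1) * r2) <= al * r1 by move: r22; congr (_ <= _); ring.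
  have -> : al * (r1 / 8) = al * r1 / 8 by ring.
  lra.
have [w hw Tw] := approx_zero r10 TH T08.
exists (w 0 0); rewrite -rn1; split.
- apply: le_trans hw _; lra.
- apply: le_trans hw _; rewrite -(ler_pM2l al0) CE mulrCA.
  apply: (@le_trans _ _ (2 * ((rn b + ch) * rn y ^+ 2 + rn lam))); first by rewrite ler_pM2l.
  have y2 : 0 <= rn y ^+ 2 by rewrite exprn_ge0 // rn_ge0.
  have l2 : 0 <= rn lam := rn_ge0 _.
  have b2 : 0 <= rn b + ch by rewrite addr_ge0 ?rn_ge0.
  move: (rn b + ch) b2 => B B0; move: (rn y ^+ 2) y2 => u u0; move: (rn lam) l2 => v v0.
  have : 0 <= B * u by rewrite mulr_ge0.
  have : 0 <= B * v by rewrite mulr_ge0.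
  have -> : 4 * (B + 1) * (u + v) = 4 * (B * u) + 4 * (B * v) + 4 * u + 4 * v by ring.
  lra.
move/rowP: Tw => /(_ 0); rewrite !mxE => /eqP; rewrite mulf_eq0 invr_eq0 (negbTE a0) orbF subr_eq0.
by move/eqP.
Qed.

(* As g(F(x, y)) = a x + b y^2 + higher order terms, the equation bounds w = x' - s^2 x by ep (1 - s) |y|^2. So moving from (s^2 x, s y) to (x', s y) costs less than what the factor s^4 gains on |y^2|^2. *)
Lemma shrink (C1 : R) : 0 <= C1 -> exists m3 sg : R, [/\ 0 < m3, 0 < sg &
  forall x y x' lam s, 0 <= s -> s <= 1 -> y != 0 -> rn y <= m3 -> rn lam <= sg * rn y ^+ 2 ->
    gF x y = lam -> gF x' (cR s * y) = lam -> rn x <= C1 * rn y ^+ 2 -> rn x' <= C1 * rn y ^+ 2 ->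
    rho S (pt2 x' (cR s * y)) <= rho S (pt2 x y)].
Proof.
move=> C0; have al0 := al_gt0; have ch0 := ch_ge0.
have k0 : 0 < 6 * C1 + 5 by rewrite ltr_wpDl // mulr_ge0.
(* 6 C1 + 5 = (2 C1 + 1) + (2 C1 + 1) + (2 (C1 + 1) + 1) adds the growth constants of the
   coordinates x, v and w; see [d6]. *)
pose ep := (6 * C1 + 5)^-1.
have ep0 : 0 < ep by rewrite invr_gt0.
have ep1 : ep <= 1 by rewrite invf_le1 //; lra.
have epk : ep * (6 * C1 + 5) = 1 by rewrite mulVf ?gt_eqF.
clearbody ep.
pose D := (ch + 1) * (4 * C1 + 3).
have D0 : 0 < D by rewrite mulr_gt0 // ltr_wpDl // mulr_ge0.
have Dch : ch <= D /\ ch * (4 * C1 + 3) <= D.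
  rewrite /D; split; last by rewrite ler_wpM2r ?lerDl // addr_ge0 // mulr_ge0.
  have : 0 <= ch * C1 by rewrite mulr_ge0.
  have -> : (ch + 1) * (4 * C1 + 3) = 4 * (ch * C1) + 3 * ch + 4 * C1 + 3 by ring.
  by lra.
clearbody D.
have C10 : 0 < C1 + 1 by rewrite ltr_wpDl.
(* q bounds m (C1 + 1); the third entry makes the remainder terms at most a quarter of al ep, in
   [chQ] and [chQ2]. *)
pose q := Num.min 1 (Num.min r (al * ep / (4 * D))).
have q0 : 0 < q by rewrite !lt_min ltr01 r0 divr_gt0 ?mulr_gt0.
have [q1 qr qD] : [/\ q <= 1, q <= r & q * (4 * D) <= al * ep].
  by rewrite -ler_pdivlMr ?mulr_gt0 // /q !ge_min !lexx /= !orbT.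
clearbody q.
have m30 : 0 < q / (C1 + 1) by rewrite divr_gt0.
exists (q / (C1 + 1)), (al * ep / 8); split=> //; first by rewrite divr_gt0 // mulr_gt0.
move=> x y x' lam s s0 s1 y0; rewrite ler_pdivlMr // => mq hl gx gx' hx hx'.
set m := rn y in mq hl hx hx' *.
have m0 : 0 < m by rewrite rn_gt0.
have m1 : m <= 1.
  apply: le_trans (_ : m * (C1 + 1) <= _); last exact: le_trans mq q1.
  by apply: ler_peMr; [exact: ltW|move: C0; lra].
have sm0 := ltW m0.
have m2 : 0 <= m ^+ 2 by rewrite exprn_ge0.
have m2m : m ^+ 2 <= m by rewrite expr2 ler_piMl.
have X0 : 0 <= C1 * m ^+ 2 by rewrite mulr_ge0.
have Xm : (C1 + 1) * m ^+ 2 <= m * (C1 + 1) by rewrite mulrC ler_pM2r.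
have XE : C1 * m ^+ 2 + m ^+ 2 = (C1 + 1) * m ^+ 2 by ring.
have X1 : C1 * m ^+ 2 <= 1 by lra.
have Xr : C1 * m ^+ 2 + m ^+ 2 <= r by lra.
pose e := 1 - s.
have e0 : 0 <= e by rewrite subr_ge0.
have e1 : e <= 1 by rewrite /e; lra.
have s2 : s ^+ 2 <= 1 by rewrite exprn_ile1.
have sE : 1 - s ^+ 2 <= 2 * e.
  have -> : 1 - s ^+ 2 = e * (1 + s) by rewrite /e; ring.
  by rewrite mulrC ler_wpM2r //; lra.
have sE0 : 0 <= 1 - s ^+ 2 by rewrite subr_ge0.
have ns : rn (cR s) = s by rewrite rn_cR ger0_norm.
have hy' : rn (cR s * y) <= m by rewrite rnM ns ler_piMl.
have yy : rn (y - cR s * y) = e * m.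
  rewrite (_ : y - cR s * y = cR (1 - s) * y); last by rewrite cRB cR1; ring.
  by rewrite rnM rn_cR ger0_norm.
pose w := x' - cR s ^+ 2 * x.
set W := rn w.
have W0 : 0 <= W := rn_ge0 _.
have xx : rn (x - x') <= W + 2 * e * (C1 * m ^+ 2).
  rewrite (_ : x - x' = - w + cR (1 - s ^+ 2) * x); last by rewrite /w cRB cR1 cRX; ring.
  apply: le_trans (rnD _ _) _; rewrite rnN lerD2l rnM rn_cR ger0_norm //.
  by rewrite ler_pM ?rn_ge0.
have mX : m + C1 * m ^+ 2 <= m * (C1 + 1).
  have : C1 * m ^+ 2 <= C1 * m by rewrite ler_wpM2l.
  lra.
have T1 := remainder_lip X0 X1 m0 m1 Xr hx hx' (lexx _) hy'.
have z0 : rn (0 : K) <= C1 * m ^+ 2 by rewrite rn0.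
have z1 : rn (0 : K) <= m by rewrite rn0.
have T2 := remainder_lip X0 X1 m0 m1 Xr hx z0 (lexx _) z1.
rewrite remainder00 !subr0 -/m in T2; rewrite yy in T1.
(* s^2 times the equation at (x, y) is subtracted from the equation at (x', s y), and the terms in b
   cancel. *)
have WE : a * w = cR (1 - s ^+ 2) * lam - cR (1 - s ^+ 2) * E x y + (E x y - E x' (cR s * y)).
  by rewrite /E gx gx' /w cRB cR1 cRX; ring.
have P1 : al * W <= 2 * e * (al * ep / 8 * m ^+ 2) + 2 * e * rn (E x y) + rn (E x y - E x' (cR s * y)).
  rewrite /al /W -rnM WE; apply: le_trans (rnD _ _) _; rewrite lerD2r.
  apply: le_trans (rnB _ _) _; rewrite !rnM rn_cR ger0_norm //.
  by apply: lerD; [rewrite ler_pM ?rn_ge0|rewrite ler_wpM2r ?rn_ge0].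
pose Q := m * (C1 + 1).
have Q0 : 0 <= Q by rewrite mulr_ge0 // ltW.
have P2 : rn (E x y) <= ch * (Q * (C1 + 1) * m ^+ 2).
  apply: le_trans T2 _; apply: ler_wpM2l => //.
  have -> : Q * (C1 + 1) * m ^+ 2 = Q * (C1 * m ^+ 2) + (C1 * m ^+ 2 + m ^+ 2) * m by rewrite /Q; ring.
  by rewrite lerD2r ler_pM ?rn_ge0 // addr_ge0.
have P3 : rn (E x y - E x' (cR s * y)) <= ch * (Q * (W + 2 * e * (C1 * m ^+ 2)) + Q * m * (e * m)).
  apply: le_trans T1 _; apply: ler_wpM2l => //; apply: lerD.
    by rewrite ler_pM ?rn_ge0 // addr_ge0.
  by rewrite XE (_ : Q * m = (C1 + 1) * m ^+ 2) // /Q; ring.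
have chQ : ch * Q <= al * ep / 4.
  apply: (@le_trans _ _ (D * q)); first by rewrite ler_pM // Dch.1.
  by rewrite ler_pdivlMr // mulrC; move: qD; congr (_ <= _); ring.
have chQ2 : ch * (4 * C1 + 3) * Q <= al * ep / 4.
  apply: (@le_trans _ _ (D * q)); first by rewrite ler_pM // ?mulr_ge0 ?Dch.2 // addr_ge0 // mulr_ge0.
  by rewrite ler_pdivlMr // mulrC; move: qD; congr (_ <= _); ring.
have alep : al * ep <= al by rewrite ler_piMr // ltW.
have em : 0 <= e * m ^+ 2 by rewrite mulr_ge0.
(* The W on the right has a coefficient at most al / 4 and is absorbed on the left. *)
have WB : W <= ep * (e * m ^+ 2).
  have u1 : ch * Q * W <= al / 4 * W by rewrite ler_wpM2r //; lra.
  have u2 : ch * (4 * C1 + 3) * Q * (e * m ^+ 2) <= al * ep / 4 * (e * m ^+ 2) by rewrite ler_wpM2r.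
  have u3 : 2 * e * rn (E x y) <= 2 * e * (ch * (Q * (C1 + 1) * m ^+ 2)) by rewrite ler_wpM2l // mulr_ge0.
  have u4 : al * W <= al * ep / 4 * (e * m ^+ 2) + ch * (4 * C1 + 3) * Q * (e * m ^+ 2) + ch * Q * W.
    apply: le_trans P1 _; apply: le_trans (lerD (lerD (lexx _) u3) P3) _.
    by rewrite le_eqVlt; apply/orP; left; apply/eqP; field.
  have aW : 0 <= al * W by rewrite mulr_ge0 // ltW.
  rewrite -(ler_pM2l al0) mulrA.
  have : al / 4 * W = al * W / 4 by field.
  have : al * ep / 4 * (e * m ^+ 2) = al * ep * (e * m ^+ 2) / 4 by field.
  lra.
have WW : W <= m ^+ 2.
  by apply: le_trans WB _; rewrite mulrA ler_piMl // mulr_ile1 // ltW.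
have sk k : s ^+ k <= 1 by rewrite exprn_ile1.
have skM k (u : K) : rn (cR s ^+ k * u) <= rn u by rewrite rnM rnX ns ler_piMl ?rn_ge0.
have mk k : rn (y ^+ k) <= 1 by rewrite rnX exprn_ile1 // ltW.
have yW k : rn (y ^+ k * w) <= W by rewrite rnM ler_piMl.
(* A coordinate of order m^2 that grows by at most W <= m^2 has a square growing by at most a
   multiple of W m^2. *)
have sqb (u v A : R) : 0 <= v -> v <= u + W -> u <= A * m ^+ 2 -> v ^+ 2 <= u ^+ 2 + W * ((2 * A + 1) * m ^+ 2).
  move=> v0 vu uA.
  have h : v ^+ 2 <= (u + W) ^+ 2 by rewrite lerXn2r ?nnegrE //; apply: le_trans vu.
  apply: le_trans h _; rewrite (_ : (u + W) ^+ 2 = u ^+ 2 + W * (2 * u + W)); last by ring.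
  rewrite lerD2l; apply: ler_wpM2l => //.
  rewrite (_ : (2 * A + 1) * m ^+ 2 = 2 * (A * m ^+ 2) + m ^+ 2); last by ring.
  by apply: lerD; [rewrite ler_pM2l|exact: WW].
have m3 : m ^+ 3 <= m ^+ 2 by rewrite exprS ler_piMl.
have c1 : rn x' <= rn x + W.
  rewrite (_ : x' = cR s ^+ 2 * x + w); last by rewrite /w; ring.
  by apply: le_trans (rnD _ _) _; rewrite lerD2r.
have c2 : rn (x' * (cR s * y) ^+ 3) <= rn (x * y ^+ 3) + W.
  rewrite (_ : x' * _ = cR s ^+ 5 * (x * y ^+ 3) + cR s ^+ 3 * (y ^+ 3 * w)); last by rewrite /w; ring.
  by apply: le_trans (rnD _ _) _; apply: lerD => //; apply: le_trans (yW 3%N).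
have c3 : rn (x' * (cR s * y) + (cR s * y) ^+ 3) <= rn (x * y + y ^+ 3) + W.
  rewrite (_ : _ + _ ^+ 3 = cR s ^+ 3 * (x * y + y ^+ 3) + cR s ^+ 1 * (y ^+ 1 * w)); last by rewrite /w; ring.
  by apply: le_trans (rnD _ _) _; apply: lerD => //; apply: le_trans (yW 1%N).
have b2 : rn (x * y ^+ 3) <= C1 * m ^+ 2.
  by rewrite rnM; apply: le_trans hx; rewrite ler_piMr ?rn_ge0.
have b3 : rn (x * y + y ^+ 3) <= (C1 + 1) * m ^+ 2.
  apply: le_trans (rnD _ _) _; rewrite mulrDl mul1r; apply: lerD; last by rewrite rnX.
  by rewrite rnM; apply: le_trans hx; rewrite ler_piMr ?rn_ge0.
have d1 := sqb _ _ _ (rn_ge0 _) c1 hx.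
have d2 := sqb _ _ _ (rn_ge0 _) c2 b2.
have d3 := sqb _ _ _ (rn_ge0 _) c3 b3.
(* The gain comes from s^4 <= s, that is, 1 - s^4 >= e. *)
have d4 : rn ((cR s * y) ^+ 2) ^+ 2 <= rn (y ^+ 2) ^+ 2 - e * (m ^+ 2) ^+ 2.
  rewrite !rnX rnM ns -/m.
  have h : s ^+ 4 <= s by rewrite exprS ler_piMr // exprn_ile1.
  have h2 : s ^+ 4 * (m ^+ 2) ^+ 2 <= s * (m ^+ 2) ^+ 2 by rewrite ler_wpM2r // exprn_ge0.
  rewrite /e; move: h2; congr (_ <= _); ring.
have d5 : W * ((6 * C1 + 5) * m ^+ 2) <= e * (m ^+ 2) ^+ 2.
  have h : 0 <= (6 * C1 + 5) * m ^+ 2 by rewrite mulr_ge0 // ltW.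
  apply: le_trans (ler_wpM2r h WB) _.
  rewrite (_ : ep * (e * m ^+ 2) * ((6 * C1 + 5) * m ^+ 2) = ep * (6 * C1 + 5) * (e * (m ^+ 2) ^+ 2)); last by ring.
  by rewrite epk mul1r.
rewrite /rho /sqnorm4 !F_pt2 !pt4s.
have d6 : W * ((6 * C1 + 5) * m ^+ 2) = W * ((2 * C1 + 1) * m ^+ 2) + W * ((2 * C1 + 1) * m ^+ 2) + W * ((2 * (C1 + 1) + 1) * m ^+ 2) by ring.
by move: d1 d2 d3 d4 d5 d6; lra.
Qed.

End MilnorFibre.

(** * Contraction of the Milnor fibre *)

Section FibreContraction.
Variables (R : realType) (K : numClosedFieldType) (S : real_structure R K).
Local Notation rn := (rn S).
Local Notation cR := (cR S).
Local Notation Y := (range (@F K)).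
Local Notation I := (`[(0 : R), (1 : R)]%classic).

Variables (g : 'rV[K]_4 -> K) (r1 r2 dl C m3 sg : R).
Local Notation gF x y := (g (F (pt2 x y))).
Hypothesis g0 : g 0 = 0.
Hypothesis r11 : r1 <= 1.
Hypothesis r20 : 0 < r2.
Hypothesis r21 : r2 <= r1.
Hypothesis C0 : 0 < C.
Hypothesis solve : forall y lam, rn y <= r2 -> rn lam <= dl ->
  exists x, [/\ rn x <= r1, rn x <= C * (rn y ^+ 2 + rn lam) & gF x y = lam].
Hypothesis lip : forall x y x' y', rn x <= r1 -> rn x' <= r1 -> rn y <= r2 -> rn y' <= r2 ->
  gF x y = gF x' y' -> rn (x - x') <= C * rn (y - y').
Hypothesis m30 : 0 < m3.
Hypothesis sg0 : 0 < sg.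
Hypothesis shrinkH : forall x y x' lam s, 0 <= s -> s <= 1 -> y != 0 -> rn y <= m3 -> rn lam <= sg * rn y ^+ 2 ->
  gF x y = lam -> gF x' (cR s * y) = lam -> rn x <= 2 * C * rn y ^+ 2 -> rn x' <= 2 * C * rn y ^+ 2 ->
  rho S (pt2 x' (cR s * y)) <= rho S (pt2 x y).

(** If |lambda| and |y|^2 are at most kap e, then |x| <= 2 C kap e, and so 2 |x| + 2 |y|^2 <= e. *)
Let kap := (4 * C + 2)^-1.

Lemma kap_gt0 : 0 < kap.
Proof. by rewrite invr_gt0 ltr_wpDl // mulr_ge0 // ltW. Qed.

Lemma solution_unique x x' y : rn x <= r1 -> rn x' <= r1 -> rn y <= r2 -> gF x y = gF x' y -> x = x'.
Proof.
move=> hx hx' hy E; have := lip hx hx' hy hy E.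
by rewrite subrr rn0 mulr0 => h; apply/eqP; rewrite -subr_eq0 -(rn_eq0 S) eq_le h rn_ge0.
Qed.

(** By uniqueness x is the solution provided by [solve] and inherits its bound. *)
Lemma solution_bound x y : rn x <= r1 -> rn y <= r2 -> rn (gF x y) <= dl ->
  rn x <= C * (rn y ^+ 2 + rn (gF x y)).
Proof.
move=> hx hy hl; have [x' [hx' hb E]] := solve hy hl.
rewrite (solution_unique hx hx' hy (esym E)); by move: hb; rewrite -(solution_unique hx hx' hy (esym E)).
Qed.

(** For |y| <= 1 the squared norm of F(x, y) is at most (2 |x| + 2 |y|^2)^2, and [kap] is made for
    this sum. *)
Lemma small_in_ball x y e : rn x <= r1 -> rn y <= r2 -> rn (gF x y) <= dl ->
  rn (gF x y) <= kap * e -> rn y ^+ 2 <= kap * e -> rho S (pt2 x y) <= e ^+ 2.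
Proof.
move=> hx hy hl hle hye; have hb := solution_bound hx hy hl.
have k1 : kap * (4 * C + 2) = 1 by rewrite mulVf // gt_eqF // -invr_gt0 kap_gt0.
have y1 : rn y <= 1 by apply: le_trans hy (le_trans r21 r11).
set u := rn x in hb *; set v := rn y ^+ 2 in hye hb *.
have u0 : 0 <= u := rn_ge0 _.
have v0 : 0 <= v by rewrite exprn_ge0 // rn_ge0.
have uv : 2 * u + 2 * v <= e.
  have h : u <= C * (kap * e + kap * e) by apply: le_trans hb _; rewrite ler_pM2l // lerD.
  have -> : e = 2 * (C * (kap * e + kap * e)) + 2 * (kap * e).
    by rewrite -[LHS]mul1r -[X in X * e]k1; ring.
  lra.
have c2 : rn (x * y ^+ 3) <= u.
  by rewrite rnM rnX ler_piMr // exprn_ile1 // rn_ge0.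
have c3 : rn (x * y + y ^+ 3) <= u + v.
  apply: le_trans (rnD _ _) _; rewrite rnM rnX; apply: lerD; first by rewrite ler_piMr.
  by rewrite exprS ler_piMl // exprn_ge0 // rn_ge0.
apply: (@le_trans _ _ ((2 * u + 2 * v) ^+ 2)); last first.
  by rewrite lerXn2r ?nnegrE // ?(le_trans _ uv) // addr_ge0 // mulr_ge0.
rewrite /rho /sqnorm4 F_pt2 !pt4s rnX -/u -/v.
have d2 : rn (x * y ^+ 3) ^+ 2 <= u ^+ 2 by rewrite lerXn2r ?nnegrE ?rn_ge0.
have d3 : rn (x * y + y ^+ 3) ^+ 2 <= (u + v) ^+ 2 by rewrite lerXn2r ?nnegrE ?rn_ge0 // addr_ge0.
have uu : 0 <= u ^+ 2 by rewrite exprn_ge0.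
have vv : 0 <= v ^+ 2 by rewrite exprn_ge0.
have uv0 : 0 <= u * v by rewrite mulr_ge0.
have E1 : (u + v) ^+ 2 = u ^+ 2 + 2 * (u * v) + v ^+ 2 by ring.
have E2 : (2 * u + 2 * v) ^+ 2 = 4 * u ^+ 2 + 8 * (u * v) + 4 * v ^+ 2 by ring.
by rewrite E2; rewrite E1 in d3; lra.
Qed.

(* If |s y|^2 is small compared with e, then so is x'; otherwise lambda is small compared with |y|^2 and the points move inwards. *)
Lemma star_shaped x y x' s e : 0 <= s -> s <= 1 -> 0 < e -> rn x <= r1 -> rn x' <= r1 -> rn y <= r2 -> rn y <= m3 ->
  gF x y = gF x' (cR s * y) -> rn (gF x y) <= dl -> rn (gF x y) <= kap * e -> rn (gF x y) <= sg * (kap * e) ->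
  rho S (pt2 x y) <= e ^+ 2 -> rho S (pt2 x' (cR s * y)) <= e ^+ 2.
Proof.
move=> s0 s1 e0 hx hx' hy hm E hd hk hsk hr.
have sy : rn (cR s * y) <= rn y by rewrite rnM rn_cR ger0_norm // ler_piMl // rn_ge0.
have hy' := le_trans sy hy.
have [small|big] := leP (rn (cR s * y) ^+ 2) (kap * e).
  by apply: small_in_ball; rewrite -?E.
have sy2 : rn (cR s * y) ^+ 2 <= rn y ^+ 2 by rewrite lerXn2r ?nnegrE ?rn_ge0.
have by2 : kap * e < rn y ^+ 2 := lt_le_trans big sy2.
have ke : 0 < kap * e by rewrite mulr_gt0 // kap_gt0.
have y0 : y != 0 by apply: contraTneq by2 => ->; rewrite rn0 expr0n /= -leNgt ltW.
apply: le_trans hr; apply: (shrinkH s0 s1 y0 hm _ erefl (esym E)).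
- by apply: le_trans hsk _; rewrite ler_pM2l // ltW.
- apply: le_trans (solution_bound hx hy hd) _.
  rewrite (mulrC 2) -mulrA ler_pM2l // mulr_natl mulr2n lerD2l; apply: le_trans hk _; exact: ltW.
- apply: le_trans (solution_bound hx' hy' _) _; rewrite -E //.
  rewrite (mulrC 2) -mulrA ler_pM2l // mulr_natl mulr2n; apply: lerD => //; apply: le_trans hk _; exact: ltW.
Qed.

(** The fibre is a graph over y: the homotopy multiplies y by 1 - t, solves again for x, and stays
    in the ball by [star_shaped]. The bounds on e put the whole fibre where the solution is
    unique. *)
Lemma milnor_fibre_contractible (e : R) (lam : K) :
  0 < e -> e <= r1 -> e <= r2 ^+ 2 -> e <= m3 ^+ 2 -> lam != 0 ->
  rn lam <= dl -> rn lam <= kap * e -> rn lam <= sg * (kap * e) ->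
  contractible R (milnor_fibre Y 0 g (cR e) lam).
Proof.
move=> e0 e1 e2 e3 lam0 hd hk hsk.
set A := milnor_fibre _ _ _ _ _.
have AP z : A (F z) <-> rho S z <= e ^+ 2 /\ g (F z) = lam.
  split=> [[[_ /=]]|[h1 h2]]; first by rewrite (eucl_le S).
  by split=> //; split; [exists z|rewrite /= (eucl_le S)].
have AE q : A q -> [/\ q = F (pt2 (F_inv q 0 0) (F_inv q 0 1)), rn (F_inv q 0 0) <= r1, rn (F_inv q 0 1) <= r2 & rn (F_inv q 0 1) <= m3].
  move=> Aq; have [[[z _ zq] _] _] := Aq; move: Aq; rewrite -zq FK -pt2E => /AP[hr _].
  (* x and y^2 are coordinates of F, so the ball bounds both by e. *)
  have [c0 c1] : rn (z 0 0) <= e /\ rn (z 0 1) ^+ 2 <= e.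
    move: hr; rewrite /rho /sqnorm4 F_pt4 !pt4s rnX => hr.
    have n (u : K) : 0 <= rn u ^+ 2 by rewrite exprn_ge0 // rn_ge0.
    have := n (z 0 0); have := n (z 0 0 * z 0 1 ^+ 3); have := n (z 0 0 * z 0 1 + z 0 1 ^+ 3).
    have n4 : 0 <= (rn (z 0 1) ^+ 2) ^+ 2 by rewrite exprn_ge0 // n.
    move=> n1 n2 n3; split.
      by rewrite -(@ler_pXn2r _ 2%N) ?nnegrE ?rn_ge0 ?(ltW e0) //; lra.
    by rewrite -(@ler_pXn2r _ 2%N) ?nnegrE ?n ?(ltW e0) //; lra.
  split=> //; first exact: le_trans c0 e1.
  - by rewrite -(@ler_pXn2r _ 2%N) ?nnegrE ?rn_ge0 ?(ltW r20) //; exact: le_trans c1 e2.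
  - by rewrite -(@ler_pXn2r _ 2%N) ?nnegrE ?rn_ge0 ?(ltW m30) //; exact: le_trans c1 e3.
(* A solution exists for |y| <= r2; the default 0 concerns larger y only. *)
pose phi (y : K) : K := xget 0 [set x | rn x <= r1 /\ gF x y = lam].
have phiP y : rn y <= r2 -> rn (phi y) <= r1 /\ gF (phi y) y = lam.
  move=> hy; have [x [hx _ E]] := solve hy hd.
  exact: (@xgetPex _ 0 [set x | rn x <= r1 /\ gF x y = lam] (ex_intro _ x (conj hx E))).
pose h (p : 'rV[K]_4 * R) : K := cR (1 - p.2) * F_inv p.1 0 1.
have hI q t : A q -> I t -> rn (h (q, t)) <= r2.
  move=> /AE[_ _ hy _]; rewrite /= in_itv /= => /andP[t0 t1].
  rewrite /h rnM rn_cR ger0_norm ?subr_ge0 //; apply: le_trans hy.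
  by rewrite ler_piMl ?rn_ge0 // gerBl.
have r2' := ltW r20.
exists (F (pt2 (phi 0) 0)), (fun p => F (pt2 (phi (h p)) (h p))); split.
- have z2 : rn (0 : K) <= r2 by rewrite rn0.
  have [h1 h2] := phiP 0 z2; apply/AP; split=> //.
  by apply: small_in_ball => //; rewrite ?h2 // rn0 expr0n /= ltW // mulr_gt0 // kap_gt0.
- apply/subspace_continuousP => -[q t] [/= Aq It].
  set Fl := within _ _.
  have FlP : \forall p \near Fl, A p.1 /\ I p.2.
    by apply: (@filterE _ (nbhs (q, t)) _ (fun p => (A `*` I) p -> A p.1 /\ I p.2)).
  have to2 : (fun p : 'rV[K]_4 * R => p.2) @ Fl --> t.
    exact: (cvg_trans (cvg_fmap2 (cvg_within _)) (@cvg_snd _ _ (nbhs q) (nbhs t) _)).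
  have to1 : (fun p : 'rV[K]_4 * R => p.1) @ Fl --> q.
    exact: (cvg_trans (cvg_fmap2 (cvg_within _)) (@cvg_fst _ _ (nbhs q) (nbhs t) _)).
  (* lambda != 0 keeps the fibre away from 0, the point excluded in [F_inv_cvg]. *)
  have q0 : q != 0 by apply: contraNneq lam0 => q0; case: Aq => _ /= <-; rewrite q0 g0.
  have Yq : Y q by case: Aq => -[].
  have toG : (fun p : 'rV[K]_4 * R => F_inv p.1) @ Fl --> F_inv q.
    by apply: (F_inv_cvg S Yq q0 to1); apply: filterS FlP => p [[[]]].
  have toy : (fun p : 'rV[K]_4 * R => F_inv p.1 0 1) @ Fl --> F_inv q 0 1.
    exact: (cvg_comp _ _ toG (@coord_continuous K 1 2 0 1 (F_inv q))).
  have tos : (fun p : 'rV[K]_4 * R => 1 - p.2) @ Fl --> 1 - t.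
    by apply: cvgB => //; exact: cvg_cst.
  have toh : h @ Fl --> h (q, t).
    exact: (cvgM (cvg_comp _ _ tos (@cR_continuous R K S (1 - t))) toy).
  (* The Lipschitz bound holds between any two small solutions, so the arbitrary choice of phi is
     continuous. *)
  have tophi : (fun p => phi (h p)) @ Fl --> phi (h (q, t)).
    apply: (cvg_rnP S _ _).2 => d d0.
    have dC : 0 < d / C by rewrite divr_gt0.
    have hn : \forall p \near Fl, rn (h p - h (q, t)) < d / C by exact: ((cvg_rnP S h _).1 toh _ dC).
    apply: filterS2 FlP hn => -[p s] [/= Ap Is] hp.
    have [p1 p2] := phiP _ (hI _ _ Ap Is); have [q1 q2] := phiP _ (hI _ _ Aq It).
    apply: le_lt_trans (lip p1 q1 (hI _ _ Ap Is) (hI _ _ Aq It) _) _; first by rewrite p2 q2.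
    by rewrite mulrC -ltr_pdivlMr.
  exact: (cvg_comp _ _ (cvg_pt2 S tophi toh) (@F_continuous R K S _)).
move=> q Aq; have [qE hx hy hm] := AE q Aq.
have gq : gF (F_inv q 0 0) (F_inv q 0 1) = lam by rewrite -qE; case: Aq.
have rq : rho S (pt2 (F_inv q 0 0) (F_inv q 0 1)) <= e ^+ 2 by have /AP[] : A (F (pt2 (F_inv q 0 0) (F_inv q 0 1))) by rewrite -qE.
split.
- have [p1 p2] := phiP _ hy; rewrite /h /= subr0 cR1 mul1r [RHS]qE.
  by rewrite (solution_unique p1 hx hy) // p2 gq.
- by rewrite /h /= subrr cR0 mul0r.
move=> t It; have [p1 p2] := phiP _ (hI q t Aq It).
move: It; rewrite in_itv /= => /andP[t0 t1]; apply/AP; split=> //.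
by apply: (@star_shaped _ _ _ _ _ _ _ e0 hx p1 hy hm); rewrite ?subr_ge0 ?gerBl // ?gq // p2.
Qed.

End FibreContraction.

(** * Complex link, link and failure of Mumford's criterion *)

Section ComplexLink.
Variables (R : realType) (K : numClosedFieldType) (S : real_structure R K).
Local Notation rn := (rn S).
Local Notation cR := (cR S).
Local Notation Y := (range (@F K)).

Lemma complex_link_contractible : contractible_complex_link R Y 0.
Proof.
move=> SS g WS hg g0 gen.
have [L [M [r [r0 M0 dL strict]]]] := holo_strict_d S hg.
have a0 : L i0 0 != 0.
  have := general_direction S WS hg gen; rewrite dL mxE !big_ord_recl big_ord0 !mxE /= !mul0r !addr0 mul1r.
  by rewrite (_ : ord0 = i0) //; apply: val_inj.
have st : forall s z w, 0 < s -> s <= r -> rn z <= s -> rn w <= s ->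
    rn (g z - g w - ((z - w) *m L) 0 0) <= M * s * rn (z - w).
  by move=> s z w s0 sr hz hw; apply: strict => //; rewrite subr0.
have [r1 [r2 [dl [C [r10 r11 [r20 r21] [dl0 C0] [sol lip]]]]]] := solve_x r0 M0 st g0 a0.
(* In the regime where points are shrunk, |lambda| <= |y|^2, so the bound C (|y|^2 + |lambda|)
   becomes 2 C |y|^2. *)
have C20 : 0 <= 2 * C by rewrite mulr_ge0 // ltW.
have [m3 [sg [m30 sg0 shrinkH]]] := shrink r0 M0 st g0 a0 C20.
pose e0 := Num.min r1 (Num.min (r2 ^+ 2) (m3 ^+ 2)).
have e00 : 0 < e0 by rewrite !lt_min r10 !exprn_gt0.
exists (cR e0); first by rewrite -(cR0 S) cR_lt.
move=> _ /andP[/(pos_cR S)[e e_0 ->]]; rewrite cR_lt => ee.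
have [e1 e2 e3] : [/\ e <= r1, e <= r2 ^+ 2 & e <= m3 ^+ 2].
  by move: ee; rewrite !lt_min => /and3P[/ltW ? /ltW ? /ltW ?].
pose k := (4 * C + 2)^-1.
have k0 : 0 < k by rewrite invr_gt0 ltr_wpDl // mulr_ge0 // ltW.
(* Below dl the equation is solvable; k e and sg k e are the thresholds of the two regimes of
   [star_shaped]. *)
pose del := Num.min dl (Num.min (k * e) (sg * (k * e))).
exists (cR del); first by rewrite -(cR0 S) cR_lt !lt_min dl0 !mulr_gt0.
move=> lam /andP[l0]; rewrite rn_lt !lt_min => /and3P[/ltW h1 /ltW h2 /ltW h3].
have l0' : lam != 0 by rewrite -normr_gt0.
exact: (milnor_fibre_contractible g0 r11 r20 r21 C0 sol lip m30 sg0 shrinkH e_0 e1 e2 e3 l0' h1 h2 h3).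
Qed.

End ComplexLink.

Lemma simply_connected_link_Y (R : realType) (K : numClosedFieldType) (S : real_structure R K) :
  simply_connected_link R (range (@F K)) 0.
Proof.
by exists 1 => // _ /andP[/(pos_cR S)[e e0 ->] _]; exact: link_simply_connected.
Qed.

(** It is the implication from a simply connected link to smoothness that fails, for the germ of Y
    at 0. *)
Lemma not_mumford_criterion (R : realType) (K : numClosedFieldType) (S : real_structure R K) :
  ~ mumford_criterion R (@surface_germ_isol K).
Proof.
move=> H; have [Y0sing isol] := isolated_Y S.
have [_ _ pd] := surface_Y S.
apply: (not_smooth_Y0 S); apply/(H 4 (range (@F K)) 0); last exact: (simply_connected_link_Y S).
split=> //; split; [exact: Y0|exact: (@analytic_Y K)|].
by apply: (@filterE _ (nbhs (0 : 'rV[K]_4))) => q; exact: pd.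
Qed.

Theorem mainTheorem2 (R : realType) :
  let C := complex_field R in
  let Y : set 'rV[C]_4 := range (@F C) in
  [/\ injective (@F C) /\ proper_map (@F C),
      surface Y /\ ~ complete_intersection_at 2 Y 0,
      isolated_singularity Y 0,
      contractible_complex_link R Y 0
    & simply_connected_link R Y 0] /\
  ~ mumford_criterion R (@surface_germ_isol C).
Proof.
move=> C Y; pose S := complex_real_structure R.
split; last exact: (not_mumford_criterion S).
split; [split; [exact: F_inj|exact: (F_proper S)]|split; [exact: (surface_Y S)|exact: (not_ci_Y0 S)]| | |].
- exact: (isolated_Y S).
- exact: (complex_link_contractible S).
- exact: (simply_connected_link_Y S).
Qed.
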